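(* There is a constant $C$ with the following property: for every non-trivial word $w$ there is an integer $n_w$ such that, for all integers $n>n_w$, every element of $\mathrm{SL}_n(\mathbb{Z})$ is a product of at most $C$ elements of $w(\mathrm{SL}_n(\mathbb{Z}))$. In fact, $C$ can be taken to be equal to $87$.
   Context: A word is an element $w=w(x_1,\ldots,x_d)$ of a free group $F_d$ of finite rank $d$; it is non-trivial if it is not the identity of $F_d$. For a group $\Gamma$, the set of $w$-values is $w(\Gamma):=\{w(g_1,\ldots,g_d),\ w(g_1,\ldots,g_d)^{-1}\mid g_1,\ldots,g_d\in\Gamma\}$, where $w(g_1,\ldots,g_d)$ is obtained by substitution. *)

(* Defs.v *)
From HB Require Import structures.
From mathcomp Require Import all_boot all_algebra.

Set Implicit Arguments.
Unset Strict Implicit.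
Unset Printing Implicit Defensive.

Import GRing.Theory.

(* The free group F_d is modelled by its normal forms: the reduced sequences
   of letters.  The letter (i, false) stands for x_i, and (i, true) for its
   formal inverse. *)
Section FreeGroup.
Variable d : nat.

Definition letter : Type := 'I_d * bool.

Definition linv (a : letter) : letter := (a.1, ~~ a.2).

Definition reduced (s : seq letter) : bool := sorted (fun a b => b != linv a) s.

Record free_group := FreeWord {
  fword :> seq letter;
  fword_reduced : reduced fword
}.

HB.instance Definition _ := [isSub for fword].
HB.instance Definition _ := [Choice of free_group by <:].

Definition red_cons (a : letter) (s : seq letter) : seq letter :=
  if s is b :: s' then if b == linv a then s' else a :: s else [:: a].

Definition red_cat (s t : seq letter) : seq letter := foldr red_cons t s.

Definition red_inv (s : seq letter) : seq letter := rev (map linv s).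

Lemma linvK : involutive linv.
Proof. by case=> i b; rewrite /linv negbK. Qed.

Lemma reduced_behead a s : reduced (a :: s) -> reduced s.
Proof. exact: path_sorted. Qed.

Lemma reduced_red_cons a s : reduced s -> reduced (red_cons a s).
Proof.
case: s => [|b s] //= rs; case: ifP => [_|/negbT nba] /=; last by rewrite nba.
exact: path_sorted rs.
Qed.

Lemma red_consK a s :
  reduced s -> red_cons a (red_cons (linv a) s) = s.
Proof.
case: s => [|b s] /= rs; first by rewrite eqxx.
rewrite linvK; case: eqVneq rs => [->|nba] rs; last by rewrite /= eqxx.
by case: s rs => [|c s] //= /andP[/negPf->].
Qed.

Lemma reduced_red_cat s t : reduced t -> reduced (red_cat s t).
Proof. by move=> rt; elim: s => //= a s IHs; apply: reduced_red_cons. Qed.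

Lemma red_cat_red_cons a s t :
  reduced t -> red_cat (red_cons a s) t = red_cons a (red_cat s t).
Proof.
move=> rt; case: s => [|b s] //=; case: ifP => [/eqP->|//].
by rewrite red_consK // reduced_red_cat.
Qed.

Lemma red_catA s t u : reduced u -> red_cat s (red_cat t u) = red_cat (red_cat s t) u.
Proof. by move=> ru; elim: s => //= a s ->; rewrite red_cat_red_cons. Qed.

Lemma red_cats0 s : reduced s -> red_cat s [::] = s.
Proof.
elim: s => //= a s IHs ras; rewrite IHs ?(reduced_behead ras) //.
by case: s ras {IHs} => [|b s] //= /andP[/negPf->].
Qed.

Lemma reduced_red_inv s : reduced s -> reduced (red_inv s).
Proof.
rewrite /reduced /red_inv -map_rev sorted_map rev_sorted.
apply: sub_sorted => a b; rewrite /= linvK.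
by apply: contraNneq => ->.
Qed.

Lemma red_catK s t : reduced t -> red_cat (red_inv s) (red_cat s t) = t.
Proof.
elim: s t => //= a s IHs t rt.
rewrite /red_inv /= rev_cons -cats1 /red_cat foldr_cat /= -/(red_cat s t).
rewrite -{2}[a]linvK red_consK ?reduced_red_cat //; exact: IHs.
Qed.

Definition free_one := FreeWord (isT : reduced [::]).
Definition free_mul (u v : free_group) :=
  FreeWord (reduced_red_cat u (fword_reduced v)).
Definition free_inv (u : free_group) := FreeWord (reduced_red_inv (fword_reduced u)).

Lemma free_mulA : associative free_mul.
Proof. by move=> u v w; apply: val_inj; rewrite /= red_catA ?fword_reduced. Qed.

Lemma free_mul1 : left_id free_one free_mul.
Proof. by move=> u; apply: val_inj. Qed.

Lemma free_mulr1 : right_id free_one free_mul.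
Proof. by move=> u; apply: val_inj; rewrite /= red_cats0 ?fword_reduced. Qed.

Lemma free_mulV : left_inverse free_one free_inv free_mul.
Proof.
move=> u; apply: val_inj; rewrite /= -{2}[fword u]red_cats0 ?fword_reduced //.
exact: red_catK.
Qed.

Lemma red_invK : involutive red_inv.
Proof. by move=> s; rewrite /red_inv map_rev revK mapK //; apply: linvK. Qed.

Lemma free_mulrV : right_inverse free_one free_inv free_mul.
Proof.
move=> u; rewrite -{1}[u](_ : free_inv (free_inv u) = u) ?free_mulV //.
by apply: val_inj; rewrite /= red_invK.
Qed.

HB.instance Definition _ := isGroup.Build free_group
  free_mulA free_mul1 free_mulr1 free_mulV free_mulrV.

Definition free_gen (i : 'I_d) : free_group :=
  FreeWord (isT : reduced [:: (i, false)]).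

End FreeGroup.

Section WordValues.
Local Open Scope group_scope.
Variables (d : nat) (G : groupType).

Definition letter_eval (g : 'I_d -> G) (a : letter d) : G :=
  if a.2 then (g a.1)^-1 else g a.1.

Definition word_eval (w : free_group d) (g : 'I_d -> G) : G :=
  \prod_(a <- fword w) letter_eval g a.

Definition word_value (w : free_group d) (x : G) : Prop :=
  exists g : 'I_d -> G, x = word_eval w g \/ x = (word_eval w g)^-1.

(* word_eval ^~ g is the homomorphism F_d -> G sending x_i to g i. *)

Lemma word_eval_gen g i : word_eval (free_gen i) g = g i.
Proof. by rewrite /word_eval big_seq1. Qed.

Lemma letter_evalV g a : letter_eval g (linv a) = (letter_eval g a)^-1.
Proof. by case: a => i [] /=; rewrite /letter_eval /= ?invgK. Qed.

Lemma word_evalM g u v :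
  word_eval (u * v) g = word_eval u g * word_eval v g.
Proof.
rewrite /word_eval /=; elim: (fword u) => [|a s IHs] /=.
  by rewrite big_nil mul1g.
rewrite big_cons -mulgA -IHs; case: (red_cat s v) => [|b t] /=.
  by rewrite big_seq1 big_nil mulg1.
case: eqP => [->|_]; last by rewrite big_cons.
by rewrite big_cons letter_evalV mulVKg.
Qed.

End WordValues.

Section SpecialLinear.
Local Open Scope ring_scope.
Variables (n : nat) (R : comUnitRingType).

Record SL := MkSL { slmx :> 'M[R]_n; slmx_det : \det slmx == 1 }.

HB.instance Definition _ := [isSub for slmx].
HB.instance Definition _ := [Choice of SL by <:].

Lemma SL_unit (A : SL) : slmx A \in unitmx.
Proof. by rewrite unitmxE (eqP (slmx_det A)) unitr1. Qed.

Fact SL_one_subproof : \det (1%:M : 'M[R]_n) == 1.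
Proof. by rewrite det1. Qed.

Fact SL_mul_subproof (A B : SL) : \det (slmx A *m slmx B) == 1.
Proof. by rewrite det_mulmx (eqP (slmx_det A)) (eqP (slmx_det B)) mulr1. Qed.

Fact SL_inv_subproof (A : SL) : \det (invmx (slmx A)) == 1.
Proof. by rewrite det_inv (eqP (slmx_det A)) invr1. Qed.

Definition SL_one := MkSL SL_one_subproof.
Definition SL_mul (A B : SL) := MkSL (SL_mul_subproof A B).
Definition SL_inv (A : SL) := MkSL (SL_inv_subproof A).

Lemma SL_mulA : associative SL_mul.
Proof. by move=> A B C; apply: val_inj; rewrite /= mulmxA. Qed.

Lemma SL_mul1 : left_id SL_one SL_mul.
Proof. by move=> A; apply: val_inj; rewrite /= mul1mx. Qed.

Lemma SL_mulr1 : right_id SL_one SL_mul.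
Proof. by move=> A; apply: val_inj; rewrite /= mulmx1. Qed.

Lemma SL_mulV : left_inverse SL_one SL_inv SL_mul.
Proof. by move=> A; apply: val_inj; rewrite /= mulVmx ?SL_unit. Qed.

Lemma SL_mulrV : right_inverse SL_one SL_inv SL_mul.
Proof. by move=> A; apply: val_inj; rewrite /= mulmxV ?SL_unit. Qed.

HB.instance Definition _ := isGroup.Build SL
  SL_mulA SL_mul1 SL_mulr1 SL_mulV SL_mulrV.

End SpecialLinear.

Definition prod_of_at_most (G : groupType) (C : nat) (P : G -> Prop) (x : G)
  : Prop :=
  exists s : seq G,
    [/\ size s <= C, forall y : G, y \in s -> P y & x = (\prod_(y <- s) y)%g].

Definition SLZ_word_width_bound (C : nat) : Prop :=
  forall (d : nat) (w : free_group d), w <> 1%g ->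
  exists n_w : nat, forall n : nat, n_w < n ->
  forall A : SL n int, prod_of_at_most C (word_value w) A.

(* Main.v *)
(* Conjugates of w-values by GL_n(Z) are w-values, and w has permutation
   values that move almost every basis vector (up to a bounded remainder) off
   itself and off its second image.  If t is such a value then
   [[1, X], [0, 1]] t [[1, X], [0, 1]]^-1 t^-1 = [[1, X - t X], [0, 1]], and
   together with a suitable conjugate of t this reaches every block matrix
   [[1, V], [0, 1]] with many rows: such a matrix is a product of 4 w-values.
   Two conjugates of such blocks normalise the superdiagonal of a unitriangular
   matrix to 1; it is then conjugate to the Jordan block, hence to a product of
   two more of them, so every unitriangular matrix is a product of 16 w-values.

   By the stable range condition a matrix of SL_n(Z) is L U L U (1 + B) with L, U
   unitriangular and B in SL_2(Z).  By bounded generation, B + 1 is a product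
   t_1 ... t_71 of conjugates of elementary matrices of SL_3(Z).  The block
   matrix diag(t_1, ..., t_71) costs only 4 w-values, and it differs from
   diag(1, ..., 1, B + 1) by two commutators of a block diagonal matrix of partial
   products with a permutation w-value moving its blocks to fresh positions.
   In total 4 * 16 + 8 = 72 w-values suffice.

   Bounded generation rests on Mennicke's multiplicativity of the first row and on
   Dirichlet's theorem on primes in progressions.  The latter is proved over the
   reals, without complex characters: the operator u |-> (n |-> sum_k u(nk)/k) on
   mean-zero functions on the units mod q is injective, since a non-zero element
   of its kernel yields a real character with vanishing L(1); hence it is
   surjective, and comparing with sums of the von Mangoldt function shows that
   each reduced residue class contains infinitely many primes. *)

Require Import Defs.
From mathcomp Require Import all_boot all_order all_algebra all_fingroup cyclic.
From mathcomp Require Import boolp classical_sets reals exp Rstruct.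
From mathcomp Require Import ring lra zify.

Set Implicit Arguments.
Unset Strict Implicit.
Unset Printing Implicit Defensive.

Import Order.TTheory GRing.Theory Num.Theory.

(** * Permutation values of words *)

(** The number of factors must not depend on [w], so [w] enters through one integer [e] only: the
    order of a finite symmetric group in which some value q of [w] satisfies q != 1 and q * q != 1.
    In the regular representation, repeated along the coordinates, q and q * q have no fixed points
    on the blocks, for every n at once, and [e] affects nothing but the size thresholds. Cycles of
    length at least 3 are what makes the images of 1 - T and of a conjugate of it span everything;
    letters are replaced by squares so that all permutations are even, that is, of determinant 1.

    The saving comes from commutators: w-values are closed under inversion and conjugation, so a
    commutator with a w-value costs 2, however complicated its other entry is. A long product of
    elementary conjugates is therefore spread over disjoint blocks, where its length 71 influences
    the required n but not the cost. That length is 34 + 34 for two powers of a matrix with prime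
    off-diagonal entries, 2 for making these entries prime, and 1 for a zero corner. The room of
    SL_3 is needed for Mennicke's relation, whose factors use a third coordinate. *)

Section WordsAndPermutations.
Local Open Scope group_scope.

Lemma perm_extend (T : finType) (s t : seq T) : uniq s -> uniq t -> size s = size t ->
  exists p : {perm T}, map p s = t.
Proof.
elim: s t => [|x s IH] [|y t] //=; first by exists 1.
move=> /andP[xs us] /andP[yt ut] [/(IH _ us ut)[p pst]].
exists (p * tperm (p x) y); rewrite permM tpermL; congr cons.
rewrite -pst; apply/eq_in_map => z zs; rewrite permM tpermD //.
  by apply: contraNneq xs => /perm_inj->.
by apply: contraNneq yt => ->; rewrite -pst map_f.
Qed.

Section PathAction.
Variable d : nat.
Implicit Types (s : seq (letter d)) (a b : letter d).

Lemma reduced_nth a0 s k : reduced s -> (k.+1 < size s)%N -> nth a0 s k.+1 != linv (nth a0 s k).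
Proof. by move=> /(sortedP a0) H ks; apply: H. Qed.

(* The letters of [s] label the edges of the path 0 - 1 - ... - size s; as [s]
   is reduced, the edges with a given label form a partial injection. *)
Lemma path_action s : reduced s -> s != [::] ->
  exists g : 'I_d -> {perm 'I_(size s).+1}, \prod_(a <- s) letter_eval g a <> 1.
Proof.
move=> rs snil; have [a0 _] : exists a0, a0 \in s by case: s snil {rs} => // a s _; exists a; rewrite mem_head.
set l := size s; pose L k := nth a0 s k.
pose src k : 'I_l.+1 := inord (if (L k).2 then k.+1 else k).
pose tgt k : 'I_l.+1 := inord (if (L k).2 then k else k.+1).
pose ks i := [seq k <- iota 0 l | (L k).1 == i].
have mem_ks i k : k \in ks i = ((L k).1 == i) && (k < l)%N.
  by rewrite mem_filter mem_iota.
have adj k : (k.+1 < l)%N -> (L k).1 = (L k.+1).1 -> (L k).2 = (L k.+1).2.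
  move=> kl; have := reduced_nth a0 rs kl; rewrite -/(L k) -/(L k.+1).
  case: (L k) (L k.+1) => [i b] [j c] /= + ij; subst j; rewrite /linv /=.
  by case: b; case: c; rewrite ?eqxx.
have valI k (b : bool) : (k < l)%N -> val (inord (if b then k.+1 else k) : 'I_l.+1) = if b then k.+1 else k.
  by move=> kl; rewrite /= inordK //; case: b; lia.
have uniq_of i (f : nat -> 'I_l.+1) : {in ks i &, injective f} -> uniq (map f (ks i)).
  by move=> fi; rewrite map_inj_in_uniq // filter_uniq // iota_uniq.
have inj_src i : {in ks i &, injective src}.
  move=> k m; rewrite !mem_ks => /andP[/eqP ki kl] /andP[/eqP mi ml] /(congr1 val).
  rewrite !valI //; case kb : (L k).2; case mb : (L m).2; try by lia.
    by move=> E; have := adj k; rewrite E mb kb ki mi => /(_ ml erefl).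
  by move=> E; have := adj m; rewrite -E mb kb ki mi => /(_ kl erefl).
have inj_tgt i : {in ks i &, injective tgt}.
  have tE k : tgt k = inord (if ~~ (L k).2 then k.+1 else k) by rewrite /tgt; case: (L k).2.
  move=> k m; rewrite !mem_ks !tE => /andP[/eqP ki kl] /andP[/eqP mi ml] /(congr1 val).
  rewrite !valI //; case kb : (L k).2; case mb : (L m).2 => //=; try by lia.
    by move=> E; have := adj m; rewrite -E mb kb ki mi => /(_ kl erefl).
  by move=> E; have := adj k; rewrite E mb kb ki mi => /(_ ml erefl).
have ext i : exists p : {perm 'I_l.+1}, map p (map src (ks i)) == map tgt (ks i).
  have sz : size (map src (ks i)) = size (map tgt (ks i)) by rewrite !size_map.
  have [p pE] := perm_extend (uniq_of i src (inj_src i)) (uniq_of i tgt (inj_tgt i)) sz.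
  by exists p; apply/eqP.
pose g i := xchoose (ext i).
have gE k : (k < l)%N -> g (L k).1 (src k) = tgt k.
  move=> kl; have kk : k \in ks (L k).1 by rewrite mem_ks eqxx.
  have := xchooseP (ext (L k).1); rewrite -/(g _) -map_comp => /eqP/eq_in_map.
  exact.
have step k : (k < l)%N -> letter_eval g (L k) (inord k) = inord k.+1.
  move=> kl; have := gE k kl; rewrite /letter_eval /src /tgt; case: (L k).2 => //= <-.
  by rewrite permK.
exists g => g1.
(* Permutations compose from left to right, so the first k letters walk the vertex 0 along the path
   to k, and the whole word moves 0 to the other end. *)
have H k : (k <= l)%N -> (\prod_(a <- take k s) letter_eval g a) (inord 0) = inord k.
  elim: k => [|k IH] kl; first by rewrite take0 big_nil perm1.
  by rewrite (take_nth a0) // -cats1 big_cat big_seq1 /= permM IH ?step // ltnW.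
have := H l (leqnn l); rewrite take_size g1 perm1 => /(congr1 val) /=.
rewrite !inordK // => /esym/size0nil sn; by rewrite sn in snil.
Qed.

(** The middle of the word decides: in odd length the middle letter would be its own inverse, in
    even length the two middle letters would be mutually inverse. Hence a free group has no element
    of order 2. *)
Lemma reduced_inv_nil s : reduced s -> s = red_inv s -> s = [::].
Proof.
move=> rs sE; apply/eqP; rewrite -size_eq0; apply/negPn/negP => sz.
have [a0 _] : exists a0, a0 \in s by case: s sz {rs sE} => // a s _; exists a; rewrite mem_head.
have nthE k : (k < size s)%N -> nth a0 s k = linv (nth a0 s (size s - k.+1)).
  move=> ks; rewrite {1}sE /red_inv nth_rev ?size_map // (nth_map a0) //.
  by rewrite ltn_subrL (leq_ltn_trans _ ks).
have nofix a : a != linv a by case: a => i []; rewrite /linv xpair_eqE andbC.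
have := odd_double_half (size s); set j := (size s)./2; case: (odd _) => /= E.
  have := nthE j; have -> : (size s - j.+1 = j)%N by lia.
  move=> /(_ _) H; have /eqP : nth a0 s j = linv (nth a0 s j) by apply: H; lia.
  by rewrite (negPf (nofix _)).
have j0 : (0 < j)%N by rewrite lt0n; apply: contraNneq sz => j0; rewrite -E j0.
have := reduced_nth a0 rs (k := j.-1); rewrite prednK // => /(_ _) H.
have /negP[] : nth a0 s j != linv (nth a0 s j.-1) by apply: H; lia.
rewrite nthE; last by lia.
by have -> : (size s - j.+1 = j.-1)%N by lia.
Qed.

Lemma free_sqr_neq1 (w : free_group d) : w <> 1 -> w * w <> 1.
Proof.
move=> w1 ww; apply: w1; apply: val_inj => /=; apply: reduced_inv_nil (fword_reduced w) _.
have -> : red_inv w = fword (w^-1) by [].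
by congr fword; rewrite -[LHS]mulg1 -(mulgV w) mulgA ww mul1g.
Qed.

Definition double s := flatten [seq [:: a; a] | a <- s].

(** Doubling is the substitution of x_i ^ 2 for x_i. The new adjacent pairs are of the form a, a,
    and no letter is its own inverse. *)
Lemma reduced_double s : reduced s -> reduced (double s).
Proof.
have nofix a : a != linv a by case: a => i []; rewrite /linv xpair_eqE andbC.
elim: s => [//|a [|b s] IH]; first by rewrite /double /reduced /= nofix.
rewrite /reduced /= => /andP[ab rs]; have := IH rs.
by rewrite /reduced /double /= !nofix ab /=; apply.
Qed.

End PathAction.

Lemma word_eval_morph d (G H : groupType) (f : G -> H) (w : free_group d) (g : 'I_d -> G) :
  {morph f : x y / x * y} -> f (word_eval w g) = word_eval w (fun i => f (g i)).
Proof.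
move=> fM; have f1 : f 1 = 1.
  by apply: (mulgI (f 1)); rewrite -fM !mulg1.
have fV x : f x^-1 = (f x)^-1.
  by apply: (mulgI (f x)); rewrite -fM !mulgV.
rewrite /word_eval (big_morph f fM f1); apply: eq_bigr => -[i []] _; rewrite /letter_eval //=.
Qed.

(* The squares make the values of the letters even in every permutation
   representation of [{perm T}]. *)
Lemma word_nontrivial_perm d (w : free_group d) : w <> 1 ->
  exists (T : finType) (g : 'I_d -> {perm T}),
    let q := word_eval w (fun i => g i * g i) in q != 1 /\ q * q != 1.
Proof.
(* Separating w * w from 1, rather than w, yields q * q != 1 and with it q != 1. *)
move=> w1; have ww1 := free_sqr_neq1 w1.
have rd := reduced_double (fword_reduced (w * w)).
have [|g Hg] := path_action rd.
  apply/eqP => dn; apply: ww1; apply: val_inj.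
  by change (fword (w * w) = [::]); case: (fword _) dn.
exists 'I_(size (double (w * w))).+1, g => q.
have qq : q * q != 1.
  apply/eqP => qq1; apply: Hg; rewrite -[RHS]qq1 /q -word_evalM /word_eval.
  rewrite /double big_flatten big_map /=; apply: eq_bigr => -[i b] _.
  rewrite big_cons big_seq1 /letter_eval; case: b => //=.
  by rewrite invMg.
by split=> //; apply: contraNneq qq => ->; rewrite mulg1.
Qed.

Section BlockRegular.
Variable Q : finGroupType.
Local Notation e := #|Q|.

Definition qel (r : nat) : Q := nth 1 (enum Q) r.
Definition qrk (x : Q) : nat := index x (enum Q).

Lemma qrk_lt x : (qrk x < e)%N.
Proof. by rewrite cardE index_mem mem_enum. Qed.

Lemma qrkK x : qel (qrk x) = x.
Proof. by rewrite /qel nth_index // mem_enum. Qed.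

Lemma qelK r : (r < e)%N -> qrk (qel r) = r.
Proof. by move=> re; rewrite /qrk index_uniq ?enum_uniq // -cardE. Qed.

Lemma card_group_gt0 : (0 < e)%N. Proof. by apply/card_gt0P; exists 1. Qed.

Variable n : nat.

(** The right regular representation of [Q], copied on consecutive intervals of length [e], and
    trivial on the remainder of length less than [e]. Because the action is regular, every g != 1
    moves every point of the intervals. *)
Definition blk_act (g : Q) (i : nat) : nat :=
  if (i < n %/ e * e)%N then (i %/ e * e + qrk (qel (i %% e) * g))%N else i.

Lemma blk_act_div g i : (blk_act g i %/ e = i %/ e)%N.
Proof.
rewrite /blk_act; case: ifP => // _.
by rewrite divnMDl ?card_group_gt0 // (divn_small (qrk_lt _)) addn0.
Qed.

Lemma blk_act_bound g i : (blk_act g i < n %/ e * e)%N = (i < n %/ e * e)%N.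
Proof. by rewrite -!ltn_divLR ?card_group_gt0 // blk_act_div. Qed.

Lemma blk_act_lt g i : (i < n)%N -> (blk_act g i < n)%N.
Proof.
move=> lin; case: (ltnP i (n %/ e * e)) => h; last by rewrite /blk_act ifF //; apply/negbTE; rewrite -leqNgt.
by apply: leq_trans (leq_divM n e); rewrite blk_act_bound.
Qed.

Lemma blk_act_mod g i : (i < n %/ e * e)%N -> (blk_act g i %% e = qrk (qel (i %% e) * g))%N.
Proof.
by move=> h; rewrite /blk_act h modnMDl (modn_small (qrk_lt _)).
Qed.

Lemma blk_actM g h i : blk_act (g * h) i = blk_act h (blk_act g i).
Proof.
rewrite {2}/blk_act blk_act_bound; case: ifP => li; last by rewrite /blk_act li.
by rewrite blk_act_div blk_act_mod // qrkK -mulgA /blk_act li.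
Qed.

Lemma blk_act1 i : blk_act 1 i = i.
Proof.
rewrite /blk_act; case: ifP => // _; rewrite mulg1 qelK ?ltn_pmod ?card_group_gt0 //.
by rewrite -divn_eq.
Qed.

Lemma blk_act_neq g i : g != 1 -> (i < n %/ e * e)%N -> blk_act g i != i.
Proof.
move=> g1 li; apply: contraNneq g1 => /(congr1 (modn^~ e)).
rewrite /= blk_act_mod // => /(congr1 qel); rewrite qrkK => h.
by apply/eqP/(mulgI (qel (i %% e))); rewrite h mulg1.
Qed.

Definition blk_ord g (i : 'I_n) : 'I_n := Ordinal (blk_act_lt g (ltn_ord i)).

Lemma blk_ord_inj g : injective (blk_ord g).
Proof.
move=> i j /(congr1 val) /= ij; apply: val_inj.
by rewrite /= -[RHS](blk_act1 j) -(mulgV g) blk_actM -ij -blk_actM mulgV blk_act1.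
Qed.

Definition blk_perm g : {perm 'I_n} := perm (@blk_ord_inj g).

Lemma blk_permE g i : val (blk_perm g i) = blk_act g i.
Proof. by rewrite permE. Qed.

Lemma blk_permM : {morph blk_perm : g h / g * h}.
Proof. by move=> g h; apply/permP => i; apply: val_inj; rewrite permM !blk_permE blk_actM. Qed.

End BlockRegular.

(** The group acting on blocks is the whole symmetric group found in [word_nontrivial_perm], and [e]
    is its order. The two inequalities say that the cycles on the blocks have length at least 3, and
    the last clause that each cycle stays in its block. *)
Lemma word_value_perm d (w : free_group d) : w <> 1 ->
  exists2 e, (0 < e)%N & forall n, exists rho : 'I_d -> {perm 'I_n},
    (forall k, odd_perm (rho k) = false) /\
    let p := word_eval w rho in forall i : 'I_n, (i < n %/ e * e)%N ->
      [/\ p i != i, p (p i) != i & (p i %/ e = i %/ e)%N].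
Proof.
move=> /word_nontrivial_perm[T [g [q1 qq1]]]; exists #|{perm T}|; first exact: card_group_gt0.
move=> n; exists (fun k => blk_perm n (g k * g k)); split.
  by move=> k; rewrite blk_permM odd_permM addbb.
move=> p i li; have -> : p = blk_perm n (word_eval w (fun k => g k * g k)).
  by rewrite /p (word_eval_morph w _ (@blk_permM _ n)).
rewrite -permM -blk_permM -!val_eqE !blk_permE blk_act_div.
by split=> //; apply: blk_act_neq.
Qed.

End WordsAndPermutations.

Local Open Scope ring_scope.

(** * Dirichlet's theorem on primes in arithmetic progressions *)

Section DirichletSums.
Variable R : realType.
Implicit Types (a f g u : nat -> R) (B C : R).

(** Summation by parts, where [g] dominates both [f] and its variation: the boundary term and the
    telescoping sum add up to B * g m. A separate [g] admits functions such as ln k / k, which are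
    not monotone from the start. *)
Lemma abel_bound a f g B m n : (m <= n)%N ->
  (forall k, `|\sum_(m <= i < k) a i| <= B) ->
  (forall k, (m <= k)%N -> `|f k| <= g k) ->
  (forall k, (m <= k)%N -> `|f k - f k.+1| <= g k - g k.+1) ->
  `|\sum_(m <= i < n) a i * f i| <= B * g m.
Proof.
move=> lemn HB Hf Hd; set A := fun k => \sum_(m <= i < k) a i.
have B0 : 0 <= B by apply: le_trans (HB 0%N).
have -> : \sum_(m <= i < n) a i * f i
    = A n * f n + \sum_(m <= i < n) A i.+1 * (f i - f i.+1).
  elim: n lemn => [|n IHn] lemn.
    by rewrite /A !big_geq // mul0r addr0.
  move: lemn; rewrite leq_eqVlt => /predU1P[mE|ltmn].
    by rewrite /A !big_geq ?mE // mul0r addr0.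
  rewrite [LHS]big_nat_recr //= IHn // [in RHS]big_nat_recr //= /A.
  rewrite [\sum_(m <= i < n.+1) a i]big_nat_recr //=; ring.
apply: le_trans (ler_normD _ _) _.
have H1 : `|A n * f n| <= B * g n.
  by rewrite normrM; apply: ler_pM => //; [exact: HB | exact: Hf].
have H2 : `|\sum_(m <= i < n) A i.+1 * (f i - f i.+1)| <= \sum_(m <= i < n) B * (g i - g i.+1).
  apply: le_trans (ler_norm_sum _ _ _) _.
  rewrite !big_nat; apply: ler_sum => i /andP[mi _].
  by rewrite normrM; apply: ler_pM => //; [exact: HB | exact: Hd].
apply: le_trans (lerD H1 H2) _.
rewrite -mulr_sumr -mulrDr ler_wpM2l //.
rewrite le_eqVlt (_ : _ == _) //; apply/eqP.
have := telescope_sumr (fun i => - g i) lemn.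
under eq_bigr do rewrite opprK addrC.
move=> ->; ring.
Qed.

Lemma sum_dvdn (G : nat -> R) d x : (0 < d)%N ->
  \sum_(1 <= k < x.+1 | (d %| k)%N) G k = \sum_(1 <= m < (x %/ d).+1) G (d * m)%N.
Proof.
move=> d0; elim: x => [|x IH]; first by rewrite div0n !big_geq.
rewrite big_mkcond big_nat_recr //= -big_mkcond /= IH divnS //.
case: ifP => [dx|_]; last by rewrite addr0.
rewrite add1n [RHS]big_nat_recr //=; congr (_ + G _).
by have := divnS x d0; rewrite dx add1n => <-; rewrite mulnC divnK.
Qed.

(** Both sides run over the pairs (d, m) with d * m <= x, grouped by the product on the left and by
    d on the right. *)
Lemma sum_divisors (F : nat -> nat -> R) x :
  \sum_(1 <= k < x.+1) \sum_(1 <= d < k.+1 | (d %| k)%N) F d (k %/ d)%N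
  = \sum_(1 <= d < x.+1) \sum_(1 <= m < (x %/ d).+1) F d m.
Proof.
transitivity (\sum_(1 <= k < x.+1) \sum_(1 <= d < x.+1 | (d %| k)%N) F d (k %/ d)%N).
  apply: eq_big_nat => k /andP[k1 kx].
  rewrite [RHS](big_cat_nat (n := k.+1)) //= [X in _ + X]big_nat_cond.
  rewrite [X in _ + X]big1 ?addr0 // => d /andP[/andP[kd _] dk].
  by move: (dvdn_leq k1 dk); rewrite leqNgt kd.
rewrite (exchange_big_dep_nat xpredT) //=.
apply: eq_big_nat => d /andP[d1 dx]; rewrite sum_dvdn //.
by apply: eq_big_nat => m _; rewrite mulKn.
Qed.

Lemma ler_arch c : (forall n, c <= n.+1%:R^-1) -> c <= 0 :> R.
Proof.
move=> H; rewrite leNgt; apply/negP => c0.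
have [n _ Hn] : exists2 n, true & c^-1 < n.+1%:R.
  exists (Num.truncn c^-1) => //; apply: truncnS_gt.
have := H n; rewrite leNgt => /negP[].
by rewrite -[c]invrK ltf_pV2 // posrE ?invr_gt0.
Qed.

Lemma ler_arch_mul c B : (forall n, c <= B / n.+1%:R) -> c <= 0 :> R.
Proof.
move=> H; have [B0|B0] := leP B 0.
  by apply: le_trans (H 0%N) _; rewrite divr1.
have : c / B <= 0 by apply: ler_arch => n; rewrite ler_pdivrMr // mulrC.
by rewrite pmulr_lle0 // invr_gt0.
Qed.

(** Every left end s m - e m lies below every right end s n + e n, so the supremum of the left ends
    belongs to all the intervals. *)
Lemma lim_exists (s e : nat -> R) :
  (forall m n, (m <= n)%N -> `|s n - s m| <= e m) ->
  exists w, forall m, `|w - s m| <= e m.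
Proof.
move=> H; pose E : set R := fun x => exists m, x = s m - e m.
have e0 k : 0 <= e k by apply: le_trans (H k k (leqnn k)).
have ub m : ubound E (s m + e m).
  move=> x [k ->]; have [mk|/ltnW km] := leqP m k.
    have h1 := H _ _ mk; have h2 := e0 k.
    by move: h1 h2; rewrite ler_norml => /andP[? ?]; lra.
  have h1 := H _ _ km; have h2 := e0 m.
  by move: h1 h2; rewrite ler_norml => /andP[? ?]; lra.
exists (sup E) => m; rewrite ler_norml; apply/andP; split.
  have : s m - e m <= sup E.
    by apply: ub_le_sup; [exists (s 0%N + e 0%N); exact: ub | exists m].
  by lra.
have : sup E <= s m + e m.
  by apply: ge_sup; [exists (s m - e m); exists m | exact: ub].
by lra.
Qed.

End DirichletSums.

(** * The von Mangoldt and Moebius functions, and Chebyshev's bound *)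

Section VonMangoldt.
Variable R : realType.
Implicit Types (F : nat -> R).

Lemma sum_divisors_ord F n N : (0 < n <= N)%N ->
  \sum_(1 <= d < n.+1 | (d %| n)%N) F d = \sum_(d < N.+1 | (d %| n)%N) F d.
Proof.
move=> /andP[n0 nN].
rewrite -(big_mkord (fun d => (d %| n)%N) F) [RHS]big_ltn_cond // dvd0n.
rewrite (gtn_eqF n0) [RHS](big_cat_nat (n := n.+1)) //=.
rewrite [X in _ + X]big_nat_cond [X in _ + X]big1 ?addr0 //.
move=> d /andP[/andP[nd _] dn].
by move: (dvdn_leq n0 dn); rewrite leqNgt nd.
Qed.

(** The von Mangoldt function: n > 1 is a prime power exactly when it equals the full power of its
    least prime factor. *)
Definition vM (n : nat) : R :=
  if (1 < n)%N && (n == pdiv n ^ logn (pdiv n) n)%N then ln (pdiv n)%:R else 0.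

Lemma vM_ge0 n : 0 <= vM n.
Proof. by rewrite /vM; case: ifP => // _; apply: ln_ge0; rewrite ler1n pdiv_gt0. Qed.

Lemma vM_pfactor p k : prime p -> (0 < k)%N -> vM (p ^ k) = ln p%:R.
Proof.
case: k => // k pp _; rewrite /vM pdiv_pfactor // pfactorK // eqxx andbT.
by rewrite (leq_trans (prime_gt1 pp)) // -{1}[p]expn1 leq_exp2l // prime_gt1.
Qed.

Lemma vM_neq0 n : vM n != 0 -> exists p k, [/\ prime p, (0 < k)%N & n = (p ^ k)%N].
Proof.
rewrite /vM; case: ifP => [/andP[n1 /eqP nE] _|]; last by rewrite eqxx.
exists (pdiv n), (logn (pdiv n) n); split => //; first exact: pdiv_prime.
by rewrite logn_gt0 mem_primes pdiv_prime // pdiv_dvd ltnW.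
Qed.

Lemma vM_prime p : prime p -> vM p = ln p%:R.
Proof. by move=> pp; rewrite -{1}[p]expn1 vM_pfactor. Qed.

Lemma vM1 : vM 1 = 0. Proof. by []. Qed.

Lemma vM_mulp p m : prime p -> (0 < m)%N -> vM (p * m) =
  if m == 1%N then ln p%:R else if (p %| m)%N then vM m else 0.
Proof.
move=> pp m0; case: eqP => [->|/eqP m1]; first by rewrite muln1 vM_prime.
have pdivE r k : prime r -> (p * m = r ^ k)%N -> r = p.
  move=> pr mE; apply/esym/eqP; rewrite -dvdn_prime2 //.
  by move: (dvdn_mulr m (dvdnn p)); rewrite mE Euclid_dvdX // => /andP[].
have pk k : (0 < k)%N -> (p * m = p ^ k)%N -> (0 < k.-1)%N /\ m = (p ^ k.-1)%N.
  case: k => // k _ /eqP; rewrite expnS eqn_pmul2l ?(prime_gt0 pp) // => /eqP mE.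
  by split => //=; rewrite lt0n; apply: contraNneq m1 => k0; rewrite mE k0.
case: (eqVneq (vM (p * m)) 0) => [v0|/vM_neq0[r [k [pr k0 mE]]]].
  rewrite v0; case: ifP => // pm; case: (eqVneq (vM m) 0) => // /vM_neq0[r [k [pr k0 mE]]].
  have rp : r = p.
    by apply/esym/eqP; rewrite -dvdn_prime2 //; move: pm; rewrite mE Euclid_dvdX // => /andP[].
  by subst r; rewrite -v0 mE -expnS !vM_pfactor.
have rp := pdivE _ _ pr mE; subst r; have [k1 mE'] := pk _ k0 mE.
by rewrite mE mE' !vM_pfactor // ifT // dvdn_exp.
Qed.

(** Induction by removing the least prime p of n: with m = n / p and v = [logn p m], the only prime
    power dividing n but not m is p ^ (v + 1), and it contributes ln p = ln n - ln m. *)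
Lemma sum_vM n : (0 < n)%N -> \sum_(1 <= d < n.+1 | (d %| n)%N) vM d = ln n%:R.
Proof.
have [k] := ubnP n; elim: k n => // k IH n nk n0.
have [->|n1] := eqVneq n 1%N.
  by rewrite big_mkcond big_nat1 dvd1n vM1 ln1.
have n2 : (1 < n)%N by rewrite ltn_neqAle eq_sym n1.
set p := pdiv n; have pp : prime p by apply: pdiv_prime.
have nE : n = (p * (n %/ p))%N by rewrite mulnC divnK // pdiv_dvd.
set m := (n %/ p)%N in nE.
have m0 : (0 < m)%N by rewrite divn_gt0 ?pdiv_gt0 // pdiv_leq.
have mn : (m < n)%N by apply: ltn_Pdiv => //; exact: prime_gt1.
have := IH m (leq_trans mn nk) m0.
rewrite !(@sum_divisors_ord _ _ n) ?n0 ?m0 ?leqnn ?(ltnW mn) // => IHm.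
have -> : ln n%:R = ln p%:R + ln m%:R :> R.
  by rewrite nE natrM lnM ?posrE ?ltr0n ?(prime_gt0 pp).
rewrite -IHm.
have mdn : (m %| n)%N by rewrite nE dvdn_mull.
have logE r : logn r n = (logn r p + logn r m)%N by rewrite nE lognM ?(prime_gt0 pp).
set v := logn p m.
have vn : (p ^ v.+1 %| n)%N by rewrite nE expnS dvdn_pmul2l ?(prime_gt0 pp) // pfactor_dvdnn.
have lt : (p ^ v.+1 < n.+1)%N by rewrite ltnS dvdn_leq.
rewrite (bigD1 (Ordinal lt)) //= vM_pfactor //; congr (_ + _).
rewrite (bigID (fun d : 'I__ => (d %| m)%N)) /= [X in _ + X]big1 ?addr0.
  apply: eq_bigl => d; rewrite -andbA.
  case dm : (d %| m)%N; rewrite ?andbF // andbT.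
  rewrite (dvdn_trans dm mdn) /=; apply: contraTN dm => /eqP->/=.
  by rewrite pfactor_dvdn // ltnn.
move=> d /andP[/andP[dn dneq] dm]; apply/eqP/negPn/negP => /vM_neq0[r [j [pr j0 dE]]].
case/negP: dneq; apply/eqP/val_inj => /=.
have jn : (j <= logn r n)%N by rewrite -pfactor_dvdn // -dE.
have jm : (logn r m < j)%N by rewrite ltnNge -pfactor_dvdn // -dE.
have := jn; rewrite logE logn_prime //.
case: eqP => [rp|_]; last by rewrite add0n leqNgt jm.
by subst r; rewrite dE add1n => jv; congr (_ ^ _)%N; apply/eqP; rewrite eqn_leq jv.
Qed.

Definition sqfree n := all (fun p => logn p n <= 1)%N (primes n).
Definition mobius n : R := if sqfree n then (-1) ^+ size (primes n) else 0.

Lemma mobius_le1 n : `|mobius n| <= 1.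
Proof. by rewrite /mobius; case: ifP; rewrite ?normr0 // normrX normrN1 expr1n. Qed.

Lemma mobius_mulp p d : prime p -> (0 < d)%N ->
  mobius (p * d) = if (p %| d)%N then 0 else - mobius d.
Proof.
move=> pp d0; have pd0 : (0 < p * d)%N by rewrite muln_gt0 prime_gt0.
have mem r : (r \in primes (p * d)) = (r == p) || (r \in primes d).
  by rewrite primesM ?(prime_gt0 pp) // primes_prime // inE.
rewrite /mobius; case pd : (p %| d)%N.
  case: ifP => [/allP/(_ p)|//]; rewrite mem eqxx => /(_ isT).
  rewrite lognM ?(prime_gt0 pp) // logn_prime // eqxx add1n ltnS leqNgt.
  by rewrite logn_gt0 mem_primes pp d0 pd.
have pnd : p \notin primes d by rewrite mem_primes pp d0 pd.
have pe : perm_eq (primes (p * d)) (p :: primes d).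
  apply: uniq_perm; rewrite ?primes_uniq //= ?pnd ?primes_uniq //.
have -> : sqfree (p * d) = sqfree d.
  rewrite /sqfree (perm_all _ pe) /= lognM ?(prime_gt0 pp) // logn_prime // eqxx.
  have -> : logn p d = 0%N by apply/eqP; rewrite -leqn0 leqNgt logn_gt0.
  rewrite /=.
  apply: eq_in_all => r rd; rewrite lognM ?(prime_gt0 pp) // logn_prime //.
    by case: eqP => // rp; move: pnd; rewrite -rp rd.
by rewrite (perm_size pe) /=; case: ifP; rewrite ?oppr0 // exprS mulN1r.
Qed.

(** For a prime p dividing n, divisors divisible by p * p contribute 0, and each divisor d prime to
    p cancels against p * d. *)
Lemma sum_mobius n : (0 < n)%N ->
  \sum_(1 <= d < n.+1 | (d %| n)%N) mobius d = (n == 1%N)%:R.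
Proof.
move=> n0; have [->|n1] := eqVneq n 1%N.
  by rewrite big_mkcond big_nat1 dvd1n /mobius.
rewrite (@sum_divisors_ord _ _ n) ?n0 ?leqnn //.
have n2 : (1 < n)%N by rewrite ltn_neqAle eq_sym n1.
set p := pdiv n; have pp : prime p by apply: pdiv_prime.
have pn : (p %| n)%N by apply: pdiv_dvd.
rewrite (bigID (fun d : 'I__ => (p %| d)%N)) /=.
rewrite (bigID (fun d : 'I__ => (p * p %| d)%N)) /=.
rewrite [X in X + _ + _]big1 ?add0r; last first.
  move=> d /andP[/andP[dn pd] ppd].
  have d0 : (0 < d)%N by rewrite lt0n; apply: contraTneq dn => ->; rewrite dvd0n (gtn_eqF n0).
  have /eqP dE : val d == (p * (d %/ p))%N by rewrite mulnC divnK.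
  rewrite dE mobius_mulp //; last by rewrite divn_gt0 ?(prime_gt0 pp) // dvdn_leq.
  by move: ppd; rewrite {1}dE dvdn_pmul2l ?(prime_gt0 pp) // => ->.
rewrite (reindex_onto (fun d : 'I_n.+1 => inord (p * d)) (fun d : 'I_n.+1 => inord (d %/ p))) /=; last first.
  move=> d /andP[/andP[dn pd] _]; apply: val_inj => /=.
  have h : (d %/ p < n.+1)%N by rewrite (leq_ltn_trans (leq_div _ _)).
  by rewrite (inordK h) inordK mulnC divnK.
have hd (d : 'I_n.+1) : (d %| n)%N -> ~~ (p %| d)%N -> (p * d %| n)%N.
  by move=> dn pd; rewrite Gauss_dvd ?pn ?dn // prime_coprime.
rewrite (eq_bigl (fun d : 'I_n.+1 => (d %| n)%N && ~~ (p %| d)%N)); last first.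
  move=> d; apply/idP/idP.
    move=> /andP[/andP[/andP[dn pd] ppd] _].
    have [pdn|npd] := ltnP (p * d) n.+1.
      move: dn ppd; rewrite (inordK pdn) dvdn_pmul2l ?(prime_gt0 pp) // => dn ->.
      by rewrite andbT (dvdn_trans _ dn) // dvdn_mull.
    (* When p * d leaves the range, [inord] returns its default 0, which does not divide n. *)
    move: dn; rewrite /inord val_insubd ltnNge npd /= dvd0n (gtn_eqF n0) //.
  move=> /andP[dn pd]; have pdn := hd d dn pd.
  have lt : (p * d < n.+1)%N by rewrite ltnS dvdn_leq.
  rewrite inordK // pdn dvdn_mulr // dvdn_pmul2l ?(prime_gt0 pp) // pd /=.
  by apply/eqP/val_inj; rewrite /= mulKn ?(prime_gt0 pp) // inordK.
rewrite (eq_bigr (fun d : 'I_n.+1 => - mobius d)) ?sumrN ?addNr //.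
move=> d /andP[dn pd]; have pdn := hd d dn pd.
have lt : (p * d < n.+1)%N by rewrite ltnS dvdn_leq.
rewrite inordK // mobius_mulp // ?(negPf pd) // lt0n.
by apply: contraTneq dn => ->; rewrite dvd0n (gtn_eqF n0).
Qed.

(** Writing ln d = ln k - ln (k / d), the constant t - ln k survives only for k = 1, where ln k = 0;
    the rest is the Moebius inversion of [sum_vM], shown in [H]. *)
Lemma sum_mobius_ln k (t : R) : (0 < k)%N ->
  \sum_(1 <= d < k.+1 | (d %| k)%N) mobius d * (t - ln d%:R)
  = (k == 1%N)%:R * t + vM k.
Proof.
move=> k0.
have qk d : (d %| k)%N -> (0 < k %/ d <= k)%N.
  by move=> dk; rewrite divn_gt0 ?(dvdn_gt0 k0 dk) // dvdn_leq //= leq_div.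
have swap d e : (d %| k)%N && (e %| k %/ d)%N = (e %| k)%N && (d %| k %/ e)%N.
  apply/andP/andP => -[dk]; rewrite dvdn_divRL // => edk.
    have ek : (e %| k)%N by apply: dvdn_trans edk; rewrite ?dvdn_mulr ?dvdn_mull.
    by split=> //; rewrite dvdn_divRL // mulnC.
  have ek : (d %| k)%N by apply: dvdn_trans edk; rewrite ?dvdn_mulr ?dvdn_mull.
  by split=> //; rewrite dvdn_divRL // mulnC.
have H : \sum_(d < k.+1 | (d %| k)%N) mobius d * ln (k %/ d)%:R = vM k.
  transitivity (\sum_(d < k.+1 | (d %| k)%N) \sum_(e < k.+1 | (e %| k %/ d)%N) mobius d * vM e).
    apply: eq_bigr => d dk; rewrite -mulr_sumr -sum_divisors_ord ?qk // sum_vM //.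
    by case/andP: (qk d dk).
  rewrite (exchange_big_dep (fun e : 'I_k.+1 => (e %| k)%N)) /=; last first.
    by move=> d e dk ek; apply: dvdn_trans ek _; exact: dvdn_div.
  have lt : (k < k.+1)%N by [].
  rewrite (bigD1 (Ordinal lt)) //= [X in _ + X]big1 ?addr0.
    rewrite (eq_bigl (fun d : 'I_k.+1 => (d %| 1)%N)); last first.
      by move=> d; rewrite swap dvdnn divnn k0.
    by rewrite -mulr_suml -sum_divisors_ord ?k0 // sum_mobius // mul1r.
  move=> e /andP[ek eneq]; rewrite (eq_bigl (fun d : 'I_k.+1 => (d %| k %/ e)%N)); last first.
    by move=> d; rewrite swap ek.
  case/andP: (qk e ek) => h1 h2.
  rewrite -mulr_suml -sum_divisors_ord ?h1 // sum_mobius // (_ : _ == _ = false) ?mul0r //.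
  apply: contraNF eneq => /eqP ke; apply/eqP/val_inj => /=.
  by rewrite -[RHS](divnK ek) ke mul1n.
have E : (k == 1%N)%:R * ln k%:R = 0 :> R.
  by case: eqP => [->|]; rewrite ?ln1 ?mulr0 ?mul0r.
rewrite (@sum_divisors_ord (fun d => mobius d * (t - ln d%:R)) _ k) ?k0 ?leqnn //.
transitivity (\sum_(d < k.+1 | (d %| k)%N) (mobius d * (t - ln k%:R) + mobius d * ln (k %/ d)%:R)).
  apply: eq_bigr => d dk; rewrite -mulrDr; congr (_ * _).
  have [h1 _] := andP (qk d dk); have h2 := dvdn_gt0 k0 dk.
  have -> : ln k%:R = ln d%:R + ln (k %/ d)%:R :> R.
    by rewrite -lnM ?posrE ?ltr0n // -natrM mulnC divnK.
  by ring.
rewrite big_split /= H -mulr_suml -(@sum_divisors_ord mobius) ?k0 ?leqnn // sum_mobius //.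
by rewrite mulrBr E subr0.
Qed.

Definition psi x := \sum_(1 <= d < x.+1) vM d.

Lemma ln_fact x : ln (x`!)%:R = \sum_(1 <= d < x.+1) vM d * (x %/ d)%:R.
Proof.
have -> : ln (x`!)%:R = \sum_(1 <= k < x.+1) ln k%:R :> R.
  elim: x => [|x IH]; first by rewrite big_geq // fact0 ln1.
  rewrite factS natrM lnM ?posrE ?ltr0n ?fact_gt0 // IH addrC.
  by rewrite [RHS]big_nat_recr.
transitivity (\sum_(1 <= k < x.+1) \sum_(1 <= d < k.+1 | (d %| k)%N) vM d).
  by apply: eq_big_nat => k /andP[k0 _]; rewrite sum_vM.
rewrite (sum_divisors (fun d _ => vM d)); apply: eq_bigr => d _.
by rewrite sumr_const_nat subn1 /= mulr_natr.
Qed.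

Lemma ln_succ_le k : (0 < k)%N -> ln k.+1%:R - ln k%:R <= k%:R^-1 :> R.
Proof.
move=> k0; have k0' : 0 < k%:R :> R by rewrite ltr0n.
rewrite -ln_div ?posrE ?ltr0n // -natr1 mulrDl divff ?gt_eqF // mul1r.
apply: le_ln1Dx; apply: lt_trans (_ : 0 < _); first by rewrite ltrN10.
by rewrite invr_gt0.
Qed.

Lemma ln_nat_ge0 k : 0 <= ln k%:R :> R.
Proof. by case: k => [|k]; [rewrite ln0 | apply: ln_ge0; rewrite ler1n]. Qed.

Lemma ln_nat_le m n : (0 < m)%N -> (m <= n)%N -> ln m%:R <= ln n%:R :> R.
Proof.
move=> m0 mn; rewrite ler_ln ?posrE ?ltr0n ?ler_nat //; exact: leq_trans mn.
Qed.

Lemma ln_nat_lt k : ln k%:R <= k%:R :> R.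
Proof.
by case: k => [|k]; [rewrite ln0 | apply/ltW/ln_sublinear; rewrite ltr0n].
Qed.

(** Chebyshev's argument: in the logarithm of the central binomial coefficient, [vM d] has weight
    [2n / d] - 2 [n / d], which is never negative and is at least 1 for n < d <= 2n. The coefficient
    is at most 2 ^ (2n), and ln 2 <= 1. *)
Lemma psi_double n : psi n.*2 - psi n <= n.*2%:R.
Proof.
have H1 : psi n.*2 - psi n <= ln (n.*2`!)%:R - 2 * ln (n`!)%:R.
  rewrite !ln_fact /psi (big_cat_nat (n := n.+1)) //=; last by rewrite ltnS -addnn leq_addr.
  rewrite [X in _ <= X - _](big_cat_nat (n := n.+1)) //=; last by rewrite ltnS -addnn leq_addr.
  have h1 : \sum_(n.+1 <= i < n.*2.+1) vM i <= \sum_(n.+1 <= i < n.*2.+1) vM i * (n.*2 %/ i)%:R.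
    rewrite !big_nat; apply: ler_sum => i /andP[ni i2n].
    have i0 : (0 < i)%N by apply: leq_ltn_trans ni.
    by rewrite ler_peMr ?vM_ge0 // ler1n divn_gt0.
  have h2 : 2 * (\sum_(1 <= i < n.+1) vM i * (n %/ i)%:R) <= \sum_(1 <= i < n.+1) vM i * (n.*2 %/ i)%:R.
    rewrite mulr_sumr !big_nat; apply: ler_sum => i /andP[i0 _].
    rewrite mulrCA ler_wpM2l ?vM_ge0 // -natrM ler_nat.
    by rewrite leq_divRL // -mulnA -mul2n leq_mul2l leq_divM.
  lra.
apply: le_trans H1 _.
have -> : ln (n.*2`!)%:R - 2 * ln (n`!)%:R = ln 'C(n.*2, n)%:R :> R.
  have := bin_fact (leq_addr n n); rewrite addnn -{2}addnn addnK => <-.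
  rewrite !natrM !lnM ?posrE ?mulr_gt0 ?ltr0n ?fact_gt0 ?bin_gt0 // -?addnn ?leq_addr //.
  by ring.
have h : ('C(n.*2, n) <= 2 ^ n.*2)%N.
  rewrite -[2%N]/(1 + 1)%N expnDn.
  have lt : (n < n.*2.+1)%N by rewrite ltnS -addnn leq_addr.
  by rewrite (bigD1 (Ordinal lt)) //= !exp1n !muln1 leq_addr.
have c0 : (0 < 'C(n.*2, n))%N by rewrite bin_gt0 -addnn leq_addr.
apply: le_trans (ln_nat_le c0 h) _.
rewrite natrX lnXn // -[ln _ *+ _]mulr_natr ler_piMl ?ler0n //.
have -> : 2%:R = 1 + 1 :> R by [].
by apply: le_trans (le_ln1Dx _) _; lra.
Qed.

Lemma psi_le x : psi x <= 4 * x%:R.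
Proof.
have [k] := ubnP x; elim: k x => // k IH x xk.
have [x1|x1] := leqP x 1.
  have -> : psi x = 0 by case: x x1 {xk} => [|[|x]] // _; rewrite /psi; [rewrite big_geq | rewrite big_nat1].
  by rewrite mulr_ge0.
set n := x./2; have hn : (n < k)%N.
  by rewrite /n -ltnS (leq_trans _ xk) // ltnS; lia.
have := IH _ hn; have := psi_double n.
have xE := odd_double_half x; rewrite -/n in xE.
have n2 : n.*2%:R = 2 * n%:R :> R by rewrite -muln2 mulnC natrM.
rewrite n2 => h1 h2.
(* The odd case has the extra term vM (2n + 1) <= 2n + 1; the constant 4 is large enough since 4n +
   2n + (2n + 1) <= 4 (2n + 1). *)
case: (odd x) xE => /= xE; rewrite -xE ?add0n ?add1n.
  rewrite /psi big_nat_recr //= -/(psi n.*2).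
  have h3 : vM n.*2.+1 <= ln n.*2.+1%:R.
    rewrite -sum_vM // big_mkcond big_nat_recr //= dvdnn lerDr sumr_ge0 // => i _.
    by case: ifP; rewrite ?vM_ge0.
  have h5 : 1 <= n%:R :> R by rewrite ler1n /n; lia.
  have h6 : n.*2.+1%:R = 2 * n%:R + 1 :> R by rewrite -natr1 n2.
  have h4 := ln_nat_lt n.*2.+1; rewrite [X in _ <= X]h6 in h4; rewrite h6.
  by move: h1 h2 h3 h4 h5; rewrite -?muln2; move: (vM _) (psi _) (psi _) (ln _) (n%:R) => *; lra.
by rewrite n2; have : 0 <= n%:R :> R by []; lra.
Qed.

End VonMangoldt.

(** * Mertens' estimate and the negligible parts of the von Mangoldt sums *)

Section Mertens.
Variable R : realType.
Local Notation vM := (@vM R).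

(** A majorant of ln k / k that decreases from k = 1 on. Its drops dominate both the variation of ln
    k / k and the terms ln p / (p (p - 1)), whose sum thereby telescopes. *)
Definition lnk2 (k : nat) : R := (ln k%:R + 2) / k%:R.

Lemma lnk2_drop k : (0 < k)%N ->
  (ln k%:R + 1) / (k%:R * k.+1%:R) <= lnk2 k - lnk2 k.+1.
Proof.
move=> k0; have h := ln_succ_le R k0; rewrite /lnk2.
have k0' : 0 < k%:R :> R by rewrite ltr0n.
have k1' : 0 < k.+1%:R :> R by rewrite ltr0n.
have -> : (ln k%:R + 2) / k%:R - (ln k.+1%:R + 2) / k.+1%:R
   = (ln k%:R + 2 - k%:R * (ln k.+1%:R - ln k%:R)) / (k%:R * k.+1%:R) :> R.
  by rewrite -[k.+1%:R]natr1; field; rewrite natr1 !gt_eqF //.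
rewrite ler_pM2r ?invr_gt0 ?mulr_gt0 //.
have : k%:R * (ln k.+1%:R - ln k%:R) <= 1 :> R by rewrite mulrC -ler_pdivlMr // mul1r.
lra.
Qed.

Lemma ln_fact_ge x : x%:R * ln x%:R - x%:R <= ln (x`!)%:R :> R.
Proof.
elim: x => [|x IH]; first by rewrite fact0 ln1 mul0r subr0.
rewrite factS natrM lnM ?posrE ?ltr0n ?fact_gt0 //.
case: x IH => [|x] IH; first by rewrite ?fact0 !ln1; lra.
have h := ln_succ_le R (ltn0Sn x); have x1 : 0 < x.+1%:R :> R by rewrite ltr0n.
have : x.+1%:R * (ln x.+2%:R - ln x.+1%:R) <= 1 :> R by rewrite mulrC -ler_pdivlMr // mul1r.
rewrite -[X in X * ln x.+2%:R]natr1 -[X in _ - X <= _]natr1.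
move: IH; move: (x.+1%:R) (ln (x.+1`!)%:R) (ln x.+2%:R) (ln x.+1%:R) => a b c d; lra.
Qed.

Lemma ln_fact_le x : ln (x`!)%:R <= x%:R * ln x%:R :> R.
Proof.
elim: x => [|x IH]; first by rewrite fact0 ln1 mul0r.
rewrite factS natrM lnM ?posrE ?ltr0n ?fact_gt0 //.
case: x IH => [|x] IH; first by rewrite ?fact0 !ln1 mulr0 addr0.
have h : ln x.+1%:R <= ln x.+2%:R :> R by apply: ln_nat_le.
rewrite -[X in _ <= X * _]natr1 mulrDl mul1r addrC lerD2r.
by apply: le_trans IH _; rewrite ler_wpM2l.
Qed.

(** Replacing [x / d] by x / d in [ln_fact] changes the sum by at most psi x <= 4x; dividing by x
    turns ln x! into ln x up to a bounded error. *)
Lemma mertens x : (0 < x)%N ->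
  `|\sum_(1 <= d < x.+1) vM d / d%:R - ln x%:R| <= 4.
Proof.
move=> x0; have x0' : 0 < x%:R :> R by rewrite ltr0n.
set S := \sum_(_ <= d < _) _.
have lo : ln (x`!)%:R <= x%:R * S.
  rewrite ln_fact mulr_sumr !big_nat; apply: ler_sum => d /andP[d0 _].
  rewrite mulrCA ler_wpM2l ?vM_ge0 // ler_pdivlMr ?ltr0n // -natrM ler_nat.
  exact: leq_divM.
have hi : x%:R * S <= ln (x`!)%:R + psi R x.
  rewrite ln_fact /psi -big_split mulr_sumr !big_nat /=; apply: ler_sum => d /andP[d0 _].
  rewrite mulrCA -[X in _ <= _ + X]mulr1 -mulrDr ler_wpM2l ?vM_ge0 //.
  rewrite ler_pdivrMr ?ltr0n // natr1 -natrM ler_nat ltnW //.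
  exact: ltn_ceil.
have h1 := ln_fact_ge x; have h2 := ln_fact_le x; have h3 := psi_le R x.
rewrite -(ler_pM2l x0') -[X in X * `|_|]gtr0_norm // -normrM mulrBr ler_norml.
by move: lo hi h1 h2 h3; move: (x%:R * S) (x%:R * ln _) => a b *; apply/andP; split; lra.
Qed.

Lemma vM_div_ge0 d : 0 <= vM d / d%:R.
Proof. by rewrite mulr_ge0 ?vM_ge0 // invr_ge0. Qed.

(** The sum is a partial geometric series of ln p / p ^ k. As a recursion: dividing the multiples of
    p by p gives S(x) <= (ln p + S(x / p)) / p, and the inductive bound 2 ln p / p is at most ln
    p. *)
Lemma sum_vM_pmul p x : prime p ->
  \sum_(1 <= n < x.+1 | (p %| n)%N) vM n / n%:R <= 2 * ln p%:R / p%:R.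
Proof.
move=> pp; have p0 : 0 < p%:R :> R by rewrite ltr0n prime_gt0.
have lp : 0 <= ln p%:R :> R by apply: ln_nat_ge0.
have [k] := ubnP x; elim: k x => // k IH x xk.
have [->|x0] := posnP x.
  by rewrite big_geq // !mulr_ge0 // invr_ge0 ltW.
rewrite sum_dvdn ?prime_gt0 //.
apply: le_trans (_ : \sum_(1 <= m < (x %/ p).+1)
   p%:R^-1 * ((m == 1%N)%:R * ln p%:R + (if (p %| m)%N then vM m / m%:R else 0)) <= _).
  rewrite !big_nat; apply: ler_sum => m /andP[m0 _].
  have m0' : 0 < m%:R :> R by rewrite ltr0n.
  rewrite vM_mulp // natrM invfM mulrCA ler_wpM2l ?invr_ge0 ?(ltW p0) //.
  case: eqP => [->|_] /=; first by rewrite invr1 !mulr1 mul1r lerDl; case: ifP => // _; apply: vM_ge0.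
  by rewrite mul0r add0r; case: ifP; rewrite ?mul0r.
rewrite -mulr_sumr big_split /= -big_mkcond /= mulrC ler_pM2r ?invr_gt0 //.
have xp : (x %/ p < k)%N.
  by rewrite -ltnS (leq_trans _ xk) // ltnS ltn_Pdiv // prime_gt1.
have h1 := IH _ xp.
have h2 : \sum_(1 <= i < (x %/ p).+1) (i == 1%N)%:R * ln p%:R <= ln p%:R :> R.
  case: (x %/ p)%N => [|y]; first by rewrite big_geq.
  rewrite big_ltn //= mul1r big_nat_cond big1 ?addr0 // => i /andP[/andP[i1 _] _].
  by rewrite gtn_eqF // mul0r.
have h3 : 2 * ln p%:R / p%:R <= ln p%:R :> R.
  by rewrite ler_pdivrMr // mulrC ler_wpM2l // ler_nat prime_gt1.
lra.
Qed.

(** A proper prime power n is p times a multiple of p, so the sum is at most that of [F] over the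
    primes p, each giving at most 2 ln p / p ^ 2 by [sum_vM_pmul]. These telescope under twice the
    drops of [lnk2], and 4 = 2 * [lnk2 1]. *)
Lemma sum_vM_nonprime x : \sum_(1 <= n < x.+1 | ~~ prime n) vM n / n%:R <= 4.
Proof.
pose F d m : R := if prime d && (d %| m)%N then vM m / m%:R / d%:R else 0.
have F0 d m : 0 <= F d m by rewrite /F; case: ifP => // _; rewrite !mulr_ge0 ?vM_ge0 ?invr_ge0.
apply: le_trans (_ : \sum_(1 <= n < x.+1) \sum_(1 <= d < n.+1 | (d %| n)%N) F d (n %/ d)%N <= _).
  rewrite big_mkcond !big_nat; apply: ler_sum => n /andP[n0 _].
  have ge0 : 0 <= \sum_(1 <= d < n.+1 | (d %| n)%N) F d (n %/ d)%N by apply: sumr_ge0.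
  case: ifPn => // np; case: (eqVneq (vM n) 0) => [->|/vM_neq0[p [k [pp k0 nE]]]].
    by rewrite mul0r.
  have k1 : (1 < k)%N by case: k k0 nE => // -[|//] _ nE; move: np; rewrite nE expn1 pp.
  have nE' : n = (p * p ^ k.-1)%N by rewrite -expnS prednK.
  rewrite (@sum_divisors_ord _ (fun d => F d (n %/ d)%N) n n) ?n0 ?leqnn //.
  have pn : (p < n.+1)%N by rewrite ltnS dvdn_leq // nE' dvdn_mulr.
  rewrite (bigD1 (Ordinal pn)) /=; last by rewrite nE' dvdn_mulr.
  have -> : (n %/ p = p ^ k.-1)%N by rewrite nE' mulKn ?prime_gt0.
  have -> : vM n / n%:R = F p (p ^ k.-1)%N.
    rewrite /F pp dvdn_exp ?ltn_predRL //= nE !vM_pfactor ?ltn_predRL //.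
    by rewrite -nE nE' natrM invfM mulrA mulrAC.
  by rewrite lerDl sumr_ge0.
rewrite sum_divisors.
apply: le_trans (_ : \sum_(1 <= d < x.+1) (if d == 1%N then 0 else 2 * (lnk2 d.-1 - lnk2 d)) <= _).
  rewrite !big_nat; apply: ler_sum => d /andP[d0 _].
  have d0' : 0 < d%:R :> R by rewrite ltr0n.
  case: (boolP (prime d)) => pd; last first.
    rewrite big1 => [|m _]; last by rewrite /F (negPf pd).
    case: eqP => // /eqP d1; have d2 : (0 < d.-1)%N by lia.
    have := lnk2_drop d2; rewrite prednK // => h; rewrite mulr_ge0 //.
    apply: le_trans h; rewrite mulr_ge0 ?invr_ge0 ?mulr_ge0 //.
    by rewrite addr_ge0 // ln_nat_ge0.
  rewrite gtn_eqF ?prime_gt1 //.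
  rewrite (eq_bigr (fun m => (if (d %| m)%N then vM m / m%:R else 0) * d%:R^-1)); last first.
    by move=> m _; rewrite /F pd /=; case: ifP; rewrite ?mul0r.
  rewrite -mulr_suml -big_mkcond /=.
  have h1 := sum_vM_pmul (x %/ d) pd.
  have d2 : (0 < d.-1)%N by have := prime_gt1 pd; lia.
  have := lnk2_drop d2; rewrite prednK // => h2.
  have h3 : ln d%:R <= ln d.-1%:R + 1 :> R.
    have := ln_succ_le R d2; rewrite prednK // => h.
    have : d.-1%:R^-1 <= 1 :> R by rewrite invf_le1 ?ler1n // ltr0n.
    lra.
  rewrite ler_pdivrMr //; apply: le_trans h1 _.
  rewrite -!mulrA ler_pM2l // -ler_pdivrMr // -mulrA -invfM.
  apply: le_trans h2; apply: ler_pM => //.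
  - exact: ln_nat_ge0.
  - by rewrite invr_ge0 mulr_ge0.
  - by rewrite lef_pV2 ?posrE ?mulr_gt0 ?ltr0n // ler_pM2r // ler_nat leq_pred.
case: x => [|x]; first by rewrite big_geq.
rewrite big_ltn //= add0r.
rewrite (eq_big_nat _ _ (F2 := fun d => 2 * (lnk2 d.-1 - lnk2 d))); last first.
  by move=> d /andP[d1 _]; rewrite gtn_eqF.
rewrite -mulr_sumr big_add1 /= (eq_bigr (fun d => - lnk2 d.+1 - - lnk2 d)); last first.
  by move=> d _; rewrite opprK addrC.
rewrite telescope_sumr // opprK /lnk2 ln1 add0r divr1.
have : 0 <= (ln x.+1%:R + 2) / x.+1%:R :> R.
  by rewrite mulr_ge0 ?invr_ge0 // addr_ge0 // ln_nat_ge0.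
move: (_ / x.+1%:R) => t; lra.
Qed.

Lemma sum_vM_noncoprime q : (0 < q)%N ->
  exists C, forall x, \sum_(1 <= n < x.+1 | ~~ coprime n q) vM n / n%:R <= C.
Proof.
move=> q0; exists (\sum_(p <- primes q) 2 * ln p%:R / p%:R) => x.
apply: le_trans (_ : \sum_(p <- primes q) \sum_(1 <= n < x.+1 | (p %| n)%N) vM n / n%:R <= _).
  rewrite big_mkcond /= [leRHS](eq_bigr (fun p => \sum_(1 <= n < x.+1) (if (p %| n)%N then vM n / n%:R else 0))); last first.
    by move=> p _; rewrite big_mkcond.
  rewrite exchange_big /= !big_nat; apply: ler_sum => n /andP[n0 _].
  have ge0 p : 0 <= (if (p %| n)%N then vM n / n%:R else 0) :> R.
    by case: ifP; rewrite ?vM_div_ge0.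
  case: ifPn => cn; last by apply: sumr_ge0.
  have [p pp /andP[pn pq]] : exists2 p, prime p & (p %| n)%N && (p %| q)%N.
    exists (pdiv (gcdn n q)); last by rewrite -dvdn_gcd pdiv_dvd.
    by apply: pdiv_prime; rewrite ltn_neqAle eq_sym cn gcdn_gt0 n0.
  have pmem : p \in primes q by rewrite mem_primes pp q0.
  by rewrite (bigD1_seq p) ?primes_uniq //= pn lerDl sumr_ge0.
rewrite [leLHS]big_seq [leRHS]big_seq; apply: ler_sum => p.
by rewrite mem_primes => /andP[pp _]; apply: sum_vM_pmul.
Qed.

End Mertens.

(** * Values at 1 of L-series of mean-zero periodic functions *)

Section LSeries.
Variable R : realType.
Local Notation vM := (@vM R).
Implicit Types (s u v : nat -> R) (B C : R).

Lemma sum_ln x : \sum_(1 <= d < x.+1) ln d%:R = ln (x`!)%:R :> R.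
Proof.
elim: x => [|x IH]; first by rewrite big_geq // fact0 ln1.
by rewrite big_nat_recr //= IH factS natrM lnM ?posrE ?ltr0n ?fact_gt0 // addrC.
Qed.

Lemma lnk_diff k : (0 < k)%N ->
  `|ln k%:R / k%:R - ln k.+1%:R / k.+1%:R| <= lnk2 R k - lnk2 R k.+1.
Proof.
move=> k0; apply: le_trans (lnk2_drop R k0).
have k0' : 0 < k%:R :> R by rewrite ltr0n.
have k1' : 0 < k.+1%:R :> R by rewrite ltr0n.
have h1 := ln_succ_le R k0; have h2 := ln_nat_le R k0 (leqnSn k); have h3 := ln_nat_ge0 R k.
have -> : ln k%:R / k%:R - ln k.+1%:R / k.+1%:R
   = (ln k%:R - k%:R * (ln k.+1%:R - ln k%:R)) / (k%:R * k.+1%:R) :> R.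
  by rewrite -[k.+1%:R]natr1; field; rewrite natr1 !gt_eqF.
have kk : 0 < k%:R * k.+1%:R :> R by rewrite mulr_gt0.
rewrite normrM [`|_^-1|]gtr0_norm ?invr_gt0 // ler_pM2r ?invr_gt0 //.
have h4 : k%:R * (ln k.+1%:R - ln k%:R) <= 1 :> R by rewrite mulrC -ler_pdivlMr // mul1r.
have h5 : 0 <= k%:R * (ln k.+1%:R - ln k%:R) :> R by rewrite mulr_ge0 ?(ltW k0') // subr_ge0.
by rewrite ler_norml; move: (_ * _) h3 h4 h5 => t *; apply/andP; split; lra.
Qed.

Lemma ln_bounded_eq0 c C : (forall x, (0 < x)%N -> ln x%:R * c <= C) -> c <= 0 :> R.
Proof.
move=> H; rewrite leNgt; apply/negP => c0.
have l2 : 0 < ln 2%:R :> R by rewrite ln_gt0 // ltr1n.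
pose k := (Num.truncn (C / (ln 2%:R * c))).+1.
have := H (2 ^ k)%N; rewrite expn_gt0 => /(_ isT); rewrite natrX lnXn // -[ln _ *+ _]mulr_natr.
rewrite mulrAC -ler_pdivlMl ?mulr_gt0 // mulrC leNgt => /negP[].
exact: truncnS_gt.
Qed.

(** Convergence at the rate 1 / m. The rate is what later estimates consume, and uniqueness and
    linearity of such limits are elementary. *)
Definition rconv s a := exists B, forall m, `|a - s m| <= B / m.+1%:R.

Lemma rconv_unique s a b : rconv s a -> rconv s b -> a = b.
Proof.
move=> [B HB] [C HC]; apply/eqP; rewrite -subr_eq0 -normr_le0.
apply: (@ler_arch_mul _ _ (B + C)) => n; rewrite mulrDl.
have -> : a - b = (a - s n) - (b - s n) by ring.
by apply: le_trans (ler_normB _ _) (lerD _ _).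
Qed.

Lemma rconv_sum (I : finType) (c : I -> R) (s : I -> nat -> R) (a : I -> R) :
  (forall i, rconv (s i) (a i)) ->
  rconv (fun m => \sum_i c i * s i m) (\sum_i c i * a i).
Proof.
move=> /choice[B HB]; exists (\sum_i `|c i| * B i) => m.
rewrite -sumrB mulr_suml; apply: le_trans (ler_norm_sum _ _ _) _.
apply: ler_sum => i _; rewrite -mulrBr normrM -mulrA ler_wpM2l //; exact: HB.
Qed.

Lemma rconv_ext s t a : s =1 t -> rconv s a -> rconv t a.
Proof. by move=> /funext->. Qed.

Definition hsum u m := \sum_(1 <= k < m.+1) u k / k%:R.

(** The value at 1 of the Dirichlet series of [u], with default 0 when the series does not converge
    at the rate of [rconv]. *)
Definition Lf u : R := xget 0 [set a | rconv (hsum u) a]%classic.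

Lemma Lf_eq u a : rconv (hsum u) a -> Lf u = a.
Proof.
move=> H; apply: (@rconv_unique (hsum u)) => //.
by rewrite /Lf; case: xgetP => [b _ Hb|Hn] //; case: (Hn a).
Qed.

Variable q : nat.
Hypothesis q0 : (0 < q)%N.

(** Over the complex numbers this would be the span of the non-principal characters mod q. Mean zero
    bounds the partial sums, hence makes the series of u k / k converge. *)
Definition inV u := [/\ forall n, u (n + q)%N = u n,
  forall n, ~~ coprime n q -> u n = 0 & \sum_(0 <= i < q) u i = 0].

Definition periodic u := forall n, u (n + q)%N = u n.

Lemma coprimeDq n : coprime (n + q) q = coprime n q.
Proof. by rewrite /coprime gcdnC gcdnDr gcdnC. Qed.

Lemma periodic_mod u n : periodic u -> u (n %% q)%N = u n.
Proof.
move=> pu; have H k r : u (r + k * q)%N = u r.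
  by elim: k => [|k IH]; [rewrite mul0n addn0 | rewrite mulSnr addnA pu].
by rewrite [in RHS](divn_eq n q) addnC H.
Qed.

Lemma periodic_eqmod u m n : periodic u -> m = n %[mod q] -> u m = u n.
Proof. by move=> pu mn; rewrite -(periodic_mod m) // mn periodic_mod. Qed.

Lemma sum_residue_mul (u : nat -> R) d : periodic u -> coprime d q ->
  \sum_(0 <= i < q) u (d * i)%N = \sum_(0 <= i < q) u i.
Proof.
move=> pu dq; rewrite !big_mkord.
pose h (i : 'I_q) : 'I_q := Ordinal (ltn_pmod (d * i) q0).
have hinj : injective h.
  move=> i j /(congr1 val) /= ij; apply: val_inj => /=.
  wlog lij : i j ij / (i <= j)%N.
    by move=> W; have [/W->|/ltnW/W->] := leqP i j.
  have : (q %| d * (j - i))%N by rewrite mulnBr -eqn_mod_dvd ?leq_mul2l ?lij ?orbT // ij.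
  rewrite Gauss_dvdr; last by rewrite coprime_sym.
  have lt : (j - i < q)%N by rewrite (leq_ltn_trans (leq_subr _ _)).
  move=> dv; apply/eqP; rewrite eqn_leq lij /= -subn_eq0.
  by apply: contraTT dv => nz; rewrite gtnNdvd // lt0n.
rewrite [RHS](reindex_inj hinj) /=; apply: eq_bigr => i _.
by rewrite periodic_mod.
Qed.

Lemma inV_shift u d : coprime d q -> inV u -> inV (fun k => u (d * k)%N).
Proof.
move=> dq [pu zu su]; split.
- move=> n; rewrite mulnDr; apply: periodic_eqmod => //.
  by rewrite -modnDmr modnMl addn0.
- by move=> n nq; apply: zu; rewrite coprimeMl dq.
- by rewrite sum_residue_mul.
Qed.

Lemma inV_bounded u : inV u ->
  exists B, forall d, coprime d q -> forall m n, `|\sum_(m <= i < n) u (d * i)%N| <= B.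
Proof.
move=> Vu; pose M := \sum_(0 <= i < q) `|u i|.
have [pu _ _] := Vu.
have HM n : `|u n| <= M.
  rewrite -periodic_mod // /M big_mkord (bigD1 (Ordinal (ltn_pmod n q0))) //=.
  by rewrite lerDl sumr_ge0.
exists (q%:R * M + q%:R * M) => d dq m n.
have [pd _ sd] := inV_shift dq Vu.
pose S n := \sum_(0 <= i < n) u (d * i)%N.
have SB k : `|S k| <= q%:R * M.
  have -> : S k = S (k %% q)%N.
    rewrite {1}(divn_eq k q); elim: (k %/ q)%N => [|j IH]; first by rewrite mul0n.
    rewrite -IH mulSn -addnA /S [LHS](big_cat_nat (n := q)) //= ?leq_addr //.
    rewrite sd add0r -{1}[q]add0n big_addn addKn.
    by apply: eq_big_nat => i _; rewrite pd.
  apply: le_trans (ler_norm_sum _ _ _) _.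
  apply: le_trans (_ : \sum_(0 <= i < k %% q) M <= _); first exact: ler_sum.
  rewrite sumr_const_nat subn0 -[M *+ _]mulr_natl ler_wpM2r ?ler_nat //.
    by apply: le_trans (HM 0%N).
  by rewrite ltnW // ltn_pmod.
have [mn|nm] := leqP m n; last first.
  by rewrite big_geq ?normr0 ?(ltnW nm) // addr_ge0 // (le_trans _ (SB 0%N)).
have -> : \sum_(m <= i < n) u (d * i)%N = S n - S m.
  by rewrite /S (big_cat_nat (leq0n m) mn) /= addrAC subrr add0r.
by apply: le_trans (ler_normB _ _) (lerD _ _).
Qed.

Lemma hsum_tail u B m n : (m <= n)%N -> (forall k l, `|\sum_(k <= i < l) u i| <= B) ->
  `|hsum u n - hsum u m| <= B / m.+1%:R.
Proof.
move=> mn HB; rewrite /hsum (big_cat_nat (n := m.+1)) //= addrAC subrr add0r.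
apply: (@abel_bound R u (fun k => k%:R^-1) (fun k => k%:R^-1)) => // k mk.
  by rewrite ger0_norm // invr_ge0.
have k0 : (0 < k)%N by apply: leq_ltn_trans mk.
by rewrite ger0_norm // subr_ge0 lef_pV2 ?posrE ?ltr0n // ler_nat.
Qed.

Lemma LfP u : inV u -> exists B, forall d, coprime d q -> forall m,
  `|Lf (fun k => u (d * k)%N) - hsum (fun k => u (d * k)%N) m| <= B / m.+1%:R.
Proof.
move=> Vu; have [B HB] := inV_bounded Vu; exists B => d dq.
have [a Ha] := lim_exists (fun m n mn => hsum_tail mn (HB d dq)).
by rewrite (Lf_eq (ex_intro _ B Ha)).
Qed.

Lemma rconv_Lf u : inV u -> rconv (hsum u) (Lf u).
Proof.
move=> /LfP[B HB]; exists B => m; have := HB 1%N (coprime1n q) m.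
by under [X in Lf X]eq_fun do rewrite mul1n; under [X in hsum X]eq_fun do rewrite mul1n.
Qed.

(* For a Dirichlet character chi, [Lop chi] would be L(1, chi) * chi. *)
Definition Lop u n : R := if coprime n q then Lf (fun k => u (n * k)%N) else 0.

(* Both sides vanish when [d] is not coprime to [q]. *)
Lemma Lop_approx u : inV u -> exists2 B, 0 <= B & forall d x, (0 < d)%N -> (0 < x)%N ->
  `|hsum (fun k => u (d * k)%N) (x %/ d) - Lop u d| <= B * (d%:R / x%:R).
Proof.
move=> Vu; have [B HB] := LfP Vu; have [_ zu _] := Vu.
have B0 : 0 <= B.
  by have := HB 1%N (coprime1n q) 0%N; rewrite divr1; apply: le_trans.
exists B => // d x d0 x0; rewrite /Lop; case: ifPn => dq.
  rewrite distrC; apply: le_trans (HB d dq _) _; rewrite ler_wpM2l //.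
  rewrite -invf_div lef_pV2 ?posrE ?divr_gt0 ?ltr0n //.
  by rewrite ler_pdivrMr ?ltr0n // -natrM ler_nat ltnW // ltn_ceil.
rewrite subr0 /hsum big1 ?normr0; first by rewrite mulr_ge0 // divr_ge0.
by move=> k _; rewrite zu ?mul0r // coprimeMl negb_and dq.
Qed.

(** The sum of u k * ln k / k is bounded by partial summation. Expanding ln k by [sum_vM] turns it
    into a sum of [vM d / d] times truncated series, each equal to [Lop u d] up to B * d / x; the
    total error is B * psi x / x <= 4B. *)
Lemma sum_vM_Lop_bounded u : inV u -> exists C, forall x, (0 < x)%N ->
  `|\sum_(1 <= n < x.+1) vM n / n%:R * Lop u n| <= C.
Proof.
move=> Vu; have [B B0 HB] := Lop_approx Vu; have [D HD] := inV_bounded Vu.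
have HD1 m n : `|\sum_(m <= i < n) u i| <= D.
  have := HD 1%N (coprime1n q) m n; by under eq_bigr do rewrite mul1n.
exists (D * lnk2 R 1 + B * 4) => x x0; have x0' : 0 < x%:R :> R by rewrite ltr0n.
have E : \sum_(1 <= k < x.+1) u k * (ln k%:R / k%:R) =
    \sum_(1 <= d < x.+1) vM d / d%:R * hsum (fun k => u (d * k)%N) (x %/ d).
  transitivity (\sum_(1 <= k < x.+1) \sum_(1 <= d < k.+1 | (d %| k)%N)
     vM d / d%:R * (u (d * (k %/ d))%N / (k %/ d)%:R)).
    apply: eq_big_nat => k /andP[k0 _]; rewrite -sum_vM // mulr_suml mulr_sumr.
    apply: eq_bigr => d dk; rewrite mulnC divnK //.
    have -> : k%:R = d%:R * (k %/ d)%:R :> R by rewrite -natrM mulnC divnK.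
    by rewrite invfM; ring.
  rewrite (sum_divisors (fun d m => vM d / d%:R * (u (d * m)%N / m%:R))).
  by apply: eq_bigr => d _; rewrite mulr_sumr.
have H1 : `|\sum_(1 <= k < x.+1) u k * (ln k%:R / k%:R)| <= D * lnk2 R 1.
  apply: abel_bound => // k k0; last exact: lnk_diff.
  rewrite ger0_norm; last by rewrite divr_ge0 ?ln_nat_ge0.
  by rewrite ler_wpM2r ?invr_ge0 // lerDl.
have H2 : `|\sum_(1 <= d < x.+1) vM d / d%:R * (hsum (fun k => u (d * k)%N) (x %/ d) - Lop u d)| <= B * 4.
  apply: le_trans (ler_norm_sum _ _ _) _.
  apply: le_trans (_ : \sum_(1 <= d < x.+1) vM d * (B / x%:R) <= _).
    rewrite !big_nat; apply: ler_sum => d /andP[d0 _].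
    have d0' : 0 < d%:R :> R by rewrite ltr0n.
    rewrite normrM ger0_norm ?vM_div_ge0 //.
    apply: le_trans (ler_wpM2l (vM_div_ge0 _ _) (HB _ _ d0 x0)) _.
    rewrite -mulrA ler_wpM2l ?vM_ge0 // mulrCA ler_wpM2l //.
    by rewrite mulKf ?gt_eqF.
  rewrite -mulr_suml mulrCA ler_wpM2l // ler_pdivrMr //; exact: psi_le.
have -> : \sum_(1 <= n < x.+1) vM n / n%:R * Lop u n =
   \sum_(1 <= k < x.+1) u k * (ln k%:R / k%:R) -
   \sum_(1 <= d < x.+1) vM d / d%:R * (hsum (fun k => u (d * k)%N) (x %/ d) - Lop u d).
  by rewrite E -sumrB; apply: eq_bigr => d _; ring.
exact: le_trans (ler_normB _ _) (lerD H1 H2).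
Qed.

(** The analogue of the estimate for a character with L(1, chi) = 0. By [sum_mobius_ln] with t = ln
    x, the left side is a sum over d of Moebius weights times truncated series, which are now O(d /
    x) as their limits vanish. The total weight of ln x - ln d over d <= x is x ln x - ln x! <=
    x. *)
Lemma sum_vM_ker_Lop u : inV u -> (forall n, Lop u n = 0) -> exists C, forall x, (0 < x)%N ->
  `|\sum_(1 <= n < x.+1) vM n / n%:R * u n + ln x%:R * u 1%N| <= C.
Proof.
move=> Vu Lu0; have [B B0 HB] := Lop_approx Vu.
exists B => x x0; have x0' : 0 < x%:R :> R by rewrite ltr0n.
have -> : \sum_(1 <= n < x.+1) vM n / n%:R * u n + ln x%:R * u 1%N =
  \sum_(1 <= k < x.+1) u k / k%:R *
    \sum_(1 <= d < k.+1 | (d %| k)%N) mobius R d * (ln x%:R - ln d%:R).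
  transitivity (\sum_(1 <= k < x.+1) (vM k / k%:R * u k + (k == 1%N)%:R * (ln x%:R * u 1%N))).
    rewrite big_split /= ; congr (_ + _).
    rewrite big_ltn //= mul1r big_nat_cond big1 ?addr0 // => k /andP[/andP[k1 _] _].
    by rewrite gtn_eqF // mul0r.
  apply: eq_big_nat => k /andP[k0 _]; rewrite sum_mobius_ln //.
  by case: eqP => [->|_] /=; rewrite ?invr1; ring.
have -> : \sum_(1 <= k < x.+1) u k / k%:R *
    \sum_(1 <= d < k.+1 | (d %| k)%N) mobius R d * (ln x%:R - ln d%:R) =
  \sum_(1 <= d < x.+1) mobius R d * (ln x%:R - ln d%:R) / d%:R * hsum (fun k => u (d * k)%N) (x %/ d).
  transitivity (\sum_(1 <= k < x.+1) \sum_(1 <= d < k.+1 | (d %| k)%N)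
     mobius R d * (ln x%:R - ln d%:R) / d%:R * (u (d * (k %/ d))%N / (k %/ d)%:R)).
    apply: eq_big_nat => k /andP[k0 _]; rewrite mulr_sumr.
    apply: eq_bigr => d dk; rewrite mulnC divnK //.
    have -> : k%:R = d%:R * (k %/ d)%:R :> R by rewrite -natrM mulnC divnK.
    by rewrite invfM; ring.
  rewrite (sum_divisors (fun d m => mobius R d * (ln x%:R - ln d%:R) / d%:R * (u (d * m)%N / m%:R))).
  by apply: eq_bigr => d _; rewrite mulr_sumr.
apply: le_trans (ler_norm_sum _ _ _) _.
apply: le_trans (_ : \sum_(1 <= d < x.+1) (ln x%:R - ln d%:R) * (B / x%:R) <= _).
  rewrite !big_nat; apply: ler_sum => d /andP[d0 dx].
  have d0' : 0 < d%:R :> R by rewrite ltr0n.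
  have ld : 0 <= ln x%:R - ln d%:R :> R by rewrite subr_ge0 ln_nat_le.
  have := HB _ _ d0 x0; rewrite Lu0 subr0 => h.
  rewrite -mulrA normrM normrM -[leRHS]mul1r -mulrA; apply: ler_pM => //.
  - by rewrite mulr_ge0.
  - exact: mobius_le1.
  rewrite ger0_norm // ler_wpM2l // normrM gtr0_norm ?invr_gt0 //.
  by rewrite ler_pdivrMl // mulrCA.
rewrite -mulr_suml sumrB sum_ln sumr_const_nat subn1 /= -[ln _ *+ _]mulr_natl.
have h := ln_fact_ge R x; rewrite mulrA ler_pdivrMr // [leLHS]mulrC ler_wpM2l //.
by move: h; move: (ln (x`!)%:R) (_ * ln _) => *; lra.
Qed.

Lemma mertens_coprime : exists C, forall x, (0 < x)%N ->
  `|\sum_(1 <= n < x.+1 | coprime n q) vM n / n%:R - ln x%:R| <= C.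
Proof.
have [C HC] := sum_vM_noncoprime R q0; exists (4 + C) => x x0.
have := mertens R x0; rewrite (bigID (fun n => coprime n q)) /= => h.
have h2 := HC x; have h3 : 0 <= \sum_(1 <= n < x.+1 | ~~ coprime n q) vM n / n%:R.
  by apply: sumr_ge0 => n _; apply: vM_div_ge0.
move: h h2 h3; move: (\sum_(_ <= _ < _ | ~~ _) _) (\sum_(_ <= _ < _ | _) _) (ln _) => a b c.
by rewrite !ler_norml => /andP[h1 h2] h3 h4; apply/andP; split; lra.
Qed.

Definition vM_class (g x : nat) : R := \sum_(1 <= n < x.+1 | n == g %[mod q]) vM n / n%:R.

(* A class is heavy when sum_{n = g mod q} vM(n)/n diverges; Dirichlet's theorem
   says that every class coprime to q is heavy. *)
Definition heavy g := coprime g q /\ ~ exists C, forall x, vM_class g x <= C.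

Lemma vM_class_ge0 g x : 0 <= vM_class g x.
Proof. by apply: sumr_ge0 => n _; apply: vM_div_ge0. Qed.

Lemma sum_residues (F : nat -> R) x :
  \sum_(1 <= n < x.+1) F n = \sum_(g < q) \sum_(1 <= n < x.+1 | n == g %[mod q]) F n.
Proof.
rewrite (eq_bigr (fun g : 'I_q => \sum_(1 <= n < x.+1) (if n == g %[mod q] then F n else 0))); last first.
  by move=> g _; rewrite big_mkcond.
rewrite exchange_big /=; apply: eq_bigr => n _.
rewrite (bigD1 (Ordinal (ltn_pmod n q0))) //= modn_mod eqxx big1 ?addr0 // => g gn.
rewrite ifF //; apply: contraNF gn => /eqP ng; apply/eqP/val_inj => /=.
by rewrite ng modn_small.
Qed.

(** On the units, w - w 1 vanishes on heavy classes, and the remaining unit classes have bounded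
    total weight; so w may be replaced by the constant w 1, for which [mertens_coprime] gives ln
    x. *)
Lemma heavy_fixed_sum w : periodic w -> (forall n, ~~ coprime n q -> w n = 0) ->
  (forall g, heavy g -> w g = w 1%N) -> exists C, forall x, (0 < x)%N ->
  `|\sum_(1 <= n < x.+1) vM n / n%:R * w n - ln x%:R * w 1%N| <= C.
Proof.
move=> pw zw hw; have [C3 HC3] := mertens_coprime.
pose z n : R := if coprime n q then w n - w 1%N else 0.
have pz : periodic z.
  by move=> n; rewrite /z pw coprimeDq.
have Hg (g : 'I_q) : exists C, forall x, (0 < x)%N ->
    `|\sum_(1 <= n < x.+1 | n == g %[mod q]) vM n / n%:R * z n| <= C.
  have E x : \sum_(1 <= n < x.+1 | n == g %[mod q]) vM n / n%:R * z n = vM_class g x * z g.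
    rewrite /vM_class mulr_suml; apply: eq_bigr => n /eqP ng.
    by rewrite (periodic_eqmod pz ng).
  have [hg|nhg] := pselect (heavy g).
    by exists 0 => x _; rewrite E /z (hw _ hg) subrr; case: ifP; rewrite mulr0 normr0.
  case: (boolP (coprime g q)) => gq; last first.
    by exists 0 => x _; rewrite E /z (negPf gq) mulr0 normr0.
  have [C HC] : exists C, forall x, vM_class g x <= C.
    by apply: contrapT => H; apply: nhg.
  exists (C * `|z g|) => x _; rewrite E normrM ger0_norm ?vM_class_ge0 //.
  by rewrite ler_wpM2r.
have [f Hf] := choice Hg.
exists (\sum_g f g + C3 * `|w 1%N|) => x x0.
have -> : \sum_(1 <= n < x.+1) vM n / n%:R * w n - ln x%:R * w 1%N =
  \sum_(1 <= n < x.+1) vM n / n%:R * z n +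
  (\sum_(1 <= n < x.+1 | coprime n q) vM n / n%:R - ln x%:R) * w 1%N.
  rewrite mulrBl addrA; congr (_ - _).
  rewrite [X in _ + X * _]big_mkcond mulr_suml -big_split; apply: eq_bigr => n _ /=.
  rewrite /z; case: ifPn => nq; first by ring.
  by rewrite (zw n nq); ring.
apply: le_trans (ler_normD _ _) _; apply: lerD.
  rewrite sum_residues; apply: le_trans (ler_norm_sum _ _ _) _.
  by apply: ler_sum => g _; apply: Hf.
by rewrite normrM ler_wpM2r // HC3.
Qed.

Lemma ln_bounded_norm c C : (forall x, (0 < x)%N -> `|ln x%:R * c| <= C) -> c = 0.
Proof.
move=> H; apply/eqP; rewrite -normr_le0; apply: (@ln_bounded_eq0 _ C) => x x0.
by have := H x x0; rewrite normrM ger0_norm // ln_nat_ge0.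
Qed.

Lemma Lop_shift u y n : coprime y q -> Lop (fun k => u (y * k)%N) n = Lop u (y * n)%N.
Proof.
move=> yq; rewrite /Lop coprimeMl yq /=; case: ifP => // _.
by congr Lf; apply: funext => k; rewrite mulnA.
Qed.

Lemma Lop_periodic u : inV u -> periodic (Lop u).
Proof.
move=> [pu _ _] n; rewrite /Lop coprimeDq; case: ifP => // _.
congr Lf; apply: funext => k; rewrite mulnDl.
by apply: periodic_eqmod => //; rewrite -modnDmr modnMr addn0.
Qed.

(* If v is fixed by the heavy classes then so is Lop v, and the weights vM(n)/n sit
   on the heavy classes up to a bounded error; as the sums of vM(n)/n against Lop v
   are bounded, Lop v vanishes, and then the sums up to x against v are both
   ln x * v(1) + O(1) and - ln x * v(1) + O(1). *)
Lemma heavy_fixed_eq0 v : inV v ->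
  (forall g n, heavy g -> v (g * n)%N = v n) -> forall n, v n = 0.
Proof.
(* The value at a unit n is the value at 1 of the shifted function k -> v (n k), which satisfies the
   same hypotheses. *)
suff H v' : inV v' -> (forall g n, heavy g -> v' (g * n)%N = v' n) -> v' 1%N = 0.
  move=> Vv hv n; case: (boolP (coprime n q)) => nq; last by case: Vv => _ ->.
  rewrite -[n]muln1; apply: (H _ (inV_shift nq Vv)) => g k hg /=.
  by rewrite mulnCA hv.
have W v1 : inV v1 -> (forall g n, heavy g -> v1 (g * n)%N = v1 n) -> Lop v1 1 = 0.
  move=> Vv hv; have [pv zv _] := Vv.
  have hw g : heavy g -> Lop v1 g = Lop v1 1%N.
    move=> hg; rewrite /Lop hg.1 coprime1n; congr Lf; apply: funext => k.
    by rewrite hv // mul1n.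
  have zw n : ~~ coprime n q -> Lop v1 n = 0 by rewrite /Lop => /negPf->.
  have [C HC] := heavy_fixed_sum (Lop_periodic Vv) zw hw.
  have [D HD] := sum_vM_Lop_bounded Vv; apply: (@ln_bounded_norm _ (D + C)) => x x0.
  have := HC x x0; have := HD x x0.
  move: (\sum_(_ <= _ < _) _) (_ * _) => a b.
  by rewrite !ler_norml => /andP[? ?] /andP[? ?]; apply/andP; split; lra.
rename v' into v1 => Vv hv; have [pv zv _] := Vv.
have L0 n : Lop v1 n = 0.
  case: (boolP (coprime n q)) => nq; last by rewrite /Lop (negPf nq).
  rewrite -[n]muln1 -Lop_shift //; apply: W; first exact: inV_shift.
  by move=> g k hg; rewrite mulnCA hv.
have h1 g : heavy g -> v1 g = v1 1%N by move=> hg; rewrite -{1}[g]muln1 hv.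
have [C HC] := heavy_fixed_sum pv zv h1; have [D HD] := sum_vM_ker_Lop Vv L0.
have : 2 * v1 1%N = 0.
  apply: (@ln_bounded_norm _ (D + C)) => x x0.
  have := HC x x0; have := HD x x0; rewrite mulrCA.
  move: (\sum_(_ <= _ < _) _) (_ * _) => a b.
  by rewrite !ler_norml => /andP[? ?] /andP[? ?]; apply/andP; split; lra.
by move=> h; lra.
Qed.

End LSeries.

(** * Non-vanishing of L(1, chi) for a real character *)

Section RealCharacter.
Variable R : realType.
Variable chi : nat -> R.
Hypothesis chi1 : chi 1 = 1.
Hypothesis chiM : forall m n, chi (m * n)%N = chi m * chi n.
Hypothesis chi_val : forall n, [\/ chi n = 0, chi n = 1 | chi n = -1].

Definition dsum n := \sum_(1 <= d < n.+1 | (d %| n)%N) chi d.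

Lemma chiX p k : chi (p ^ k)%N = chi p ^+ k.
Proof. by elim: k => [|k IH]; rewrite ?expr0 // expnS chiM IH exprS. Qed.

Lemma dsum_pmul p k m : prime p -> (0 < m)%N -> ~~ (p %| m)%N ->
  dsum (p ^ k.+1 * m) = dsum (p ^ k * m) + chi p ^+ k.+1 * dsum m.
Proof.
move=> pp m0 pm; have p0 := prime_gt0 pp.
set N := (p ^ k.+1 * m)%N; set n := (p ^ k * m)%N.
have N0 : (0 < N)%N by rewrite muln_gt0 expn_gt0 p0.
have n0 : (0 < n)%N by rewrite muln_gt0 expn_gt0 p0.
have nN : (n %| N)%N by rewrite dvdn_mul // dvdn_exp2l.
have equ d : (d %| N)%N -> ~~ (d %| n)%N = (p ^ k.+1 %| d)%N.
  move=> dN; have d0 := dvdn_gt0 N0 dN; apply/idP/idP.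
    apply: contraR => pd; have [e pe dE] := pfactor_coprime pp d0.
    rewrite dE mulnC; apply: dvdn_mul.
      by rewrite dvdn_exp2l // -ltnS ltnNge -pfactor_dvdn.
    have : (e %| N)%N by apply: dvdn_trans dN; rewrite dE dvdn_mulr.
    by rewrite Gauss_dvdr // coprimeXr // coprime_sym.
  move=> pd; apply: contra pm => dn; have := dvdn_trans pd dn.
  by rewrite expnSr dvdn_pmul2l // expn_gt0 p0.
have leNN : (0 < N <= N)%N by rewrite N0 leqnn.
rewrite /dsum (sum_divisors_ord _ leNN) (bigID (fun d : 'I__ => (d %| n)%N)) /=.
congr (_ + _).
  have leN : (0 < n <= N)%N by rewrite n0 dvdn_leq.
  rewrite (sum_divisors_ord _ leN); apply: eq_bigl => d.
  by apply: andb_idl => dn; apply: dvdn_trans nN.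
rewrite (eq_bigl (fun d : 'I_N.+1 => (d %| N)%N && (p ^ k.+1 %| d)%N)); last first.
  by move=> d; case dN : (d %| N)%N => //=; rewrite equ.
rewrite -(big_mkord (fun d => (d %| N)%N && (p ^ k.+1 %| d)%N) chi) big_ltn_cond //.
rewrite dvd0n (gtn_eqF N0) /= big_mkcond /=.
rewrite (eq_bigr (fun d => if (p ^ k.+1 %| d)%N then (if (d %| N)%N then chi d else 0) else 0)); last first.
  by move=> d _; case: (d %| N)%N; case: (_ %| d)%N.
rewrite -big_mkcond /= sum_dvdn ?expn_gt0 ?p0 // /N mulKn ?expn_gt0 ?p0 //.
rewrite mulr_sumr [RHS]big_mkcond; apply: eq_bigr => e _.
by rewrite dvdn_pmul2l ?expn_gt0 ?p0 // chiM chiX.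
Qed.

Lemma dsum_pfactor p k m : prime p -> (0 < m)%N -> ~~ (p %| m)%N ->
  dsum (p ^ k * m) = (\sum_(i < k.+1) chi p ^+ i) * dsum m.
Proof.
move=> pp m0 pm; elim: k => [|k IH].
  by rewrite big_ord_recl big_ord0 expr0 addr0 mul1r mul1n.
by rewrite dsum_pmul // IH [in RHS]big_ord_recr mulrDl.
Qed.

Lemma geom_sum_ge (c : R) k : [\/ c = 0, c = 1 | c = -1] ->
  (~~ odd k)%:R <= \sum_(i < k.+1) c ^+ i.
Proof.
case=> ->.
- rewrite big_ord_recl expr0 big1 ?addr0; first by case: odd; rewrite ?ler01.
  by move=> i _; rewrite /= exprS mul0r.
- under eq_bigr do rewrite expr1n.
  by rewrite sumr_const card_ord ler_nat; case: odd.
elim: k => [|k IH]; first by rewrite big_ord_recl big_ord0 expr0 addr0.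
have -> : \sum_(i < k.+2) (-1) ^+ i = (~~ odd k.+1)%:R :> R; last by [].
elim: k.+1 => [|j IHj]; first by rewrite big_ord_recl big_ord0 expr0 addr0.
rewrite big_ord_recr IHj /= negbK -signr_odd /=.
by case: (odd j); rewrite /= ?expr0 ?expr1 ?add0r ?subrr.
Qed.

(** [dsum] is a product of geometric sums over the prime powers exactly dividing n, each
    non-negative, and at least 1 for an even exponent. Squares are described by their valuations so
    that the induction can strip one prime. *)
Lemma dsum_ge n : (0 < n)%N ->
  0 <= dsum n /\ ((forall p, ~~ odd (logn p n)) -> 1 <= dsum n).
Proof.
have [k] := ubnP n; elim: k n => // k IH n nk n0.
have [->|n1] := eqVneq n 1%N.
  by rewrite /dsum big_mkcond big_nat1 dvd1n chi1.
have n2 : (1 < n)%N by rewrite ltn_neqAle eq_sym n1.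
set p := pdiv n; have pp : prime p by apply: pdiv_prime.
have [m pm nE] := pfactor_coprime pp n0.
have m0 : (0 < m)%N by move: n0; rewrite nE muln_gt0 => /andP[].
have v0 : (0 < logn p n)%N by rewrite logn_gt0 mem_primes pp n0 pdiv_dvd.
have mn : (m < n)%N.
  by rewrite [X in (_ < X)%N]nE -[X in (X < _)%N]muln1 ltn_pmul2l // -(expn0 p) ltn_exp2l // prime_gt1.
have [m1 m2] := IH m (leq_trans mn nk) m0.
have pm' : ~~ (p %| m)%N by rewrite -prime_coprime.
have -> : dsum n = (\sum_(i < (logn p n).+1) chi p ^+ i) * dsum m.
  by rewrite -dsum_pfactor // mulnC -nE.
have g := geom_sum_ge (logn p n) (chi_val p).
have g0 : 0 <= \sum_(i < (logn p n).+1) chi p ^+ i by apply: le_trans g.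
split; first exact: mulr_ge0.
move=> ev; rewrite (ev p) in g; rewrite -[1]mul1r; apply: ler_pM => //.
apply: m2 => r; case: (eqVneq r p) => [->|rp].
  have -> : logn p m = 0%N by apply/eqP; rewrite -leqn0 leqNgt logn_gt0 mem_primes pp m0.
  by [].
have pv0 : (0 < p ^ logn p n)%N by rewrite expn_gt0 prime_gt0.
have := ev r; rewrite nE lognM // lognX.
case pr : (prime r); last by rewrite lognE pr.
by rewrite (logn_prime _ pp) (negPf rp) muln0 addn0.
Qed.

Definition rsq (n : nat) : R := (Num.sqrt n%:R)^-1.
Definition Hsq n := \sum_(1 <= m < n.+1) rsq m.

Lemma sqrt_gt0 n : (0 < n)%N -> 0 < Num.sqrt n%:R :> R.
Proof. by move=> n0; rewrite sqrtr_gt0 ltr0n. Qed.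

Lemma rsq_gt0 n : (0 < n)%N -> 0 < rsq n.
Proof. by move=> n0; rewrite invr_gt0 sqrt_gt0. Qed.

Lemma rsq_ge0 n : 0 <= rsq n.
Proof. by rewrite invr_ge0 sqrtr_ge0. Qed.

Lemma rsq_le m n : (0 < m)%N -> (m <= n)%N -> rsq n <= rsq m.
Proof.
move=> m0 mn; rewrite lef_pV2 ?posrE ?sqrt_gt0 ?(leq_trans m0) //.
by rewrite ler_sqrt ?ler_nat.
Qed.

Lemma rsqM m n : rsq (m * n) = rsq m * rsq n.
Proof. by rewrite /rsq natrM sqrtrM // invfM. Qed.

Lemma rsq_sqr n : rsq (n * n) = n%:R^-1.
Proof. by rewrite rsqM -invfM -expr2 sqr_sqrtr. Qed.

Lemma rsq2 n : rsq n * rsq n = n%:R^-1.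
Proof. by rewrite -rsqM rsq_sqr. Qed.

Lemma sqrt_step n : (0 < n)%N ->
  rsq n.+1 <= 2 * (Num.sqrt n.+1%:R - Num.sqrt n%:R) <= rsq n.
Proof.
move=> n0; rewrite /rsq; set a := Num.sqrt n%:R; set b := Num.sqrt _.
have a0 : 0 < a by apply: sqrt_gt0.
have b0 : 0 < b by apply: sqrt_gt0.
have aE : a ^+ 2 = n%:R by rewrite sqr_sqrtr.
have bE : b ^+ 2 = a ^+ 2 + 1 by rewrite aE sqr_sqrtr // natr1.
have ab : a <= b by rewrite ler_sqrt // ler_nat.
have sq := sqr_ge0 (b - a); rewrite sqrrB in sq.
apply/andP; split.
  by rewrite -div1r ler_pdivrMr //; move: sq bE; rewrite !expr2 => *; nra.
by rewrite -div1r ler_pdivlMr //; move: sq bE; rewrite !expr2 => *; nra.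
Qed.

(** The constant is zeta(1/2). The difference [Hsq n] - 2 sqrt n decreases, and by [sqrt_step] its
    decrements are at most those of [rsq]. *)
Lemma Hsq_const : exists c, forall n, (0 < n)%N ->
  `|c - (Hsq n - 2 * Num.sqrt n%:R)| <= rsq n.
Proof.
pose s n := Hsq n.+1 - 2 * Num.sqrt n.+1%:R.
have [c Hc] : exists c, forall m, `|c - s m| <= rsq m.+1; last first.
  by exists c => -[|n] // _; apply: Hc.
apply: lim_exists => m n mn.
suff H : 0 <= s m - s n <= rsq m.+1 - rsq n.+1.
  case/andP: H => h1 h2; rewrite distrC ger0_norm //.
  by have := rsq_ge0 n.+1; lra.
elim: n mn => [|n IH]; first by rewrite leqn0 => /eqP->; rewrite !subrr lexx.
rewrite leq_eqVlt => /predU1P[->|]; first by rewrite !subrr lexx.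
rewrite ltnS => /IH /andP[h1 h2]; have /andP[h3 h4] := sqrt_step (ltn0Sn n).
have E : s n.+1 = s n + rsq n.+2 - 2 * (Num.sqrt n.+2%:R - Num.sqrt n.+1%:R).
  by rewrite /s /Hsq [in LHS]big_nat_recr //=; ring.
by rewrite E; apply/andP; split; lra.
Qed.

Lemma Hsq_le n : Hsq n <= 2 * Num.sqrt n%:R.
Proof.
elim: n => [|n IH]; first by rewrite /Hsq big_geq // sqrtr0 mulr0.
rewrite /Hsq big_nat_recr //= -/(Hsq n).
case: n IH => [|n] IH.
  by rewrite /Hsq big_geq // add0r /rsq sqrtr1 invr1; lra.
by have /andP[h3 h4] := sqrt_step (ltn0Sn n); lra.
Qed.

Lemma Hsq_ge0 n : 0 <= Hsq n.
Proof. by apply: sumr_ge0 => i _; apply: rsq_ge0. Qed.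

Lemma Hsq_mono m n : (m <= n)%N -> Hsq m <= Hsq n.
Proof.
move=> mn; rewrite /Hsq [leRHS](big_cat_nat (n := m.+1)) //= lerDl.
by apply: sumr_ge0 => i _; apply: rsq_ge0.
Qed.

Lemma harmonic_ge N : ln N.+1%:R <= \sum_(1 <= j < N.+1) j%:R^-1 :> R.
Proof.
elim: N => [|N IH]; first by rewrite ln1 big_geq.
rewrite big_nat_recr //=; have h := ln_succ_le R (ltn0Sn N).
by apply: le_trans (lerD IH h); rewrite addrC subrK.
Qed.

Variable B : R.
Hypothesis chi_sums : forall m n, `|\sum_(m <= i < n) chi i| <= B.
Hypothesis chi_L0 : forall m, `|hsum chi m| <= B / m.+1%:R.

Definition Tsum N := \sum_(1 <= k < (N * N).+1) dsum k * rsq k.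

(** The squares k = j * j alone give the harmonic sum, since [rsq (j * j)] = 1 / j and [dsum] is at
    least 1 there; all other terms are non-negative. *)
Lemma Tsum_ge N : \sum_(1 <= j < N.+1) j%:R^-1 <= Tsum N.
Proof.
elim: N => [|N IH]; first by rewrite /Tsum !big_geq.
rewrite big_nat_recr //= /Tsum.
rewrite [leRHS](big_cat_nat (n := (N * N).+1)) //=; last by rewrite ltnS leq_mul.
apply: lerD => //.
rewrite big_nat_recr /=; last by rewrite ltn_mul.
rewrite rsq_sqr -[leLHS]add0r; apply: lerD.
  rewrite big_nat; apply: sumr_ge0 => k /andP[k1 _].
  by rewrite mulr_ge0 ?rsq_ge0 //; apply: (dsum_ge _).1; apply: leq_ltn_trans k1.
rewrite ler_peMl ?invr_ge0 //; apply: (dsum_ge _).2 => // p.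
by rewrite lognM // addnn odd_double.
Qed.

(* Dirichlet's hyperbola method at x = N ^ 2: the main term has the factor L(1, chi),
   which is 0 by [chi_L0]. *)
Lemma Tsum_bounded : exists C, forall N, (0 < N)%N -> Tsum N <= C.
Proof.
have [c Hc] := Hsq_const.
have B0 : 0 <= B by apply: le_trans (chi_sums 0 0).
exists (B * 2 + (2 * B + `|c| * B + 4)) => N N0.
have N0' : 0 < N%:R :> R by rewrite ltr0n.
set x := (N * N)%N.
have Nx : (N < x.+1)%N by rewrite ltnS leq_pmulr.
have -> : Tsum N = \sum_(1 <= d < x.+1) chi d * (rsq d * Hsq (x %/ d)).
  transitivity (\sum_(1 <= k < x.+1) \sum_(1 <= d < k.+1 | (d %| k)%N)
     chi d * (rsq d * rsq (k %/ d))).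
    apply: eq_bigr => k _; rewrite mulr_suml; apply: eq_bigr => d dk.
    by rewrite -rsqM mulnC divnK.
  rewrite (sum_divisors (fun d m => chi d * (rsq d * rsq m))).
  by apply: eq_bigr => d _; rewrite -!mulr_sumr.
rewrite (big_cat_nat (n := N.+1)) //= addrC; apply: le_trans (ler_norm _) _.
apply: le_trans (ler_normD _ _) _; apply: lerD.
  (* Range d > N: partial summation against a factor decreasing in d, which at d = N is at most
     [rsq N * Hsq N] <= 2. *)
  have mono k : (N.+1 <= k)%N -> rsq k.+1 * Hsq (x %/ k.+1) <= rsq k * Hsq (x %/ k).
    move=> Nk; have k0 : (0 < k)%N by apply: leq_ltn_trans Nk.
    by rewrite ler_pM ?rsq_ge0 ?Hsq_ge0 ?rsq_le // Hsq_mono // leq_div2l.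
  apply: le_trans (abel_bound Nx (chi_sums N.+1) (g := fun k => rsq k * Hsq (x %/ k)) _ _) _.
  - by move=> k _; rewrite ger0_norm // mulr_ge0 ?rsq_ge0 ?Hsq_ge0.
  - by move=> k Nk; rewrite ger0_norm // subr_ge0 mono.
  rewrite ler_wpM2l //.
  apply: le_trans (_ : rsq N * Hsq N <= _).
    rewrite ler_pM ?rsq_ge0 ?Hsq_ge0 ?rsq_le // Hsq_mono //.
    by rewrite -[X in (_ <= X)%N](mulKn N N0) leq_div2l.
  by rewrite /rsq ler_pdivrMl ?sqrt_gt0 // mulrC Hsq_le.
(* Range d <= N: here 2 sqrt (x / d) = 2 N * [rsq d]. The three terms are the main term with the
   truncated L(1, chi), the constant of [Hsq_const] times bounded sums, and an error of at most 4 /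
   N for each d. *)
have E : \sum_(1 <= i < N.+1) chi i * (rsq i * Hsq (x %/ i)) =
  2 * N%:R * hsum chi N + c * \sum_(1 <= i < N.+1) chi i * rsq i +
  \sum_(1 <= i < N.+1) chi i * rsq i * (Hsq (x %/ i) - 2 * N%:R * rsq i - c).
  rewrite /hsum !mulr_sumr -!big_split; apply: eq_bigr => i _ /=.
  by rewrite -rsq2; ring.
rewrite E; apply: le_trans (ler_normD _ _) _; apply: lerD; [apply: le_trans (ler_normD _ _) _; apply: lerD|].
- rewrite normrM ger0_norm; last by rewrite mulr_ge0.
  rewrite -mulrA ler_wpM2l //; apply: le_trans (ler_wpM2l (ltW N0') (chi_L0 N)) _.
  by rewrite mulrCA ler_piMr // ler_pdivrMr ?ltr0n // mul1r ler_nat.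
- rewrite normrM ler_wpM2l //.
  apply: le_trans (abel_bound (ltn0Sn N) (chi_sums 1) (g := rsq) _ _) _ => //.
  + by move=> k _; rewrite ger0_norm // rsq_ge0.
  + by move=> k k0; rewrite ger0_norm // subr_ge0 rsq_le.
  + by rewrite /rsq sqrtr1 invr1 mulr1.
apply: le_trans (ler_norm_sum _ _ _) _.
apply: le_trans (_ : \sum_(1 <= i < N.+1) 4 / N%:R <= _); last first.
  by rewrite sumr_const_nat subn1 /= -[_ *+ N]mulr_natr divfK // gt_eqF.
rewrite !big_nat; apply: ler_sum => d /andP[d0 dN].
have d0' : 0 < d%:R :> R by rewrite ltr0n.
have chid : `|chi d| <= 1 by case: (chi_val d) => ->; rewrite ?normr0 ?normrN1 ?normr1.
set n := (x %/ d)%N.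
have n0 : (0 < n)%N by rewrite divn_gt0 //; move: Nx dN; rewrite !ltnS => h1 h2; apply: leq_trans h1.
have y_lo : n%:R <= (N%:R * rsq d) ^+ 2.
  rewrite exprMn expr2 [rsq d ^+ 2]expr2 rsq2 -natrM ler_pdivlMr // -natrM ler_nat.
  exact: leq_divM.
have y_hi : (N%:R * rsq d) ^+ 2 <= n%:R + 1.
  rewrite exprMn expr2 [rsq d ^+ 2]expr2 rsq2 -natrM ler_pdivrMr // natr1 -natrM ler_nat.
  by rewrite ltnW // ltn_ceil.
(* With t = sqrt (x / d) and a = sqrt n for n = [x / d], one has a <= t <= 2a and t - a <= 1 / t. So
   the error of [Hsq_const] and the rounding of x / d cost 2 / t each. *)
have hc := Hc n n0; set t := N%:R * rsq d in y_lo y_hi *.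
have t0 : 0 < t by rewrite mulr_gt0 ?rsq_gt0.
set a := Num.sqrt n%:R in hc; have a0 : 0 < a by apply: sqrt_gt0.
have aE : a ^+ 2 = n%:R by rewrite sqr_sqrtr.
have a1 : 1 <= n%:R :> R by rewrite ler1n.
have at' : a <= t by rewrite -(ler_pXn2r (n := 2)) // ?nnegrE ?(ltW t0) ?(ltW a0) // aE.
have ta : t <= 2 * a.
  have h : t ^+ 2 <= (2 * a) ^+ 2.
    rewrite [(2 * a) ^+ 2]exprMn aE; apply: le_trans y_hi _.
    by move: a1; move: (n%:R) => b *; lra.
  have a2 : 0 <= 2 * a by rewrite mulr_ge0 // ltW.
  by move: h; rewrite ler_pXn2r ?nnegrE ?(ltW t0).
have r1 : rsq n <= 2 / t.
  by rewrite /rsq -/a ler_pdivlMr // mulrC ler_pdivrMr.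
have r2 : 2 * t - 2 * a <= 2 / t.
  rewrite ler_pdivlMr //; have : (t - a) * (t + a) <= 1 by rewrite -subr_sqr aE; lra.
  have : 0 <= (t - a) * a by rewrite mulr_ge0 ?subr_ge0 // ltW.
  rewrite !mulrDr !mulrBl; move: (t * t) (a * t) (t * a) (a * a) => *; nra.
have key : `|Hsq n - 2 * N%:R * rsq d - c| <= 4 / t.
  rewrite -mulrA -/t.
  have -> : Hsq n - 2 * t - c = - (c - (Hsq n - 2 * a)) + (2 * a - 2 * t) by ring.
  apply: le_trans (ler_normD _ _) _; rewrite normrN.
  have -> : 4 / t = 2 / t + 2 / t by field; rewrite gt_eqF.
  apply: lerD; first exact: le_trans hc r1.
  by rewrite distrC ger0_norm // subr_ge0 ler_wpM2l.
rewrite !normrM -mulrA -[leRHS]mul1r; apply: ler_pM => //.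
  by rewrite mulr_ge0.
rewrite ger0_norm ?rsq_ge0 //; apply: le_trans (ler_wpM2l (rsq_ge0 _) key) _.
have rd : rsq d != 0 by rewrite gt_eqF // rsq_gt0.
by rewrite /t invfM le_eqVlt; apply/orP; left; apply/eqP; field; rewrite rd gt_eqF.
Qed.

Lemma real_char_contra : False.
Proof.
have [C HC] := Tsum_bounded.
have : 1 <= 0 :> R; last by rewrite ler10.
apply: (@ln_bounded_eq0 _ _ C) => -[|[|x]] // _.
  rewrite ln1 mul0r; apply: le_trans (HC 1%N isT); apply: le_trans (Tsum_ge 1).
  by rewrite big_nat1 invr1.
rewrite mulr1; apply: le_trans (HC x.+1 isT); apply: le_trans (Tsum_ge _).
exact: harmonic_ge.
Qed.

End RealCharacter.

(** * Injectivity of the operator [Lop] *)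

Section Dirichlet.
Variable R : realType.
Local Notation vM := (@vM R).
Variable q : nat.
Hypothesis q0 : (0 < q)%N.
Implicit Types (u v w f : nat -> R).
Local Notation periodic := (periodic q).
Local Notation inV := (inV q).
Local Notation heavy := (heavy R q).
Local Notation Lop := (Lop q).

Definition nunits : R := \sum_(0 <= i < q) (coprime i q)%:R.
Definition uavg f : R := (\sum_(0 <= i < q) (coprime i q)%:R * f i) / nunits.
Definition uproj f n : R := if coprime n q then f n - uavg f else 0.

Lemma nunits_gt0 : 0 < nunits.
Proof.
have lt : (1 %% q < q)%N by rewrite ltn_pmod.
rewrite /nunits big_mkord (bigD1 (Ordinal lt)) //= coprime_modl coprime1n.
by rewrite ltr_wpDr // sumr_ge0.
Qed.

Lemma uproj_inV f : periodic f -> inV (uproj f).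
Proof.
move=> pf; split.
- by move=> n; rewrite /uproj coprimeDq pf.
- by move=> n /negPf nq; rewrite /uproj nq.
transitivity (\sum_(0 <= i < q) ((coprime i q)%:R * f i - uavg f * (coprime i q)%:R)).
  by apply: eq_bigr => i _; rewrite /uproj; case: coprime; rewrite /= ?mul1r ?mulr1 ?mul0r ?mulr0 ?subr0.
by rewrite sumrB -mulr_sumr -/nunits divfK ?subrr // gt_eqF // nunits_gt0.
Qed.

(** In other words, the heavy classes generate the units mod q: after subtraction of the mean this
    is [heavy_fixed_eq0]. *)
Lemma heavy_fixed_const f : periodic f ->
  (forall g n, heavy g -> coprime n q -> f (g * n)%N = f n) ->
  forall n, coprime n q -> f n = f 1%N.
Proof.
move=> pf hf; have E n : coprime n q -> f n = uavg f.
  move=> nq; apply/eqP; rewrite -subr_eq0; apply/eqP.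
  have := heavy_fixed_eq0 q0 (uproj_inV pf) _ n; rewrite /uproj nq; apply=> g k hg.
  by rewrite coprimeMl hg.1 /=; case: ifP => // kq; rewrite hf.
by move=> n nq; rewrite !E ?coprime1n.
Qed.

(** By maximality of |u 1|, t n = sg (u 1) * (u n + u 1) is non-negative. Its von Mangoldt sum over
    the units is bounded, because ln x cancels between [sum_vM_ker_Lop] and [mertens_coprime]. So a
    class where t > 0 has bounded weight, and t vanishes on heavy classes. *)
Lemma heavy_flip1 u : inV u -> (forall n, Lop u n = 0) ->
  (forall z, `|u z| <= `|u 1%N|) -> forall g, heavy g -> u g = - u 1%N.
Proof.
move=> Vu L0 umax g hg; have [pu zu _] := Vu; apply: contrapT => ne; apply: hg.2.
have [C2 HC2] := sum_vM_ker_Lop q0 Vu L0; have [C3 HC3] := mertens_coprime R q0.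
pose s := Num.sg (u 1%N); pose t n := s * (u n + u 1%N).
have t0 n : 0 <= t n.
  rewrite /t mulrDr -normrEsg; have := umax n.
  have : `|s * u n| <= `|u n|.
    by rewrite normrM ler_piMl // /s normr_sg; case: (_ != _).
  by rewrite ler_norml => /andP[h _]; lra.
have tg : 0 < t g.
  rewrite lt_neqAle t0 andbT eq_sym mulf_neq0 ?sgr_eq0 //.
    apply/eqP => u1; apply: ne; have := umax g; rewrite u1 normr0 normr_le0 => /eqP->.
    by rewrite oppr0.
  by rewrite addr_eq0; apply/eqP.
exists ((C2 + C3 * `|u 1%N|) / t g) => x.
have [->|x0] := posnP x.
  rewrite /vM_class big_geq // divr_ge0 ?(ltW tg) // addr_ge0 //.
    by have := HC2 1%N isT; apply: le_trans.
  by rewrite mulr_ge0 //; have := HC3 1%N isT; apply: le_trans.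
rewrite ler_pdivlMr //.
apply: le_trans (_ : \sum_(1 <= n < x.+1 | coprime n q) vM n / n%:R * t n <= _).
  rewrite /vM_class mulr_suml big_mkcond [leRHS]big_mkcond; apply: ler_sum => n _ /=.
  case: ifPn => [/eqP ng|_].
    have nq : coprime n q by rewrite -coprime_modl ng coprime_modl hg.1.
    by rewrite nq /t (periodic_eqmod pu ng).
  by case: ifP => // _; rewrite mulr_ge0 ?vM_div_ge0.
have -> : \sum_(1 <= n < x.+1 | coprime n q) vM n / n%:R * t n =
  s * (\sum_(1 <= n < x.+1) vM n / n%:R * u n + ln x%:R * u 1%N) +
  s * ((\sum_(1 <= n < x.+1 | coprime n q) vM n / n%:R - ln x%:R) * u 1%N).
  have -> : \sum_(1 <= n < x.+1) vM n / n%:R * u n = \sum_(1 <= n < x.+1 | coprime n q) vM n / n%:R * u n.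
    rewrite [RHS]big_mkcond; apply: eq_bigr => n _; case: ifPn => // nq.
    by rewrite zu // mulr0.
  rewrite (eq_bigr (fun n => s * (vM n / n%:R * u n) + (vM n / n%:R) * (s * u 1%N))); last first.
    by move=> n _; rewrite /t; ring.
  by rewrite big_split /= -mulr_sumr -mulr_suml; ring.
have sle y : s * y <= `|y|.
  by apply: le_trans (ler_norm _) _; rewrite normrM ler_piMl // /s normr_sg; case: (_ != _).
apply: lerD; apply: le_trans (sle _) _; first exact: HC2.
by rewrite normrM ler_wpM2r // HC3.
Qed.

Lemma heavy_flip u y : inV u -> (forall n, Lop u n = 0) ->
  coprime y q -> (forall z, `|u z| <= `|u y|) ->
  forall g, heavy g -> u (y * g)%N = - u y.
Proof.
move=> Vu L0 yq ymax g hg; have := @heavy_flip1 (fun k => u (y * k)%N) (inV_shift q0 yq Vu).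
rewrite muln1; apply=> // n; by rewrite Lop_shift.
Qed.

(** A heavy class carries a maximum of |u| to a maximum and changes the sign of u. As heavy classes
    generate the units, |u| is constant there. Then k -> u (z k) * u k is invariant under heavy
    classes, hence constant, which makes u / u 1 multiplicative: a real character with vanishing
    L(1). *)
Lemma Lop_injective u : inV u -> (forall n, Lop u n = 0) -> forall n, u n = 0.
Proof.
move=> Vu L0; have [pu zu _] := Vu; apply: contrapT => une.
have [y ymax] : exists y, forall z, `|u z| <= `|u y|.
  have [i _ Hi] := @Order.TotalTheory.arg_maxP _ _ _ (Ordinal q0) xpredT (fun i : 'I_q => `|u i|) isT.
  exists i => z; rewrite -(periodic_mod z pu).
  exact: (Hi (Ordinal (ltn_pmod z q0)) isT).
have uy0 : u y != 0.
  apply/eqP => uy; apply: une => n; have := ymax n.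
  by rewrite uy normr0 normr_le0 => /eqP.
have yq : coprime y q by apply: contraNT uy0 => yq; rewrite zu.
have ext g n : heavy g -> coprime n q -> `|u n| = `|u y| -> u (g * n)%N = - u n.
  move=> hg nq un; rewrite mulnC; apply: heavy_flip => // z; rewrite un; exact: ymax.
have extI n : coprime n q -> `|u n| = `|u y|.
  pose f n : R := (`|u n| == `|u y|)%:R.
  have pf : periodic f by move=> k; rewrite /f pu.
  have hf g k : heavy g -> coprime k q -> f (g * k)%N = f k.
    move=> hg kq; rewrite /f; case: (eqVneq `|u k| `|u y|) => [uk|nuk].
      by rewrite ext // normrN uk eqxx.
    have gX j : coprime (g ^ j * k) q by rewrite coprimeMl coprimeXl ?hg.1.
    case: eqP => // gk; case/negP: nuk.
    (* The converse direction of invariance: if g * k is a maximum, so is every g ^ (j + 1) * k, and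
       Euler's theorem leads back to k. *)
    have H j : `|u (g ^ j.+1 * k)%N| = `|u y|.
      by elim: j => [//|j IH]; rewrite expnS -mulnA ext // normrN.
    have := H (totient q).-1; rewrite prednK ?totient_gt0 // => <-; apply/eqP; congr `|_|.
    apply: (periodic_eqmod pu).
    by rewrite -modnMml (Euler_exp_totient hg.1) modnMml mul1n.
  have fc := heavy_fixed_const pf hf; move=> nq.
  have : f n = f y by rewrite (fc n) // (fc y).
  rewrite /f eqxx; case: eqP => // _ /eqP; by rewrite eq_sym oner_eq0.
have flip g n : heavy g -> coprime n q -> u (g * n)%N = - u n by move=> hg nq; apply: ext => //; apply: extI.
have u1 : u 1%N != 0 by rewrite -normr_eq0 (extI 1%N) ?coprime1n // normr_eq0.
have u2 n : coprime n q -> u n * u n = u 1%N * u 1%N.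
  move=> nq; rewrite -!expr2 -[u n ^+ 2]real_normK ?num_real // -[RHS]real_normK ?num_real //.
  by rewrite !extI // coprime1n.
have um z n : coprime z q -> coprime n q -> u (z * n)%N * u 1%N = u z * u n.
  move=> zq nq.
  have pf : periodic (fun k => u (z * k)%N * u k).
    move=> k; rewrite pu; congr (_ * _); apply: periodic_eqmod => //.
    by rewrite mulnDr -modnDmr modnMl addn0.
  have hf g k : heavy g -> coprime k q -> u (z * (g * k))%N * u (g * k)%N = u (z * k)%N * u k.
    by move=> hg kq; rewrite mulnCA (flip g (z * k)%N) ?coprimeMl ?zq // (flip g k) // mulrNN.
  have := heavy_fixed_const pf hf nq; rewrite /= muln1 => h.
  apply: (mulIf u1); rewrite -mulrA -(u2 n) // mulrA h; ring.
pose chi n := u n / u 1%N.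
have [B HB] := inV_bounded q0 Vu; have [D HD] := LfP q0 Vu.
have L1 : Lf u = 0.
  have := L0 1%N; rewrite /Lop coprime1n => <-; congr Lf; apply: funext => k; by rewrite mul1n.
have hsumE m : hsum chi m = hsum u m / u 1%N.
  by rewrite /hsum mulr_suml; apply: eq_bigr => k _; rewrite /chi mulrAC.
apply: (@real_char_contra R chi _ _ _ (B / `|u 1%N| + D / `|u 1%N|)).
- by rewrite /chi divff.
- move=> m n; rewrite /chi; case: (boolP (coprime m q)) => mq; last first.
    by rewrite (zu m) // zu ?coprimeMl ?(negPf mq) // !mul0r.
  case: (boolP (coprime n q)) => nq; last first.
    by rewrite (zu n) // zu ?coprimeMl ?(negPf nq) ?andbF // mul0r mulr0.
  apply: (mulIf u1); apply: (mulIf u1); rewrite divfK // um //; by field.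
- move=> n; case: (boolP (coprime n q)) => nq; last by constructor 1; rewrite /chi zu // mul0r.
  have : chi n * chi n = 1.
    by rewrite /chi mulrACA u2 // -invfM divff // mulf_neq0.
  rewrite -expr2 => /eqP; rewrite sqrf_eq1 => /orP[] /eqP; by [constructor 2 | constructor 3].
- have D0 : 0 <= D by have := HD 1%N (coprime1n q) 0%N; rewrite divr1; apply: le_trans.
  move=> m n; rewrite -mulr_suml normrM normfV.
  apply: le_trans (_ : B / `|u 1%N| <= _); last by rewrite lerDl divr_ge0.
  rewrite ler_wpM2r ?invr_ge0 //; have := HB 1%N (coprime1n q) m n.
  by under eq_bigr do rewrite mul1n.
- have B0 : 0 <= B by apply: le_trans (HB 1%N (coprime1n q) 0%N 0%N).
  move=> m; rewrite hsumE normrM normfV.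
  apply: le_trans (_ : D / `|u 1%N| / m.+1%:R <= _); last first.
    by rewrite ler_wpM2r ?invr_ge0 // lerDr divr_ge0.
  rewrite mulrAC ler_wpM2r ?invr_ge0 //; have := HD 1%N (coprime1n q) m.
  under [X in Lf X]eq_fun do rewrite mul1n; under [X in hsum X]eq_fun do rewrite mul1n.
  by rewrite L1 sub0r normrN.
Qed.

End Dirichlet.

(** * Surjectivity by finite dimension, and primes in residue classes *)

Section DirichletTheorem.
Variable R : realType.
Local Notation vM := (@vM R).
Variable q : nat.
Hypothesis q0 : (0 < q)%N.
Implicit Types (u : nat -> R) (v : 'rV[R]_q).
Local Notation periodic := (periodic q).
Local Notation inV := (inV q).
Local Notation Lop := (Lop q).
Local Notation uavg := (uavg q).
Local Notation uproj := (uproj q).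

Lemma Lop_sum (I : finType) (c : I -> R) (u : I -> nat -> R) i :
  (forall j, inV (u j)) ->
  Lop (fun n => \sum_j c j * u j n) i = \sum_j c j * Lop (u j) i.
Proof.
move=> Vu; rewrite /Lop; case: ifP => iq; last by rewrite big1 // => j _; rewrite mulr0.
have H : forall j, rconv (hsum (fun k => u j (i * k)%N)) (Lf (fun k => u j (i * k)%N)).
  by move=> j; apply: (@rconv_Lf R q) => //; apply: inV_shift.
apply: Lf_eq; apply: rconv_ext (rconv_sum c H) => m.
rewrite /hsum; under eq_bigr do rewrite mulr_sumr.
rewrite exchange_big /=; apply: eq_bigr => k _.
by rewrite mulr_suml; apply: eq_bigr => j _; rewrite mulrA.
Qed.

(** Already each truncated sum vanishes: for a unit k the map i -> i k permutes the residues, so u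
    (i k) sums to 0 over i. *)
Lemma sum_Lop u : inV u -> \sum_(0 <= i < q) Lop u i = 0.
Proof.
move=> Vu; have [pu zu su] := Vu.
rewrite big_mkord.
pose c (i : 'I_q) : R := (coprime i q)%:R.
pose d (i : 'I_q) : nat := if coprime i q then val i else 1%N.
have dq i : coprime (d i) q by rewrite /d; case: ifP => // _; apply: coprime1n.
have -> : \sum_(i < q) Lop u i = \sum_(i < q) c i * Lf (fun k => u (d i * k)%N).
  by apply: eq_bigr => i _; rewrite /Lop /c /d; case: ifP; rewrite ?mul1r ?mul0r.
have H i : rconv (hsum (fun k => u (d i * k)%N)) (Lf (fun k => u (d i * k)%N)).
  by apply: (@rconv_Lf R q) => //; apply: inV_shift.
apply: rconv_unique (rconv_sum c H) _.
exists 0 => m; rewrite mul0r sub0r normrN normr_le0; apply/eqP.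
rewrite /hsum; under eq_bigr do rewrite mulr_sumr.
rewrite exchange_big big1 //= => k _.
under eq_bigr do rewrite mulrA.
rewrite -mulr_suml (_ : \sum_(i < q) _ = 0) ?mul0r //.
case: (boolP (coprime k q)) => kq; last first.
  by rewrite big1 // => i _; rewrite zu ?mulr0 // coprimeMl negb_and kq orbT.
rewrite -[RHS]su -(sum_residue_mul q0 pu kq) big_mkord; apply: eq_bigr => i _.
rewrite /c /d mulnC; case: ifPn => iq; first by rewrite mul1r.
by rewrite mul0r zu // coprimeMl negb_and iq orbT.
Qed.

Definition rvfun (v : 'rV[R]_q) n : R := v 0 (Ordinal (ltn_pmod n q0)).

Lemma rvfun_periodic v : periodic (rvfun v).
Proof. by move=> n; congr (v 0 _); apply: val_inj; rewrite /= modnDr. Qed.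

Lemma rvfun_ord v (i : 'I_q) : rvfun v i = v 0 i.
Proof. by congr (v 0 _); apply: val_inj; rewrite /= modn_small. Qed.

(** [Lop] on mean-zero functions on the units, extended by the identity on constants and on the
    non-unit coordinates, so that it is a square matrix and injectivity gives invertibility. *)
Definition Lop_ext (v : 'rV[R]_q) (i : 'I_q) : R :=
  if coprime i q then Lop (uproj (rvfun v)) i + uavg (rvfun v) else v 0 i.

Definition Lop_mx : 'M[R]_q := \matrix_(j, i) Lop_ext (delta_mx 0 j) i.

Lemma Lop_mxE v i : (v *m Lop_mx) 0 i = Lop_ext v i.
Proof.
rewrite mxE; under eq_bigr do rewrite mxE.
have rv n : rvfun v n = \sum_j v 0 j * rvfun (delta_mx 0 j) n.
  rewrite /rvfun {1}(row_sum_delta v) summxE; apply: eq_bigr => j _.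
  by rewrite !mxE.
have av : uavg (rvfun v) = \sum_j v 0 j * uavg (rvfun (delta_mx 0 j)).
  rewrite /uavg; under [in LHS]eq_bigr do rewrite rv mulr_sumr.
  rewrite exchange_big /= mulr_suml; apply: eq_bigr => j _; rewrite mulrA; congr (_ / _).
  by rewrite mulr_sumr; apply: eq_bigr => k _; rewrite mulrCA.
rewrite /Lop_ext; case: ifPn => iq; last first.
  by rewrite -[in RHS]rvfun_ord rv; apply: eq_bigr => j _; rewrite rvfun_ord.
rewrite av; under eq_bigr do rewrite mulrDr.
rewrite big_split /=; congr (_ + _); rewrite -Lop_sum; last first.
  by move=> j; apply: uproj_inV; [ | apply: rvfun_periodic].
congr Lop; apply: funext => n; rewrite /uproj; case: ifP => nq; last first.
  by rewrite big1 // => j _; rewrite mulr0.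
rewrite rv av -sumrB; apply: eq_bigr => j _; by rewrite mulrBr.
Qed.

Lemma sum_coprime_ord (F : nat -> R) :
  \sum_(0 <= i < q) (coprime i q)%:R * F i = \sum_(i < q | coprime i q) F i.
Proof.
rewrite big_mkord [RHS]big_mkcond; apply: eq_bigr => i _.
by case: coprime; rewrite ?mul1r ?mul0r.
Qed.

Lemma uavg_Lop_ext v : nunits R q * uavg (rvfun v) = \sum_(i < q | coprime i q) Lop_ext v i.
Proof.
rewrite /Lop_ext; under eq_bigr => i iq do rewrite iq.
rewrite big_split /= -(sum_coprime_ord (fun i => Lop (uproj (rvfun v)) i)).
rewrite -(sum_coprime_ord (fun=> uavg (rvfun v))) -mulr_suml -/(nunits R q).
rewrite [X in _ = X + _](_ : _ = 0) ?add0r //.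
have Vp := uproj_inV q0 (rvfun_periodic v).
rewrite -[RHS](sum_Lop Vp); apply: eq_bigr => i _.
by rewrite /Lop; case: coprime; rewrite ?mul1r ?mul0r.
Qed.

Lemma Lop_mx_unit : Lop_mx \in unitmx.
Proof.
rewrite -row_free_unit; apply: inj_row_free => v v0.
have ext0 i : Lop_ext v i = 0 by rewrite -Lop_mxE v0 mxE.
have a0 : uavg (rvfun v) = 0.
  have := uavg_Lop_ext v; rewrite big1 // => /eqP; rewrite mulf_eq0.
  by rewrite gt_eqF ?nunits_gt0 //= => /eqP.
have Vp := uproj_inV q0 (rvfun_periodic v).
have L0 n : Lop (uproj (rvfun v)) n = 0.
  rewrite -(periodic_mod n (Lop_periodic Vp)).
  have := ext0 (Ordinal (ltn_pmod n q0)); rewrite /Lop_ext a0 addr0 /=.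
  by case iq : (coprime (n %% q) q) => // _; rewrite /Lop iq.
have p0 := Lop_injective q0 Vp L0.
apply/rowP => i; rewrite mxE.
have := ext0 i; rewrite /Lop_ext; case: ifP => // iq _.
by have := p0 i; rewrite /uproj iq a0 subr0 rvfun_ord.
Qed.

(** Solve [Lop_ext v] = indicator of the class of a. The mean c of v on the units is the inverse of
    their number, and [Lop] of the projection is the indicator minus c on the units;
    [sum_vM_Lop_bounded] then compares the class with c times all units. *)
Lemma vM_class_asymptotic a : coprime a q -> exists c C, 0 < c /\
  forall x, (0 < x)%N -> `|vM_class R q a x - c * ln x%:R| <= C.
Proof.
move=> aq; pose v : 'rV[R]_q := delta_mx 0 (Ordinal (ltn_pmod a q0)) *m invmx Lop_mx.
have ext i : Lop_ext v i = (i == Ordinal (ltn_pmod a q0))%:R.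
  by rewrite -Lop_mxE mulmxKV ?Lop_mx_unit // mxE eqxx.
have nu := nunits_gt0 R q0.
have c0 : 0 < uavg (rvfun v).
  rewrite -(pmulr_rgt0 _ nu) uavg_Lop_ext (bigD1 (Ordinal (ltn_pmod a q0))) /=; last by rewrite coprime_modl.
  rewrite ext eqxx ltr_wpDr // sumr_ge0 // => i _; by rewrite ext.
have Vp := uproj_inV q0 (rvfun_periodic v).
have LE n : coprime n q -> Lop (uproj (rvfun v)) n = (n == a %[mod q])%:R - uavg (rvfun v).
  move=> nq; rewrite -(periodic_mod n (Lop_periodic Vp)).
  have := ext (Ordinal (ltn_pmod n q0)); rewrite /Lop_ext /= coprime_modl nq.
  move=> h; apply/eqP; rewrite eq_sym subr_eq; apply/eqP; rewrite h.
  by congr (nat_of_bool _)%:R; apply/eqP/eqP => [h1|/(congr1 val)//]; apply: val_inj.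
have [C1 HC1] := sum_vM_Lop_bounded q0 Vp; have [C3 HC3] := mertens_coprime R q0.
exists (uavg (rvfun v)), (C1 + uavg (rvfun v) * C3); split => // x x0.
have -> : vM_class R q a x - uavg (rvfun v) * ln x%:R =
  \sum_(1 <= n < x.+1) vM n / n%:R * Lop (uproj (rvfun v)) n +
  uavg (rvfun v) * (\sum_(1 <= n < x.+1 | coprime n q) vM n / n%:R - ln x%:R).
  rewrite mulrBr addrA; congr (_ - _).
  rewrite /vM_class big_mkcond [X in _ + _ * X]big_mkcond mulr_sumr -big_split; apply: eq_bigr => n _ /=.
  case: (boolP (coprime n q)) => nq.
    by rewrite LE //; case: ifP => _ /=; ring.
  rewrite /Lop (negPf nq) !mulr0 addr0; case: ifP => // /eqP na.
  by move: nq; rewrite -coprime_modl na coprime_modl aq.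
apply: le_trans (ler_normD _ _) _; apply: lerD; first exact: HC1.
by rewrite normrM gtr0_norm // ler_wpM2l ?(ltW c0) // HC3.
Qed.

End DirichletTheorem.

(** Without such a prime, the class sum consists of terms n <= N and proper prime powers, and stays
    bounded, against c * ln x with c > 0. *)
Theorem dirichlet a q N : (0 < q)%N -> coprime a q ->
  exists p, [/\ prime p, (N < p)%N & p = a %[mod q]].
Proof.
move=> q0 aq; pose R : realType := Rdefinitions.R.
have [c [C [c0 HC]]] := vM_class_asymptotic R q0 aq.
apply: contrapT => no.
have : c <= 0; last by rewrite leNgt c0.
apply: (@ln_bounded_eq0 R _ (C + (4 + \sum_(1 <= n < N.+1) @vM R n / n%:R))) => x x0.
have := HC x x0; rewrite ler_norml => /andP[h _].
have h2 : vM_class R q a x <= 4 + \sum_(1 <= n < N.+1) @vM R n / n%:R.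
  apply: le_trans (_ : \sum_(1 <= n < x.+1 | ~~ prime n) @vM R n / n%:R +
    \sum_(1 <= n < x.+1) (if (n <= N)%N then @vM R n / n%:R else 0) <= _).
    rewrite /vM_class big_mkcond [X in _ <= X + _]big_mkcond -big_split.
    apply: ler_sum => n _ /=; have v0 := vM_div_ge0 R n.
    case: ifP => [/eqP na|_]; last by rewrite addr_ge0 //; case: ifP.
    case: (boolP (prime n)) => pn /=; last by rewrite lerDl; case: ifP.
    rewrite ifT ?add0r // leqNgt; apply/negP => Nn; apply: no; by exists n.
  apply: lerD; first exact: sum_vM_nonprime.
  have [Nx|xN] := leqP N x.
    rewrite (big_cat_nat (n := N.+1)) //= [X in _ + X]big_nat_cond [X in _ + X]big1.
      rewrite addr0 !big_nat; apply: ler_sum => n /andP[_ nN].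
      by rewrite -ltnS nN.
    by move=> n /andP[/andP[nN _] _]; rewrite leqNgt nN.
  rewrite [leRHS](big_cat_nat (n := x.+1)) //= ?ltnS 1?ltnW // -[leLHS]addr0; apply: lerD.
    by apply: ler_sum => n _; case: ifP => // _; apply: vM_div_ge0.
  by apply: sumr_ge0 => n _; apply: vM_div_ge0.
by rewrite mulrC; move: (c * _) (vM_class _ _ _ _) (\sum_(_ <= _ < _) _) h h2 => *; lra.
Qed.

(** * Bounded generation of SL_2(Z) inside SL_3(Z) *)

Section ProductsOfK.
Variables (n : nat) (P : 'M[int]_n -> Prop).
Implicit Types (A B M g : 'M[int]_n).

Fixpoint mprod k M : Prop :=
  if k is k'.+1 then exists A B, [/\ P A, mprod k' B & M = A *m B] else M = 1%:M.

Lemma mprodM j k A B : mprod j A -> mprod k B -> mprod (j + k) (A *m B).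
Proof.
elim: j A => [|j IH] A /=; first by move=> -> HB; rewrite mul1mx.
move=> [A1 [A2 [PA1 HA2 ->]]] HB; exists A1, (A2 *m B); split=> //; first exact: IH.
by rewrite mulmxA.
Qed.

Lemma mprod1 A : P A -> mprod 1 A.
Proof. by move=> PA; exists A, 1%:M; rewrite mulmx1. Qed.

Lemma mprod_mono j k M : P 1%:M -> (j <= k)%N -> mprod j M -> mprod k M.
Proof.
move=> P1 jk HM; rewrite -(subnK jk) -[M]mul1mx; apply: mprodM => //.
elim: (k - j)%N => //= i IH; exists 1%:M, 1%:M; rewrite mulmx1; split=> //.
Qed.

Lemma mprod_conj k M g : (forall A, P A -> P (g *m A *m invmx g)) -> g \in unitmx ->
  mprod k M -> mprod k (g *m M *m invmx g).
Proof.
move=> HP gu; elim: k M => [|k IH] M /=; first by move=> ->; rewrite mulmx1 mulmxV.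
move=> [A [B [PA HB ->]]]; exists (g *m A *m invmx g), (g *m B *m invmx g); split; auto.
by rewrite !mulmxA mulmxKV.
Qed.

Lemma mprod_unit k M : (forall A, P A -> A \in unitmx) -> mprod k M -> M \in unitmx.
Proof.
move=> HP; elim: k M => [|k IH] M /=; first by move=> ->; rewrite unitmx1.
by move=> [A [B [PA HB ->]]]; rewrite unitmx_mul HP // IH.
Qed.

Lemma invmxM A B : A \in unitmx -> B \in unitmx -> invmx (A *m B) = invmx B *m invmx A.
Proof.
move=> Au Bu; have ABu : A *m B \in unitmx by rewrite unitmx_mul Au.
have E : (A *m B) *m (invmx B *m invmx A) = 1%:M by rewrite -mulmxA mulKVmx // mulmxV.
by rewrite -[RHS](mulKmx ABu) E mulmx1.
Qed.

Lemma mprod_inv k M : (forall A, P A -> A \in unitmx) -> (forall A, P A -> P (invmx A)) ->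
  mprod k M -> mprod k (invmx M).
Proof.
move=> HU HP; elim: k M => [|k IH] M; first by move=> /= ->; rewrite invmx1.
move=> [A [B [PA HB ->]]]; rewrite invmxM; [|exact: HU|exact: mprod_unit HU HB].
by rewrite -addn1; apply: mprodM; [exact: IH | apply/mprod1/HP].
Qed.

End ProductsOfK.

Section Elementary.
Variable n : nat.
Implicit Types (A g : 'M[int]_n).

Definition elmx (i j : 'I_n) (x : int) : 'M[int]_n := 1%:M + x *: delta_mx i j.

Lemma elmxM i j x y : i != j -> elmx i j x *m elmx i j y = elmx i j (x + y).
Proof.
move=> ij; rewrite /elmx mulmxDl mul1mx mulmxDr mulmx1 -scalemxAl -scalemxAr.
by rewrite mul_delta_mx_0 1?eq_sym // !scaler0 addr0 scalerDl -addrA [x *: _ + y *: _]addrC.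
Qed.

Lemma elmx0 i j : elmx i j 0 = 1%:M.
Proof. by rewrite /elmx scale0r addr0. Qed.

Lemma elmx_unit i j x : i != j -> elmx i j x \in unitmx.
Proof.
move=> ij; have := unitmx1 int n; rewrite -(elmx0 i j) -(subrr x) -elmxM //.
by rewrite unitmx_mul => /andP[].
Qed.

Lemma invmx_elmx i j x : i != j -> invmx (elmx i j x) = elmx i j (- x).
Proof.
move=> ij; have Eu := elmx_unit x ij.
by rewrite -[RHS](mulKmx Eu) elmxM // subrr elmx0 mulmx1.
Qed.

Definition elconj A := exists g i j x, [/\ g \in unitmx, i != j & A = g *m elmx i j x *m invmx g].

Lemma elconj_elmx i j x : i != j -> elconj (elmx i j x).
Proof.
by move=> ij; exists 1%:M, i, j, x; rewrite unitmx1 invmx1 mul1mx mulmx1; split.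
Qed.

Lemma elconj_unit A : elconj A -> A \in unitmx.
Proof. by move=> [g [i [j [x [gu ij ->]]]]]; rewrite !unitmx_mul unitmx_inv gu elmx_unit. Qed.

Lemma elconj_conj A g : g \in unitmx -> elconj A -> elconj (g *m A *m invmx g).
Proof.
move=> gu [h [i [j [x [hu ij ->]]]]]; exists (g *m h), i, j, x; split=> //.
  by rewrite unitmx_mul gu.
by rewrite invmxM // !mulmxA.
Qed.

Lemma elconj_inv A : elconj A -> elconj (invmx A).
Proof.
move=> [g [i [j [x [gu ij ->]]]]]; exists g, i, j, (- x); split=> //.
by rewrite !invmxM ?unitmx_mul ?gu ?elmx_unit ?unitmx_inv // invmxK invmx_elmx // mulmxA.
Qed.

End Elementary.

(** * Mennicke symbols and powers of SL_2 matrices inside SL_3(Z) *)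

Definition mx3 (s : seq int) : 'M[int]_3 := \matrix_(i, j) nth 0 s (i * 3 + j).

Lemma mx3M a b c d e f g h i a' b' c' d' e' f' g' h' i' :
  mx3 [:: a; b; c; d; e; f; g; h; i] *m mx3 [:: a'; b'; c'; d'; e'; f'; g'; h'; i'] =
  mx3 [:: a * a' + b * d' + c * g'; a * b' + b * e' + c * h'; a * c' + b * f' + c * i';
          d * a' + e * d' + f * g'; d * b' + e * e' + f * h'; d * c' + e * f' + f * i';
          g * a' + h * d' + i * g'; g * b' + h * e' + i * h'; g * c' + h * f' + i * i'].
Proof.
apply/matrixP => x y; rewrite !mxE !big_ord_recl big_ord0 !mxE addr0 addrA.
by case: x => [[|[|[|x]]] //= _]; case: y => [[|[|[|y]]] //= _].
Qed.

Lemma mx3_1 : 1%:M = mx3 [:: 1; 0; 0; 0; 1; 0; 0; 0; 1].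
Proof.
apply/matrixP => x y; rewrite !mxE -val_eqE /=.
by case: x y => [[|[|[|//]]] /= _] [[|[|[|//]]] /= _].
Qed.

Definition ord3_0 : 'I_3 := @Ordinal 3 0 isT.
Definition ord3_1 : 'I_3 := @Ordinal 3 1 isT.
Definition ord3_2 : 'I_3 := @Ordinal 3 2 isT.

Lemma mx3_el x : [/\ elmx ord3_0 ord3_1 x = mx3 [:: 1; x; 0; 0; 1; 0; 0; 0; 1],
  elmx ord3_1 ord3_0 x = mx3 [:: 1; 0; 0; x; 1; 0; 0; 0; 1],
  elmx ord3_0 ord3_2 x = mx3 [:: 1; 0; x; 0; 1; 0; 0; 0; 1] &
  elmx ord3_2 ord3_1 x = mx3 [:: 1; 0; 0; 0; 1; 0; 0; x; 1]].
Proof.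
by split; apply/matrixP => i j; rewrite !mxE -!val_eqE /=;
  case: i j => [[|[|[|//]]] /= _] [[|[|[|//]]] /= _]; rewrite ?mulr1 ?mulr0 ?addr0 ?add0r.
Qed.

Definition emb a b c d : 'M[int]_3 := mx3 [:: a; b; 0; c; d; 0; 0; 0; 1].

Local Notation el := (mprod (@elconj 3)).

Lemma elconj1 : @elconj 3 1%:M.
Proof. by rewrite -(elmx0 ord3_0 ord3_1); apply: elconj_elmx. Qed.

Lemma el_mono j k M : (j <= k)%N -> el j M -> el k M.
Proof. apply: mprod_mono; exact: elconj1. Qed.

Lemma el_conj k M g h : g *m h = 1%:M -> el k M -> el k (g *m M *m h).
Proof.
move=> gh; have [gu _] := mulmx1_unit gh.
have -> : h = invmx g by rewrite -[h](mulKmx gu) gh mulmx1.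
by apply: mprod_conj => // A; apply: elconj_conj.
Qed.

Lemma el_inv k M N : M *m N = 1%:M -> el k M -> el k N.
Proof.
move=> MN; have [Mu _] := mulmx1_unit MN.
have -> : N = invmx M by rewrite -[N](mulKmx Mu) MN mulmx1.
by apply: mprod_inv => A; [exact: elconj_unit | exact: elconj_inv].
Qed.

Lemma el_elmx i j x : i != j -> el 1 (elmx i j x).
Proof. by move=> ij; apply/mprod1/elconj_elmx. Qed.

Lemma embM a b c d a' b' c' d' : emb a b c d *m emb a' b' c' d' =
  emb (a * a' + b * c') (a * b' + b * d') (c * a' + d * c') (c * b' + d * d').
Proof. by rewrite mx3M; congr mx3; do ![congr cons]; ring. Qed.

Lemma emb1 : emb 1 0 0 1 = 1%:M.
Proof. by rewrite mx3_1. Qed.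

Lemma emb_inv a b c d : a * d - b * c = 1 -> emb a b c d *m emb d (- b) (- c) a = 1%:M.
Proof. by move=> h; rewrite embM -emb1; congr emb; lia. Qed.

Lemma emb_up x : emb 1 x 0 1 = elmx ord3_0 ord3_1 x. Proof. by case: (mx3_el x). Qed.
Lemma emb_lo x : emb 1 0 x 1 = elmx ord3_1 ord3_0 x. Proof. by case: (mx3_el x). Qed.

(** In SL_2 the inverse, conjugated by [[0, 1], [-1, 0]], is the transpose. *)
Lemma el_tr k a b c d : a * d - b * c = 1 -> el k (emb a b c d) -> el k (emb a c b d).
Proof.
move=> h /(el_inv (emb_inv h)) H.
have gh : emb 0 1 (-1) 0 *m emb 0 (-1) 1 0 = 1%:M by rewrite embM -emb1; congr emb; ring.
have := el_conj gh H; rewrite !embM.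
by congr el; congr emb; ring.
Qed.

(** A quantitative Mennicke symbol. All completions of the row are bounded at once, because
    [row_bounded_mul] passes to the completions (b2 * c, d) and (b1 * c, d). *)
Definition row_bounded k a b := forall c d, a * d - b * c = 1 -> el k (emb a b c d).

Lemma row_bounded_mono j k a b : (j <= k)%N -> row_bounded j a b -> row_bounded k a b.
Proof. by move=> jk H c d h; apply: el_mono jk _; apply: H. Qed.

Lemma row_bounded_addl k a b t : row_bounded k a b -> row_bounded k.+1 (a + t * b) b.
Proof.
move=> H c d h.
have -> : emb (a + t * b) b c d = emb a b (c - t * d) d *m emb 1 0 t 1.
  by rewrite embM; congr emb; ring.
rewrite -[k.+1]addn1; apply: mprodM; first by apply: H; rewrite -h; ring.
by rewrite emb_lo; apply: el_elmx.
Qed.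

Lemma lin_rel (k x y u v : int) : u = v -> x - y = k * (u - v) -> x = y.
Proof. by move=> ->; rewrite subrr mulr0 => /eqP; rewrite subr_eq0 => /eqP. Qed.

(* Mennicke's factorization: with A_1 = [[a, b1], [b2 c, d]] in the coordinates
   1, 3 and A_2 = [[a, b2], [b1 c, d]], the matrix emb a (b1 b2) c d is
   E_13(-b1) (A_2^T)^-1 E_21(c) A_1 E_32(b2). *)
Lemma row_bounded_mul j k a b1 b2 : row_bounded j a b1 -> row_bounded k a b2 -> row_bounded (j + k + 3) a (b1 * b2).
Proof.
move=> H1 H2 c d h.
have h1 : a * d - b1 * (b2 * c) = 1 by rewrite -h; ring.
have h2 : a * d - b2 * (b1 * c) = 1 by rewrite -h; ring.
have HA1 := H1 _ _ h1; have HA2 := el_inv (emb_inv h2) (H2 _ _ h2).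
have HA1' : el j (mx3 [:: a; 0; b1; 0; 1; 0; b2 * c; 0; d]).
  have gh : mx3 [:: 1; 0; 0; 0; 0; 1; 0; 1; 0] *m mx3 [:: 1; 0; 0; 0; 0; 1; 0; 1; 0] = 1%:M.
    by rewrite mx3M mx3_1.
  have := el_conj gh HA1; rewrite !mx3M.
  by congr el; congr mx3; do ![congr cons]; ring.
have HA2' : el k (mx3 [:: 1; 0; 0; 0; d; - (b1 * c); 0; - b2; a]).
  have h3 : d * a - - b2 * - (b1 * c) = 1 by rewrite -h; ring.
  have HA3 := el_tr h3 HA2.
  have gh : mx3 [:: 0; 0; 1; 1; 0; 0; 0; 1; 0] *m mx3 [:: 0; 1; 0; 0; 0; 1; 1; 0; 0] = 1%:M.
    by rewrite mx3M mx3_1.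
  have := el_conj gh HA3; rewrite !mx3M.
  by congr el; congr mx3; do ![congr cons]; ring.
have -> : emb a (b1 * b2) c d = elmx ord3_0 ord3_2 (- b1) *m mx3 [:: 1; 0; 0; 0; d; - (b1 * c); 0; - b2; a]
   *m elmx ord3_1 ord3_0 c *m mx3 [:: a; 0; b1; 0; 1; 0; b2 * c; 0; d] *m elmx ord3_2 ord3_1 b2.
  have [_ _ -> _] := mx3_el (- b1); have [_ -> _ _] := mx3_el c; have [_ _ _ ->] := mx3_el b2.
  rewrite !mx3M; congr mx3; do ![congr cons]; try ring.
  - by apply: (lin_rel (k := b1 * b2) h); ring.
  - by apply: (lin_rel (k := b1) h); ring.
  - by apply: (lin_rel (k := - c) h); ring.
  - by apply: (lin_rel (k := - b2) h); ring.
  - by apply: (lin_rel (k := - 1) h); ring.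
have -> : (j + k + 3 = 1 + k + 1 + j + 1)%N by lia.
apply: mprodM; last exact: el_elmx.
apply: mprodM => //; apply: mprodM; last exact: el_elmx.
by apply: mprodM => //; apply: el_elmx.
Qed.

Lemma row_bounded_1 b : row_bounded 2 1 b.
Proof.
move=> c d h; have -> : emb 1 b c d = emb 1 0 c 1 *m emb 1 b 0 1.
  by rewrite embM; congr emb; try ring; apply: (lin_rel (k := 1) h); ring.
by rewrite emb_lo emb_up; apply: (@mprodM _ _ 1 1); apply: el_elmx.
Qed.

Lemma row_bounded_N1 b : row_bounded 8 (-1) b.
Proof.
move=> c d h; have -> : emb (-1) b c d = emb (-1) 0 0 (-1) *m emb 1 (- b) (- c) (- d).
  by rewrite embM; congr emb; ring.
apply: (@mprodM _ _ 6 2); last by apply: row_bounded_1; apply: (lin_rel (k := 1) h); ring.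
(* Minus the identity is the square of [[0, 1], [-1, 0]], itself a product of three elementary
   matrices. *)
have -> : emb (-1) 0 0 (-1) = emb 1 1 0 1 *m (emb 1 0 (-1) 1 *m (emb 1 1 0 1 *m
   (emb 1 1 0 1 *m (emb 1 0 (-1) 1 *m emb 1 1 0 1)))).
  by rewrite !embM; congr emb; ring.
rewrite emb_up emb_lo.
do 5![apply: (@mprodM _ _ 1); first exact: el_elmx]; exact: el_elmx.
Qed.

Lemma row_bounded_cong x y : (y %| x - 1)%Z || (y %| x + 1)%Z -> row_bounded 9 x y.
Proof.
case/orP => /dvdzP[t tE].
  have -> : x = 1 + t * y by rewrite -tE; ring.
  by apply: (@row_bounded_mono 3) => //; apply/row_bounded_addl/row_bounded_1.
have -> : x = -1 + t * y by rewrite -tE; ring.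
exact/row_bounded_addl/row_bounded_N1.
Qed.

Lemma dvdz_split_sqr (x y : int) : (y %| x ^+ 2 - 1)%Z ->
  exists y1 y2, [/\ y = y1 * y2, (y1 %| x - 1)%Z & (y2 %| x + 1)%Z].
Proof.
have -> : x ^+ 2 - 1 = (x - 1) * (x + 1) by ring.
move=> /dvdzP[w wE]; have [u [v uv]] := Bezoutz (x - 1) y.
set g := gcdz _ _ in uv.
have /dvdzP[p pE] : (g %| x - 1)%Z by apply: dvdz_gcdl.
have /dvdzP[t tE] : (g %| y)%Z by apply: dvdz_gcdr.
have [g0|g0] := eqVneq g 0.
  by exists y, 1; rewrite mulr1 dvd1z pE g0 mulr0 dvdz0.
have uv1 : u * p + v * t = 1 by apply: (mulIf g0); rewrite mul1r -[RHS]uv pE tE; ring.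
have wE' : p * (x + 1) = w * t.
  by apply: (mulIf g0); rewrite mulrAC -pE wE tE; ring.
exists g, t; split; first by rewrite tE mulrC.
  by rewrite pE dvdz_mull.
apply/dvdzP; exists (u * w + v * (x + 1)).
have -> : (u * w + v * (x + 1)) * t = u * (w * t) + v * t * (x + 1) by ring.
by rewrite -wE' -[LHS]mul1r -uv1; ring.
Qed.

Lemma row_bounded_sqr x y : (y %| x ^+ 2 - 1)%Z -> row_bounded 21 x y.
Proof.
move=> /dvdz_split_sqr[y1 [y2 [-> h1 h2]]].
by apply: (@row_bounded_mul 9 9); apply: row_bounded_cong; rewrite ?h1 ?h2 ?orbT.
Qed.

(** Cayley-Hamilton writes the power as x + y A. The quadratic relation is its determinant 1, and
    the divisibility holds because A is lower triangular mod b with corner a. *)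
Lemma emb_pow a b c d M : a * d - b * c = 1 -> exists x y,
  [/\ iter M (mulmx (emb a b c d)) 1%:M = emb (x + y * a) (y * b) (y * c) (x + y * d),
      x ^+ 2 + x * y * (a + d) + y ^+ 2 = 1 & (b %| x + y * a - a ^+ M)%Z].
Proof.
move=> h; elim: M => [|M [x [y [E1 E2 /dvdzP[t E3]]]]].
  exists 1, 0; rewrite /= -emb1 !mul0r !addr0 expr0 subrr dvdz0; split=> //.
exists (- y), (x + y * (a + d)); split.
- rewrite iterS E1 embM; congr emb; [|ring|ring|].
  + by apply: (lin_rel (k := - y) h); ring.
  + by apply: (lin_rel (k := - y) h); ring.
- by rewrite -[RHS]E2; ring.
apply/dvdzP; exists (a * t + y * c).
have -> : (a * t + y * c) * b = a * (t * b) + y * (b * c) by ring.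
have -> : b * c = a * d - 1 by rewrite -h; ring.
by rewrite -E3 exprS; ring.
Qed.

(* With A^M = x I + y A one has x^2 = 1 mod y, which bounds the row (x, y), while
   x + y a = a^M mod b bounds the row (x + y a, b); the first row of A^M is
   (x + y a, y b). *)
Lemma el_pow a b c d M : a * d - b * c = 1 -> (b %| a ^+ M - 1)%Z || (b %| a ^+ M + 1)%Z ->
  el 34 (iter M (mulmx (emb a b c d)) 1%:M).
Proof.
move=> h ab; have [x [y [-> E2 E3]]] := emb_pow M h.
(* 34 = 22 + 9 + 3: [row_bounded_sqr] with one shift, [row_bounded_cong], and the three elementary
   factors of Mennicke's relation. *)
apply: (@row_bounded_mul 22 9).
- have -> : x + y * a = x + a * y by ring.
  apply/row_bounded_addl/row_bounded_sqr/dvdzP; exists (- (x * (a + d) + y)).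
  by apply: (lin_rel (k := 1) E2); ring.
- apply: row_bounded_cong; case/orP: ab => ab; apply/orP; [left|right].
    by have := rpredD E3 ab; rewrite addrA subrK.
  by have := rpredD E3 ab; rewrite addrA subrK.
by rewrite -[RHS]E2; apply: (lin_rel (k := y ^+ 2) h); ring.
Qed.

Lemma iter_mulmx_tr a b c d M :
  (iter M (mulmx (emb a b c d)) 1%:M)^T = iter M (mulmx (emb a c b d)) 1%:M.
Proof.
have comm A j : iter j (mulmx A) 1%:M *m A = A *m iter j (mulmx A) 1%:M :> 'M[int]_3.
  by elim: j => [|j IH]; rewrite /= ?mulmx1 ?mul1mx // -mulmxA IH.
elim: M => [|M IH]; first by rewrite /= trmx1.
rewrite [in LHS]iterS trmx_mul IH iterS -comm; congr (_ *m _).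
by apply/matrixP => i j; rewrite !mxE; case: i j => [[|[|[|//]]] ?] [[|[|[|//]]] ?].
Qed.

Lemma emb_tr a b c d : (emb a b c d)^T = emb a c b d.
Proof.
by apply/matrixP => i j; rewrite !mxE; case: i j => [[|[|[|//]]] ?] [[|[|[|//]]] ?].
Qed.

Lemma el_pow_tr a b c d M : a * d - b * c = 1 -> (c %| a ^+ M - 1)%Z || (c %| a ^+ M + 1)%Z ->
  el 34 (iter M (mulmx (emb a b c d)) 1%:M).
Proof.
move=> h ac; have [x [y [E1 E2 _]]] := emb_pow M h.
have h' : a * d - c * b = 1 by rewrite -h; ring.
have := el_pow h' ac; rewrite -iter_mulmx_tr E1 emb_tr; apply: el_tr.
by rewrite -[RHS]E2; apply: (lin_rel (k := y ^+ 2) h); ring.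
Qed.

(** Euler's criterion without identifying the sign. The half exponent matters: p - 1 and r - 1 are
    both even for odd primes, whereas their halves can be coprime. *)
Lemma half_fermat (a : int) (p h u : nat) : prime p -> p = h.*2.+1 -> ~~ (p %| `|a|)%N ->
  (p%:Z %| a ^+ (h * u) - 1)%Z || (p%:Z %| a ^+ (h * u) + 1)%Z.
Proof.
move=> pp pE pa; have ap : coprime `|a| p by rewrite coprime_sym prime_coprime.
have F : (p%:Z %| a ^+ h - 1)%Z || (p%:Z %| a ^+ h + 1)%Z.
  rewrite !dvdzE -Euclid_dvdM // -abszM -subr_sqr expr1n -exprM -(dvdzE p).
  have -> : a ^+ (h * 2) = (`|a| ^ (h * 2))%N%:Z.
    by rewrite -abszX gez0_abs // exprM sqr_ge0.
  rewrite -eqz_mod_dvd (_ : 1 = 1%N%:Z) // !modz_nat muln2.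
  have pm : p.-1 = h.*2 by rewrite pE.
  by have := Euler_exp_totient ap; rewrite totient_prime // pm => ->.
rewrite exprM; case/orP: F => F; apply/orP.
  by left; rewrite subrX1 dvdz_mulr.
have : (p%:Z %| (a ^+ h) ^+ u - (-1) ^+ u)%Z by rewrite subrXX opprK dvdz_mulr.
by rewrite -signr_odd; case: (odd u); rewrite ?expr1 ?opprK ?expr0; [right|left].
Qed.

(** With u h - v h' = 1, A is the quotient of A ^ (u h) and A ^ (v h'). The first is bounded since a
    ^ h = 1 or -1 mod the upper entry p, the second since the same holds for h' and the lower entry
    r. *)
Lemma el_two_primes (a d : int) (p r h h' : nat) : prime p -> prime r ->
  p = h.*2.+1 -> r = h'.*2.+1 -> coprime h h' ->
  ~~ (p %| `|a|)%N -> ~~ (r %| `|a|)%N -> a * d - p%:Z * r%:Z = 1 -> el 68 (emb a p r d).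
Proof.
move=> pp pr pE rE cop pa ra det.
have h0 : (0 < h)%N by rewrite lt0n; apply: contraTneq pp => h0; rewrite pE h0.
have /coprimeP := cop; move/(_ h0) => [[u v] /= uv].
set A := emb a p r d.
have HX : el 34 (iter (u * h) (mulmx A) 1%:M).
  by apply: el_pow => //; rewrite mulnC; apply: half_fermat.
have HY : el 34 (iter (v * h') (mulmx A) 1%:M).
  by apply: el_pow_tr => //; rewrite mulnC; apply: half_fermat.
have -> : A = iter (u * h) (mulmx A) 1%:M *m invmx (iter (v * h') (mulmx A) 1%:M).
  have -> : (u * h = (v * h').+1)%N by lia.
  rewrite iterS mulmxK //; exact: mprod_unit (@elconj_unit 3) HY.
apply: (@mprodM _ _ 34 34) => //; apply: mprod_inv HY; [exact: elconj_unit|exact: elconj_inv].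
Qed.

(* Two applications of Dirichlet's theorem make both off-diagonal entries
   prime, with (p - 1)/2 and (r - 1)/2 coprime. *)
Lemma el_nonzero a b c d : a != 0 -> a * d - b * c = 1 -> el 70 (emb a b c d).
Proof.
move=> a0 det; have A0 : (0 < `|a|)%N by rewrite absz_gt0.
have nat_res (x : int) (q : nat) : (0 < q)%N -> coprimez x q -> forall N : nat,
    exists r : nat, [/\ prime r, (N < r)%N & (q%:Z %| r%:Z - x)%Z].
  move=> q0 xq N.
  have E : `|(x %% q)%Z|%N%:Z = (x %% q)%Z by rewrite gez0_abs // modz_ge0 // -lt0n.
  have cop : coprime `|(x %% q)%Z| q.
    by move: xq; rewrite /coprimez -gcdz_modl -E.
  have [r [pr Nr rE]] := dirichlet N q0 cop; exists r; split=> //.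
  by rewrite -eqz_mod_dvd -[(x %% q)%Z]modz_mod -E !modz_nat rE.
have ab : coprimez b a.
  by apply/coprimezP; exists (- c, d); rewrite /= -det; ring.
have absE (x y : int) : (`|a|%:Z %| x - y)%Z -> exists t, x = y + t * a.
  rewrite dvdzE absz_nat -dvdzE => /dvdzP[t tE]; exists t; rewrite -tE; ring.
have [p [pp pA /absE[t tE]]] := nat_res b `|a|%N A0 ab (maxn `|a| 2).
have -> : emb a b c d = emb a p c (d + t * c) *m emb 1 (- t) 0 1.
  by rewrite embM tE; congr emb; ring.
apply: (@mprodM _ _ 69 1); last by rewrite emb_up; apply: el_elmx.
set d1 := d + t * c; have det1 : a * d1 - p%:Z * c = 1 by rewrite tE /d1 -det; ring.
have [p2 pa] : (2 < p)%N /\ (`|a| < p)%N by apply/andP; rewrite andbC -gtn_max.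
set h := p./2; have pE : p = h.*2.+1.
  have := odd_double_half p; rewrite -/h; case/even_prime: pp => [pE|->] //.
  by rewrite pE in p2.
have h0 : (0 < h)%N by lia.
have pza : p%:Z = 2 * h%:Z + 1 by rewrite {1}pE; lia.
(* The goal is c0 with c0 = c mod a and c0 = -1 mod p - 1 = 2h. The two congruences are compatible:
   gcd(a, 2h) divides c + 1 = a d1 - 2h c. *)
have [u [v uv]] := Bezoutz a (2 * h%:Z).
have [w wE] : exists w, c + 1 = w * gcdz a (2 * h%:Z).
  apply/dvdzP; have -> : c + 1 = a * d1 - 2 * h%:Z * c.
    by rewrite pza in det1; apply: (lin_rel (k := - 1) det1); ring.
  by apply: rpredB; rewrite dvdz_mulr // ?dvdz_gcdl ?dvdz_gcdr.
set c0 := c - w * u * a.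
have c0E : c0 = w * v * (2 * h%:Z) - 1.
  by rewrite /c0; apply: (addIr 1); rewrite subrK addrAC wE -uv; ring.
have qE : (`|a| * h.*2)%N%:Z = `|a|%:Z * (2 * h%:Z) by lia.
have cq : coprimez c0 (`|a| * h.*2)%N%:Z.
  rewrite qE coprimezMr; apply/andP; split.
    have : coprimez c0 a.
      by apply/coprimezP; exists (- p%:Z, d1 - p%:Z * w * u); rewrite /= -det1 /c0; ring.
    by rewrite !coprimezE.
  by apply/coprimezP; exists (-1, w * v); rewrite /= c0E; ring.
have q0 : (0 < `|a| * h.*2)%N by rewrite muln_gt0 A0 double_gt0.
have [r [pr ra rE]] := nat_res c0 _ q0 cq `|a|%N.
have [s sE] : exists s, r%:Z = c + s * a.
  have /absE[s sE] : (`|a|%:Z %| r%:Z - c0)%Z by apply: dvdz_trans rE; rewrite qE dvdz_mulr.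
  by exists (s - w * u); rewrite sE /c0; ring.
have [k kE] : exists k : int, r%:Z = k * (2 * h%:Z) - 1.
  have /dvdzP[k kE] : (2 * h%:Z %| r%:Z - c0)%Z by apply: dvdz_trans rE; rewrite qE dvdz_mull.
  by exists (k + w * v); rewrite mulrDl -kE c0E; ring.
have -> : emb a p c d1 = emb 1 0 (- s) 1 *m emb a p r (d1 + s * p%:Z).
  by rewrite embM sE; congr emb; ring.
apply: (@mprodM _ _ 1 68); first by rewrite emb_lo; apply: el_elmx.
have k0 : 0 < k.
  rewrite ltNge; apply/negP => k0; have : k * (2 * h%:Z) <= 0 by rewrite mulr_le0_ge0.
  lia.
have kh : (`|k| * h)%N%:Z = k * h%:Z by rewrite PoszM gtz0_abs.
have kh0 : (0 < `|k| * h)%N by rewrite muln_gt0 absz_gt0 gt_eqF.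
(* From r = 2 k h - 1 one gets (r - 1) / 2 = k h - 1, which is coprime to h. *)
set h' := (`|k| * h).-1; have h'E : h'%:Z = k * h%:Z - 1 by rewrite -kh /h'; lia.
apply: (@el_two_primes _ _ p r h h') => //.
- by apply/eqP; rewrite -eqz_nat kE; apply/eqP; lia.
- rewrite -[coprime h h']/(coprimez h%:Z h'%:Z); apply/coprimezP; exists (k, -1).
  by rewrite /= h'E; ring.
- by apply/negP => /dvdn_leq; rewrite A0 => /(_ isT); lia.
- by apply/negP => /dvdn_leq; rewrite A0 => /(_ isT); lia.
- by rewrite sE -det1; ring.
Qed.

Theorem sl2_bounded_generation a b c d : a * d - b * c = 1 -> el 71 (emb a b c d).
Proof.
move=> det; have [a0|a0] := eqVneq a 0; last first.
  by apply: el_mono (el_nonzero a0 det).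
have b0 : b != 0.
  by apply/eqP => b0; move: det; rewrite a0 b0 !mul0r subrr.
have -> : emb a b c d = emb (a + b) b (c + d) d *m emb 1 0 (-1) 1.
  by rewrite embM; congr emb; ring.
apply: (@mprodM _ _ 70 1); last by rewrite emb_lo; apply: el_elmx.
by apply: el_nonzero; [rewrite a0 add0r | rewrite -det; ring].
Qed.

(** * Word values in SL_n(Z) *)

Section WordValueMatrices.
Variables (d : nat) (w : free_group d).

Definition wval n (M : 'M[int]_n) := exists2 A : SL n int, word_value w A & M = slmx A.

Local Notation wprod n := (mprod (@wval n)).

Lemma slmx_mul n (A B : SL n int) : slmx (A * B)%g = slmx A *m slmx B. Proof. by []. Qed.

Lemma wval_unit n (M : 'M_n) : wval M -> M \in unitmx.
Proof. by move=> [A _ ->]; apply: SL_unit. Qed.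

Lemma wval_inv n (M : 'M_n) : wval M -> wval (invmx M).
Proof.
move=> [A [g gE] ->]; exists (A^-1)%g => //; exists g.
by case: gE => ->; [right | left; rewrite invgK].
Qed.

Lemma wval1 n : wval (1%:M : 'M_n).
Proof.
exists 1%g => //; exists (fun=> 1%g); left; rewrite /word_eval big1 // => -[i []] _.
  by rewrite /letter_eval /= invg1.
by [].
Qed.

Lemma wval_morph m n (f : SL m int -> SL n int) (A : SL m int) :
  {morph f : x y / (x * y)%g} -> word_value w A -> wval (slmx (f A)).
Proof.
move=> fM [g gE]; exists (f A) => //; exists (fun i => f (g i)).
have f1 : f 1%g = 1%g by apply: (mulgI (f 1%g)); rewrite -fM !mulg1.
have fV x : f (x^-1)%g = ((f x)^-1)%g by apply: (mulgI (f x)); rewrite -fM !mulgV.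
by rewrite -(word_eval_morph w g fM); case: gE => ->; [left | right; rewrite fV].
Qed.

Lemma wval_conj n (g M : 'M_n) : g \in unitmx -> wval M -> wval (g *m M *m invmx g).
Proof.
move=> gu [A Aw ->].
have detc (B : SL n int) : \det (g *m slmx B *m invmx g) == 1.
  rewrite !det_mulmx (eqP (slmx_det B)) mulr1 -det_mulmx mulmxV // det1 //.
pose f B := MkSL (detc B).
have fM : {morph f : x y / (x * y)%g}.
  by move=> x y; apply: val_inj; rewrite /= !mulmxA mulmxKV.
exact: (wval_morph fM Aw).
Qed.

Lemma wval_block m n (M : 'M_m) : wval M -> wval (block_mx M 0 0 (1%:M : 'M_n)).
Proof.
move=> [A Aw ->].
have detc (B : SL m int) : \det (block_mx (slmx B) 0 0 (1%:M : 'M[int]_n)) == 1.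
  by rewrite det_ublock (eqP (slmx_det B)) det1 mulr1.
pose f B := MkSL (detc B).
have fM : {morph f : x y / (x * y)%g}.
  move=> x y; apply: val_inj; rewrite /= mulmx_block !mulmx0 !mul0mx !addr0 !add0r.
  by rewrite mulmx1.
exact: (wval_morph fM Aw).
Qed.

Lemma wval_perm n (rho : 'I_d -> {perm 'I_n}) : (forall k, odd_perm (rho k) = false) ->
  wval (perm_mx (word_eval w rho)).
Proof.
move=> ev; have detc k : \det (perm_mx (rho k) : 'M[int]_n) == 1 by rewrite det_perm ev.
pose g k := MkSL (detc k); exists (word_eval w g); first by exists g; left.
rewrite /word_eval; apply: (big_rec2 (fun (p : {perm 'I_n}) (A : SL n int) => perm_mx p = slmx A)).
  exact: perm_mx1.
move=> [i b] p A _ pA; rewrite slmx_mul perm_mxM pA; congr (_ *m _).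
rewrite /letter_eval /=; case: b => //=.
have pV : perm_mx (rho i) *m perm_mx (rho i)^-1%g = 1%:M :> 'M[int]_n.
  by rewrite -perm_mxM mulgV perm_mx1.
have [pu _] := mulmx1_unit pV.
by rewrite -[LHS](mulKmx pu) pV mulmx1.
Qed.

Lemma wprod_mono n j k (M : 'M_n) : (j <= k)%N -> wprod n j M -> wprod n k M.
Proof. by apply: mprod_mono; apply: wval1. Qed.

Lemma wprod_conj n k (g M : 'M_n) : g \in unitmx -> wprod n k M -> wprod n k (g *m M *m invmx g).
Proof. by move=> gu; apply: mprod_conj => // A; apply: wval_conj. Qed.

Lemma wprod_conjV n k (g M : 'M_n) : g \in unitmx -> wprod n k (g *m M *m invmx g) -> wprod n k M.
Proof.
move=> gu H; have gVu : invmx g \in unitmx by rewrite unitmx_inv.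
have := wprod_conj gVu H; rewrite invmxK.
by rewrite -[_ *m M *m _]mulmxA mulKmx // mulmxKV.
Qed.

Lemma wprod_comm n (g t : 'M_n) : g \in unitmx -> wval t ->
  wprod n 2 (g *m t *m invmx g *m invmx t).
Proof.
move=> gu tw; apply: (@mprodM _ _ 1 1); apply: mprod1; [exact: wval_conj | exact: wval_inv].
Qed.

(** * Block unipotent matrices from a single permutation value *)

Section Span.
Variables (e a : nat) (p : {perm 'I_a}).
Hypothesis e0 : (0 < e)%N.
Hypothesis ea : (e * e <= a)%N.
Local Notation a0 := (a %/ e * e)%N.
Hypothesis pP : forall i : 'I_a, (i < a0)%N ->
  [/\ p i != i, p (p i) != i & (p i %/ e = i %/ e)%N].
Hypothesis T_wval : wval (perm_mx p).

Local Notation T := (perm_mx p : 'M[int]_a).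
Local Notation ev j := (delta_mx j (0 : 'I_1) : 'cV[int]_a).

Lemma perm_mx_delta i : T *m ev (p i) = ev i.
Proof.
apply/colP => k; rewrite -colE !mxE !eqxx andbT.
by rewrite (inj_eq perm_inj).
Qed.

Implicit Types (y z i j : 'I_a).

Definition orbmin (y : 'I_a) := (y < a0)%N && [forall z in porbit p y, (y <= z)%N].

Lemma orbmin_uniq y z : orbmin y -> orbmin z -> z \in porbit p y -> z = y.
Proof.
move=> /andP[_ /forall_inP Hy] /andP[_ /forall_inP Hz] zy.
have yz : y \in porbit p z by rewrite porbit_sym.
by apply: val_inj; apply/eqP; rewrite eqn_leq Hy // Hz.
Qed.

Lemma p_lt y : (y < a0)%N -> (p y < a0)%N.
Proof. by move=> ya; have [_ _ h] := pP ya; rewrite -ltn_divLR // h ltn_divLR. Qed.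

Lemma porbit_block z y : (y < a0)%N -> z \in porbit p y -> (z %/ e = y %/ e)%N.
Proof.
move=> ya /porbitP[k ->]; elim: k => [|k IH]; first by rewrite expg0 perm1.
rewrite expgSr permM; have ka : ((p ^+ k)%g y < a0)%N by rewrite -ltn_divLR // IH ltn_divLR.
by have [_ _ ->] := pP ka.
Qed.

(* The matrix g = 1 + N, N e_j = e_(phi j), is chosen so that the images of 1 - T and
   of 1 - g T g^-1 span everything.  An orbit minimum y satisfies
   g (e_(p (p y)) - e_y) = e_(p (p y)) - e_y - e_(p y), so e_y is reached modulo the
   image of 1 - T; each of the < e leftover vectors f is reached through the
   successor of the first element of its own block. *)
Definition phi (j : 'I_a) : option 'I_a :=
  if orbmin j then Some (p j)
  else if (j < a0)%N && ((p^-1)%g j == j %/ e * e :> nat)%N then insub (a0 + j %/ e)%N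
  else None.

Definition Nmx : 'M[int]_a := \matrix_(i, j) (phi j == Some i)%:R.

Lemma Nmx_delta j : Nmx *m ev j = if phi j is Some i then ev i else 0.
Proof.
apply/colP => k; rewrite -colE !mxE; case: (phi j) => [i|]; last by rewrite mxE.
by rewrite !mxE eqxx andbT eq_sym.
Qed.

Lemma orbmin_p y : orbmin y -> ~~ orbmin (p y).
Proof.
move=> Cy; apply/negP => Cpy; have /andP[ya _] := Cy; have [+ _ _] := pP ya.
by rewrite (orbmin_uniq Cy Cpy) ?eqxx // -{1}[p]expg1 mem_porbit.
Qed.

Lemma orbmin_pp y : orbmin y -> ~~ orbmin (p (p y)).
Proof.
move=> Cy; apply/negP => Cpy; have /andP[ya _] := Cy; have [_ + _] := pP ya.
by rewrite (orbmin_uniq Cy Cpy) ?eqxx // -permM (_ : p * p = p ^+ 2)%g // mem_porbit.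
Qed.

Lemma orbmin_block y : (y < a0)%N -> y = (y %/ e * e)%N :> nat -> orbmin y.
Proof.
move=> ya yE; rewrite /orbmin ya; apply/forall_inP => z /(porbit_block ya) zy.
by rewrite yE -zy leq_divM.
Qed.

Lemma phi_ge j : (a0 <= j)%N -> phi j = None.
Proof. by move=> ja; rewrite /phi /orbmin ltnNge ja. Qed.

Lemma phi_nmin j i : ~~ orbmin j -> phi j = Some i -> (a0 <= i)%N.
Proof.
rewrite /phi => /negPf->; case: ifP => // _; case: insubP => // u _ uE [<-].
by rewrite uE leq_addr.
Qed.

Lemma phi_orbmin y : orbmin y -> phi y = Some (p y).
Proof. by rewrite /phi => ->. Qed.

Lemma phi_pp y : orbmin y -> phi (p (p y)) = None.
Proof.
move=> Cy; rewrite /phi (negPf (orbmin_pp Cy)) permK; case: ifP => // /andP[ppa /eqP ppE].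
have /andP[ya _] := Cy.
have [_ _ pE] := pP (p_lt ya).
by case/negP: (orbmin_p Cy); apply: orbmin_block; [exact: p_lt | rewrite -pE].
Qed.

(** [phi] sends an orbit minimum to a non-minimum, a non-minimum to a leftover index at most, and
    leftover indices nowhere. Nilpotency makes 1 + N invertible. *)
Lemma Nmx3 : Nmx *m (Nmx *m Nmx) = 0.
Proof.
suff H j : Nmx *m (Nmx *m (Nmx *m ev j)) = 0.
  apply/matrixP => i j; have E := H j; rewrite !mulmxA -colE in E.
  by rewrite mulmxA [RHS]mxE; have := congr1 (fun v : 'cV_a => v i 0) E; rewrite mxE => ->; rewrite mxE.
rewrite Nmx_delta; case ji : (phi j) => [i|]; last by rewrite !mulmx0.
rewrite Nmx_delta; case ik : (phi i) => [k|]; last by rewrite mulmx0.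
rewrite Nmx_delta phi_ge //.
have [Ci|nCi] := boolP (orbmin i); last exact: phi_nmin nCi ik.
have [Cj|nCj] := boolP (orbmin j).
  by move: ji Ci; rewrite phi_orbmin // => -[<-]; rewrite (negPf (orbmin_p Cj)).
have := phi_nmin nCj ji; have /andP[ia _] := Ci; by rewrite leqNgt ia.
Qed.

Definition gmx : 'M[int]_a := 1%:M + Nmx.

Lemma gmx_unit : gmx \in unitmx.
Proof.
have E : gmx *m (1%:M - Nmx + Nmx *m Nmx) = 1%:M.
  rewrite /gmx mulmxDl mul1mx mulmxDr mulmxBr mulmx1 Nmx3 addr0.
  by rewrite -addrA [Nmx *m Nmx + _]addrCA subrr addr0 subrK.
by case: (mulmx1_unit E).
Qed.

Definition in_span b (V : 'M[int]_(a, b)) := exists X1 X2 : 'M[int]_(a, b),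
  V = (X1 - T *m X1) + (X2 - gmx *m T *m invmx gmx *m X2).

Lemma in_span0 b : in_span (0 : 'M_(a, b)).
Proof. by exists 0, 0; rewrite !mulmx0 !subr0 addr0. Qed.

Lemma in_spanD b (U V : 'M_(a, b)) : in_span U -> in_span V -> in_span (U + V).
Proof.
move=> [X1 [X2 ->]] [Y1 [Y2 ->]]; exists (X1 + Y1), (X2 + Y2).
rewrite [LHS]addrACA !mulmxDr !opprD; congr (_ + _); exact: addrACA.
Qed.

Lemma in_spanN b (V : 'M_(a, b)) : in_span V -> in_span (- V).
Proof. by move=> [X1 [X2 ->]]; exists (- X1), (- X2); rewrite !mulmxN -!opprD. Qed.

Lemma in_spanM b c (V : 'M_(a, b)) (r : 'M_(b, c)) : in_span V -> in_span (V *m r).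
Proof.
move=> [X1 [X2 ->]]; exists (X1 *m r), (X2 *m r).
by rewrite mulmxDl !mulmxBl !mulmxA.
Qed.

Lemma in_spanT b (X : 'M_(a, b)) : in_span (X - T *m X).
Proof. by exists X, 0; rewrite mulmx0 subr0 addr0. Qed.

Lemma in_span_g b (X : 'M_(a, b)) : in_span (gmx *m (X - T *m X)).
Proof.
exists 0, (gmx *m X); rewrite mulmx0 subrr add0r mulmxBr !mulmxA; congr (_ - _).
by rewrite mulmxKV ?gmx_unit.
Qed.

Lemma gmx_delta j : gmx *m ev j = ev j + if phi j is Some i then ev i else 0.
Proof. by rewrite mulmxDl mul1mx Nmx_delta. Qed.

Lemma diff1 j : in_span (ev (p j) - ev j).
Proof. by rewrite -(perm_mx_delta j); apply: in_spanT. Qed.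

Lemma diff_g1 j : in_span (gmx *m ev (p (p j)) - gmx *m ev (p j)).
Proof. by rewrite -mulmxBr -(perm_mx_delta (p j)); apply: in_span_g. Qed.

Lemma diff_g2 j : in_span (gmx *m ev (p (p j)) - gmx *m ev j).
Proof.
have h : in_span (gmx *m ev (p j) - gmx *m ev j).
  by rewrite -mulmxBr -(perm_mx_delta j); apply: in_span_g.
by have := in_spanD (diff_g1 j) h; rewrite addrA subrK.
Qed.

Lemma span_orbmin y : orbmin y -> in_span (ev y).
Proof.
move=> Cy; have := in_spanN (diff_g2 y); rewrite !gmx_delta phi_pp // phi_orbmin // addr0 opprB.
move=> /in_spanD /(_ (diff1 (p y))); congr in_span.
by rewrite addrA subrK addrK.
Qed.

Lemma span_lt y : (y < a0)%N -> in_span (ev y).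
Proof.
move=> ya; have [z zP zmin] := @arg_minnP _ y [pred z | z \in porbit p y] (fun z => nat_of_ord z) (porbit_id p y).
have zy : porbit p y = porbit p z by apply/eqP; rewrite eq_sym eq_porbit_mem.
have Cz : orbmin z.
  rewrite /orbmin -ltn_divLR // (porbit_block ya zP) ltn_divLR // ya.
  by apply/forall_inP => x; rewrite -zy; apply: zmin.
have /porbitP[k ->] : y \in porbit p z by rewrite -zy porbit_id.
elim: k => [|k IH]; first by rewrite expg0 perm1; apply: span_orbmin.
by rewrite expgSr permM; have := in_spanD (diff1 ((p ^+ k)%g z)) IH; rewrite subrK.
Qed.

Lemma span_ge (f : 'I_a) : (a0 <= f)%N -> in_span (ev f).
Proof.
move=> af; set k := (f - a0)%N.
have ke : (k < e)%N.
  by rewrite /k ltn_subLR // (leq_trans (ltn_ord f)) // {1}(divn_eq a e) leq_add2l ltnW // ltn_pmod.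
(* Here e * e <= a is used: there are at least [e] blocks, so each leftover vector has a block of
   its own. *)
have kea : (k * e < a0)%N.
  rewrite ltn_mul2r e0 /=; apply: leq_trans ke _; by rewrite leq_divRL.
have lta : (k * e < a)%N by apply: leq_trans kea (leq_divM _ _).
pose y : 'I_a := Ordinal lta.
have Cy : orbmin y by apply: orbmin_block; rewrite //= mulnK.
have [_ _ py] := pP (kea : (y < a0)%N).
have phif : phi (p y) = Some f.
  rewrite /phi (negPf (orbmin_p Cy)) p_lt //= permK py mulnK // eqxx.
  have fE : (a0 + k = f)%N by rewrite subnKC.
  by rewrite fE; case: insubP => [u _ uf|]; [congr Some; apply: val_inj | rewrite ltn_ord].
have := diff_g1 y; rewrite !gmx_delta phi_pp // phif addr0 => /in_spanN; rewrite opprB.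
move=> /in_spanD /(_ (diff1 (p y))); rewrite addrA subrK addrAC subrr add0r //.
Qed.

Lemma span_all b (V : 'M[int]_(a, b)) : in_span V.
Proof.
have -> : V = \sum_j ev j *m row j V.
  by apply/matrixP => i k; rewrite summxE (bigD1 i) //= big1 ?addr0 => [|j ji];
    rewrite mxE big_ord_recl big_ord0 addr0 !mxE ?eqxx ?mul1r // eq_sym (negPf ji) mul0r.
apply: big_ind => [||j _]; [exact: in_span0 | exact: in_spanD | apply: in_spanM].
by have [|] := ltnP j a0; [exact: span_lt | exact: span_ge].
Qed.

Lemma wprod_block_unip b (V : 'M[int]_(a, b)) : wprod (a + b) 4 (block_mx 1%:M V 0 1%:M).
Proof.
have [X1 [X2 ->]] := span_all V.
pose U (X : 'M[int]_(a, b)) : 'M[int]_(a + b) := block_mx 1%:M X 0 1%:M.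
have UM X Y : U X *m U Y = U (X + Y).
  by rewrite /U mulmx_block !mulmx0 !mul0mx !mul1mx !mulmx1 !addr0 !add0r addrC.
have U1 : U 0 = 1%:M by rewrite /U -scalar_mx_block.
have UV X : U X *m U (- X) = 1%:M by rewrite UM subrr.
have Uu X : U X \in unitmx by case: (mulmx1_unit (UV X)).
have Uinv X : invmx (U X) = U (- X) by rewrite -[RHS](mulKmx (Uu X)) UV mulmx1.
have H (t : 'M[int]_a) X : wval t -> wprod (a + b) 2 (U (X - t *m X)).
  move=> tw; have := wprod_comm (Uu X) (wval_block b tw).
  have tu := wval_unit tw; rewrite Uinv.
  have -> : invmx (block_mx t 0 0 (1%:M : 'M[int]_b)) = block_mx (invmx t) 0 0 1%:M.
    have E : block_mx t 0 0 (1%:M : 'M[int]_b) *m block_mx (invmx t) 0 0 1%:M = 1%:M.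
      by rewrite mulmx_block !mulmx0 !mul0mx !addr0 !add0r mulmxV // mulmx1 -scalar_mx_block.
    have [Eu _] := mulmx1_unit E.
    by rewrite -[RHS](mulKmx Eu) E mulmx1.
  rewrite /U !mulmx_block !mulmx0 !mul0mx !addr0 !add0r !mul1mx !mulmx1 mulmxV //.
  by rewrite !mul0mx add0r mulmxN addrC.
rewrite -/(U _) -UM; apply: (@mprodM _ _ 2 2); first exact: H.
by apply: H; apply: wval_conj => //; apply: gmx_unit.
Qed.

End Span.

End WordValueMatrices.

Lemma perm_mx_unit n (s : {perm 'I_n}) : (perm_mx s : 'M[int]_n) \in unitmx.
Proof.
have E : perm_mx s *m perm_mx s^-1%g = 1%:M :> 'M[int]_n by rewrite -perm_mxM mulgV perm_mx1.
by case: (mulmx1_unit E).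
Qed.

Lemma invmx_perm n (s : {perm 'I_n}) : invmx (perm_mx s) = perm_mx s^-1%g :> 'M[int]_n.
Proof.
have E : perm_mx s *m perm_mx s^-1%g = 1%:M :> 'M[int]_n by rewrite -perm_mxM mulgV perm_mx1.
by rewrite -[RHS](mulKmx (perm_mx_unit s)) E mulmx1.
Qed.

Lemma perm_conjE n (s : {perm 'I_n}) (M : 'M[int]_n) i j :
  (perm_mx s *m M *m invmx (perm_mx s)) i j = M (s i) (s j).
Proof. by rewrite invmx_perm -col_permE -row_permE !mxE. Qed.

Section Supported.
Variables (d : nat) (w : free_group d).
Local Notation wprod n := (mprod (@wval d w n)).

(** The matrices [[1, V], [0, 1]] up to a permutation of coordinates: V has its rows in [P] and its
    columns outside. *)
Definition supported n (P : pred 'I_n) (M : 'M[int]_n) :=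
  forall i j, M i j != (i == j)%:R -> P i && ~~ P j.

Lemma sorting_perm a b (P : pred 'I_(a + b)) : #|P| = a ->
  exists s : {perm 'I_(a + b)}, forall i, P (s i) = (i < a)%N.
Proof.
move=> Pa; have sz : size (enum P ++ enum (predC P)) = (a + b)%N.
  by rewrite size_cat -!cardE cardC card_ord.
have ut : uniq (enum P ++ enum (predC P)).
  by rewrite cat_uniq !enum_uniq andbT /=; apply/hasPn => x; rewrite !mem_enum.
have ss : size (enum 'I_(a + b)) = size (enum P ++ enum (predC P)).
  by rewrite sz -cardE card_ord.
have [s sE] := perm_extend (enum_uniq 'I_(a + b)) ut ss.
exists s => i; have si : s i = nth (s i) (enum P ++ enum (predC P)) i.
  by rewrite -sE (nth_map i) ?nth_ord_enum // -cardE card_ord.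
rewrite si nth_cat -cardE Pa; case: ltnP => ia.
  have := mem_nth (s i) (s := enum P) (n := i); rewrite -cardE Pa => /(_ ia).
  by rewrite mem_enum.
have ib : (i - a < size (enum (predC P)))%N.
  by move: sz; rewrite size_cat -cardE Pa => /addnI ->; rewrite ltn_subLR.
by have := mem_nth (s i) ib; rewrite mem_enum => /negbTE.
Qed.

(** Sorting the indices of [P] to the front gives block form. The threshold is the e * e of the span
    argument; there is no condition on the number of columns. *)
Lemma supported_wprod_ex : w <> 1%g -> exists aw, forall n (P : pred 'I_n) (M : 'M[int]_n),
  (aw <= #|P|)%N -> supported P M -> wprod n 4 M.
Proof.
move=> w1; have [e e0 He] := word_value_perm w1; exists (e * e)%N => n P M.
set a := #|P| => ea; have Pa : #|P| = a by []; move: Pa; clearbody a.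
have nE := cardC P; rewrite card_ord in nE; move: nE; set b := #|predC P|; clearbody b.
move=> + Pa; rewrite Pa => nE; subst n => MP.
have [s sP] := sorting_perm Pa.
have [rho [ev pP]] := He a.
apply: (wprod_conjV (perm_mx_unit s)).
set M' := _ *m invmx _.
have M'E i j : M' i j = M (s i) (s j) by rewrite perm_conjE.
clearbody M'.
have -> : M' = block_mx 1%:M (ursubmx M') 0 1%:M.
  rewrite -[LHS]submxK; congr block_mx; apply/matrixP => i j; rewrite !mxE M'E; apply/eqP.
  - have := MP (s (lshift b i)) (s (lshift b j)); rewrite !sP /= !ltn_ord (inj_eq perm_inj).
    by rewrite (inj_eq (@lshift_inj _ _)) => H; apply: contraT => /H.
  - have := MP (s (rshift a i)) (s (lshift b j)); rewrite !sP /= ltn_ord andbF (inj_eq perm_inj).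
    by rewrite eq_rlshift /= => H; apply: contraT => /H.
  - have := MP (s (rshift a i)) (s (rshift a j)); rewrite !sP /= (inj_eq perm_inj).
    rewrite (inj_eq (@rshift_inj _ _)) ltnNge leq_addr /= => H; apply: contraT => /H //.
exact: (wprod_block_unip e0 ea pP (wval_perm w ev)).
Qed.

End Supported.

(** * Unitriangular matrices *)

Section Unitriangular.
Implicit Types n : nat.

Definition utri n (M : 'M[int]_n) :=
  forall i j : 'I_n, (M i i = 1) /\ ((j < i)%N -> M i j = 0).

Definition Jmx n : 'M[int]_n := \matrix_(i, j) ((j == i :> nat) || (j == i.+1 :> nat))%:R.

Definition super1 n (M : 'M[int]_n) := forall i j : 'I_n, j = i.+1 :> nat -> M i j = 1.

Lemma utri1 n : utri (1%:M : 'M_n).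
Proof. by move=> i j; rewrite !mxE eqxx; split=> // ji; rewrite -val_eqE gtn_eqF. Qed.

Lemma utriM n (A B : 'M[int]_n) : utri A -> utri B -> utri (A *m B).
Proof.
move=> HA HB i j; rewrite !mxE; split.
  rewrite (bigD1 i) //= (HA i i).1 (HB i i).1 mul1r big1 ?addr0 // => k ki.
  have [ik|] := ltnP i k; first by rewrite ((HB k i).2 ik) mulr0.
  by rewrite leq_eqVlt val_eqE (negPf ki) /= => ki'; rewrite ((HA i k).2 ki') mul0r.
move=> ji; rewrite big1 // => k _; have [jk|kj] := ltnP j k; first by rewrite ((HB k j).2 jk) mulr0.
by rewrite ((HA i k).2 (leq_ltn_trans kj ji)) mul0r.
Qed.

(** No index lies strictly between i and i + 1, so the superdiagonal is additive under
    multiplication and can be corrected entry by entry. *)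
Lemma superM n (A B : 'M[int]_n) (i j : 'I_n) : utri A -> utri B -> j = i.+1 :> nat ->
  (A *m B) i j = A i j + B i j.
Proof.
move=> HA HB jE; have ij : j != i by rewrite -val_eqE /= jE gtn_eqF.
rewrite mxE (bigD1 i) //= (HA i i).1 mul1r (bigD1 j) //= (HB j j).1 mulr1 big1 ?addr0 1?addrC //.
move=> k /andP[ki kj]; have [ik|ik] := ltnP k i; first by rewrite ((HA i k).2 ik) mul0r.
rewrite ((HB k j).2 _) ?mulr0 // jE ltn_neqAle; move: ki kj ik; rewrite -!val_eqE /= jE; lia.
Qed.

Lemma utri_block n (r : 'M[int]_(1, n)) (M : 'M_n) : utri M -> utri (block_mx 1%:M r 0 M).
Proof.
move=> HM; change (forall i j : 'I_(1 + n), block_mx (1%:M : 'M_1) r 0 M i i = 1 /\ ((j < i)%N -> block_mx (1%:M : 'M_1) r 0 M i j = 0)) => i j.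
case: (splitP i) => i' iE.
  have -> : i = lshift n i' by apply: val_inj.
  rewrite block_mxEul mxE eqxx; split=> //=; by rewrite ord1.
have -> : i = rshift 1 i' by apply: val_inj.
rewrite block_mxEdr (HM i' i').1; split=> //.
case: (splitP j) => j' jE.
  have -> : j = lshift n j' by apply: val_inj.
  by rewrite block_mxEdl mxE.
have -> : j = rshift 1 j' by apply: val_inj.
by rewrite block_mxEdr /= ltn_add2l => /(HM i' j').2.
Qed.

Lemma utri_dr n (u : 'M[int]_(1 + n)) : utri u ->
  u = block_mx 1%:M (ursubmx u) 0 (drsubmx u) /\ utri (drsubmx u).
Proof.
move=> Hu; split; last first.
  move=> i j; rewrite !mxE (Hu (rshift 1 i) (rshift 1 i)).1; split=> // ji.
  by apply: (Hu _ _).2; rewrite /= ltn_add2l.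
rewrite -{1}[u]submxK; congr block_mx; apply/matrixP => i j; rewrite !mxE.
  by rewrite !ord1 eqxx (Hu _ (lshift n 0)).1.
by apply: (Hu _ _).2; rewrite /= ord1.
Qed.

(* By induction on the last n - 1 coordinates; the first row is corrected by solving
   s + v (J - 1) = e_0 for v, which is possible as J - 1 shifts the coordinates. *)
Lemma utri_conj_J n (u : 'M[int]_n) : utri u -> super1 u ->
  exists g h : 'M_n, [/\ utri g, g *m h = 1%:M & u = g *m Jmx n *m h].
Proof.
elim: n u => [|n IH] u Hu su.
  by exists 1%:M, 1%:M; split; [exact: utri1 | rewrite mulmx1 | apply/matrixP => -[]].
have [uE Hu'] := @utri_dr n u Hu.
have su' : super1 (drsubmx (u : 'M_(1 + n))).
  by move=> i j ji; rewrite !mxE; apply: su; rewrite /= ji.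
have [g [h [Hg gh u'E]]] := IH _ Hu' su'.
have gu := (mulmx1_unit gh).1; have hg := mulmx1C gh.
set r := @ursubmx int 1 n 1 n u in uE.
have [s sE] : exists s : 'M[int]_(1, n), s = r *m g by exists (r *m g).
(* Since v (J - 1) is v shifted by one place, v_j = - s_(j+1) cancels every entry of s but the
   first, which is 1 by [super1]. The last entry of v is shifted out and set to 0. *)
pose v : 'M[int]_(1, n) := \row_j (if insub j.+1 is Some k then - s 0 k else 0).
pose e0 : 'M[int]_(1, n) := \row_j (j == 0 :> nat)%:R.
have JE : Jmx (1 + n) = block_mx 1%:M e0 0 (Jmx n).
  rewrite -[LHS]submxK; congr block_mx; apply/matrixP => i j; rewrite !mxE ?ord1 //=.
have vE : s + v *m (Jmx n - 1%:M) = e0.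
  apply/rowP => j; rewrite !mxE.
  have -> : \sum_k v 0 k * (Jmx n - 1%:M) k j = if j == 0 :> nat then 0 else - s 0 j.
    rewrite (eq_bigr (fun k : 'I_n => if j == k.+1 :> nat then v 0 k else 0)); last first.
      move=> k _; rewrite !mxE -!val_eqE /=.
      have [jk|jk] := eqVneq (val j) k.+1; first by rewrite jk gtn_eqF // eq_sym gtn_eqF // subr0 mulr1.
      by rewrite orbF eq_sym subrr mulr0.
    rewrite -big_mkcond /=; case: eqP => [j0|/eqP j0].
      by rewrite big1 // => k; rewrite j0.
    have lt : (j.-1 < n)%N by rewrite (leq_ltn_trans (leq_pred _)).
    rewrite (big_pred1 (Ordinal lt)) => [|k]; last by rewrite /= -val_eqE /=; lia.
    rewrite mxE /=; case: insubP => [k _ kE|]; last by rewrite prednK ?lt0n // ltn_ord.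
    by congr (- s 0 _); apply: val_inj; rewrite kE prednK // lt0n.
  case: eqP => [j0|_]; last by rewrite subrr.
  rewrite addr0 sE mxE (bigD1 j) //= (Hg j j).1 mulr1 big1 ?addr0 => [|k kj].
    by rewrite !mxE; apply: su; rewrite /= j0.
  by rewrite (Hg k j).2 ?mulr0 //; move: kj; rewrite -val_eqE /=; lia.
exists (block_mx 1%:M (- v) 0 g), (block_mx 1%:M (v *m h) 0 h); split.
- exact: (@utri_block n).
- rewrite (@mulmx_block _ 1 n 1 n 1 n) !mulmx0 !mul0mx !mul1mx ?mulmx1 !addr0 !add0r gh.
  by rewrite mulNmx subrr -(@scalar_mx_block _ 1 n).
have X : v *m h + (e0 - v *m Jmx n) *m h = r.
  rewrite -mulmxDl (_ : v + _ = s); first by rewrite sE -mulmxA gh mulmx1.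
  rewrite -vE mulmxBr mulmx1; move: (v *m Jmx n) (v) => q z.
  by apply/matrixP => i j; rewrite !mxE; ring.
have XX : block_mx 1%:M (- v) 0 g *m block_mx 1%:M e0 0 (Jmx n) *m block_mx 1%:M (v *m h) 0 h
    = block_mx 1%:M r 0 (g *m Jmx n *m h) :> 'M[int]_(1 + n).
  rewrite !mulmx_block !mulmx0 !mul0mx !mul1mx ?mulmx1 ?addr0 ?add0r -X.
  by rewrite mulNmx mul0mx add0r mul1mx.
by apply: (etrans uE); rewrite u'E JE; exact: esym XX.
Qed.

(** A superdiagonal split by parity: row i and column i + 1 have opposite parities, so each half is
    [supported] on the rows of one parity and the halves of a given parity multiply by adding
    entries. *)
Definition parity_unip n (b : bool) (f : nat -> int) : 'M[int]_n :=
  \matrix_(i, j) ((i == j)%:R + if (odd i == b) && (j == i.+1 :> nat) then f i else 0).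

Lemma parity_unip_utri n b f : utri (parity_unip n b f).
Proof.
move=> i j; rewrite !mxE eqxx [i == i.+1 :> nat](ltn_eqF (ltnSn i)) andbF addr0; split=> // ji.
by rewrite -val_eqE /= gtn_eqF // [_ == i.+1 :> nat]ltn_eqF ?andbF ?addr0 // ltnW.
Qed.

Lemma parity_unip_supported n b f : supported [pred i : 'I_n | odd i == b] (parity_unip n b f).
Proof.
move=> i j; rewrite mxE /=; case: ifP => [/andP[/eqP<- /eqP->] _|_]; last by rewrite addr0 eqxx.
by rewrite eqxx /=; case: odd.
Qed.

Lemma parity_unipM n b f g : parity_unip n b f *m parity_unip n b g = parity_unip n b (fun k => f k + g k).
Proof.
pose N (h : nat -> int) : 'M[int]_n := \matrix_(i, j) (if (odd i == b) && (j == i.+1 :> nat) then h i else 0).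
have X h : parity_unip n b h = 1%:M + N h by apply/matrixP => i j; rewrite !mxE.
have NN : N f *m N g = 0.
  apply/matrixP => i j; rewrite !mxE big1 // => k _; rewrite !mxE.
  case: ifP => [/andP[/eqP ib /eqP kE]|_]; last by rewrite mul0r.
  by rewrite kE /= ib; case: (b); rewrite /= mulr0.
have ND : N f + N g = N (fun k => f k + g k).
  by apply/matrixP => i j; rewrite !mxE; case: ifP; rewrite ?addr0.
by rewrite !X mulmxDl mul1mx mulmxDr mulmx1 NN addr0 -ND -addrA [N g + _]addrC.
Qed.

Lemma parity_unipVK n b f : parity_unip n b (fun k => - f k) *m parity_unip n b f = 1%:M.
Proof.
rewrite parity_unipM; apply/matrixP => i j; rewrite !mxE addNr.
by rewrite if_same addr0.
Qed.

Lemma card_parity c n b : (c.*2.+1 <= n)%N -> (c <= #|[pred i : 'I_n | odd i == b]|)%N.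
Proof.
move=> cn; have lt (k : 'I_c) : (k.*2 + b < n)%N by have := ltn_ord k; case: b; lia.
pose f k : 'I_n := Ordinal (lt k).
have fi : injective f by move=> k l /(congr1 val) /= kl; apply: val_inj; case: b lt f kl => /=; lia.
rewrite -[X in (X <= _)%N]card_ord -(card_image fi); apply: subset_leq_card.
apply/fintype.subsetP => x /fintype.imageP[k _ ->]; rewrite inE /= oddD odd_double addFb.
by case: (b).
Qed.

Section Widths.
Variables (d : nat) (w : free_group d).
Local Notation wprod n := (mprod (@wval d w n)).

Lemma utri_wprod_ex : w <> 1%g -> exists m, forall n (u : 'M[int]_n),
  (m <= n)%N -> utri u -> wprod n 16 u.
Proof.
move=> /supported_wprod_ex[aw Haw]; exists aw.*2.+1 => n u nm Hu.
have vP b f : wprod n 4 (parity_unip n b f).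
  by apply: Haw (@parity_unip_supported n b f); apply: card_parity.
have vu b f : parity_unip n b f \in unitmx by apply: mprod_unit (vP b f) => A; apply: wval_unit.
have superE b f (i j : 'I_n) : j = i.+1 :> nat -> parity_unip n b f i j = if odd i == b then f i else 0.
  move=> ji; rewrite mxE ji eqxx andbT -val_eqE /= ji ltn_eqF ?add0r //.
pose y (k : nat) := (if insub k is Some i then if insub k.+1 is Some j then u i j else 0 else 0) - 1.
have yE (i j : 'I_n) : j = i.+1 :> nat -> y i = u i j - 1.
  move=> ji; rewrite /y valK -ji valK //.
pose u' := u *m parity_unip n true (fun k => - y k) *m parity_unip n false (fun k => - y k).
have uE : u = u' *m (parity_unip n false y *m parity_unip n true y).
  rewrite /u' mulmxA -(mulmxA (u *m _)) parity_unipVK mulmx1.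
  by rewrite -mulmxA parity_unipVK mulmx1.
have u'tri : utri u' by do 2?[apply: utriM => //]; apply: parity_unip_utri.
have u'sup : super1 u'.
  move=> i j ji; rewrite /u' !superM //; try exact: parity_unip_utri; last first.
    by apply: utriM => //; apply: parity_unip_utri.
  rewrite !superE // (yE i j ji); case: (odd i) => /=; ring.
pose k1 : nat -> int := fun=> 1.
(* A product of two parity factors with superdiagonal 1; like [u'] it is conjugate to [Jmx n], so
   [u'] is conjugate to [J0] and costs 4 + 4. *)
pose J0 := parity_unip n false k1 *m parity_unip n true k1.
have J0tri : utri J0 by apply: utriM; apply: parity_unip_utri.
have J0sup : super1 J0.
  move=> i j ji; rewrite /J0 superM //; try exact: parity_unip_utri.
  by rewrite !superE // /k1; case: (odd i).
have [g [h [_ gh u'E]]] := utri_conj_J u'tri u'sup.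
have [g2 [h2 [_ gh2 J0E]]] := utri_conj_J J0tri J0sup.
have u'J : u' = (g *m h2) *m J0 *m (g2 *m h).
  have hg2 := mulmx1C gh2.
  by rewrite J0E !mulmxA -(mulmxA g h2 g2) hg2 mulmx1 -(mulmxA _ h2 g2) hg2 mulmx1 u'E.
have E : (g *m h2) *m (g2 *m h) = 1%:M.
  by rewrite mulmxA -(mulmxA g) (mulmx1C gh2) mulmx1.
have [Eu _] := mulmx1_unit E.
rewrite uE; apply: (@mprodM _ _ 8 8); last exact: (@mprodM _ _ 4 4).
have -> : u' = (g *m h2) *m J0 *m invmx (g *m h2).
  by rewrite u'J -[X in _ *m X](mulKmx Eu) E mulmx1.
by apply: wprod_conj => //; apply: (@mprodM _ _ 4 4).
Qed.

Definition ltri n (M : 'M[int]_n) := utri M^T.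

Lemma ltri_wprod_ex : w <> 1%g -> exists m, forall n (u : 'M[int]_n),
  (m <= n)%N -> ltri u -> wprod n 16 u.
Proof.
move=> /utri_wprod_ex[m Hm]; exists m => n u mn Hu.
(* Reversing the order of the coordinates turns lower into upper unitriangular matrices. *)
pose s : {perm 'I_n} := perm (@rev_ord_inj n).
apply: (wprod_conjV (perm_mx_unit s)); apply: Hm => // i j.
rewrite !perm_conjE !permE; have := Hu (rev_ord j) (rev_ord i); rewrite !mxE.
have := Hu (rev_ord i) (rev_ord i); rewrite !mxE => -[-> _] [_ H]; split=> // ji.
by apply: H => /=; move: (ltn_ord i) ji; lia.
Qed.

End Widths.

End Unitriangular.

(** * Stable range reduction *)

(** Take for t the product of the primes of h that do not divide c. A prime q of h divides exactly
    one of c and t; if it divides c, it cannot divide p because of the unit relation. In both cases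
    q does not divide c + t p. *)
Lemma shift_coprime (c p h a b e : int) : h != 0 -> a * c + b * p + e * h = 1 ->
  exists t, coprimez (c + t * p) h.
Proof.
move=> h0 E; pose t := (\prod_(q <- primes `|h| | ~~ (q %| `|c|)) q)%N.
exists t%:Z; apply: contraT => nc; set g := gcdn `|c + t%:Z * p| `|h|.
have g1 : (1 < g)%N.
  move: nc; rewrite coprimezE /coprime -/g.
  have : (0 < g)%N by rewrite gcdn_gt0 (absz_gt0 h) h0 orbT.
  by case: (g) => [|[|]].
have qp := pdiv_prime g1; have := pdiv_dvd g; rewrite dvdn_gcd.
move: (pdiv g) qp => q qp /andP[q1 qh].
have qh' : q \in primes `|h| by rewrite mem_primes qp absz_gt0 h0.
have qt : (q %| t)%N = ~~ (q %| `|c|)%N.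
  rewrite Euclid_dvd_prod // big_has_cond; apply/hasP/idP => [[q' q'h /andP[/= q'c qq']]|qc].
    by move: q'h; rewrite mem_primes => /andP[q'p _]; rewrite (eqP (_ : q == q')) // -dvdn_prime2.
  by exists q => //=; rewrite qc dvdnn.
have {}q1 : (q%:Z %| c + t%:Z * p)%Z by rewrite dvdzE.
have {}qh : (q%:Z %| h)%Z by rewrite dvdzE.
have qtp : (q%:Z %| t%:Z * p)%Z = (q%:Z %| t%:Z)%Z || (q%:Z %| p)%Z by rewrite !dvdzE abszM Euclid_dvdM.
have {}qt : (q%:Z %| t%:Z)%Z = ~~ (q%:Z %| c)%Z by rewrite !dvdzE.
case qc : (q%:Z %| c)%Z.
  have : (q%:Z %| t%:Z * p)%Z by rewrite -(rpredDl _ qc).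
  rewrite qtp qt qc /= => qp'.
  have : (q%:Z %| 1%R)%Z by rewrite -E !rpredD // dvdz_mull.
  by rewrite dvdzE /= dvdn1 => /eqP q1'; move: qp; rewrite q1'.
have : (q%:Z %| t%:Z * p)%Z by rewrite qtp qt qc.
by move=> H; move: q1; rewrite (rpredDr _ H) qc.
Qed.

Lemma cV_gcd m (c : 'cV[int]_m) : exists h (y : 'rV[int]_m) (z : 'cV[int]_m),
  (y *m c) 0 0 = h /\ c = h *: z.
Proof.
elim: m c => [|m IH] c.
  by exists 0, 0, 0; rewrite mul0mx mxE; split=> //; apply/colP => -[].
move: c; rewrite -[m.+1]/(1 + m)%N => c; rewrite -[c]vsubmxK.
set c1 := usubmx c; have [h [y [z [yE zE]]]] := IH (dsubmx c).
have [u [v uv]] := Bezoutz (c1 0 0) h.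
have /dvdzP[k1 k1E] := dvdz_gcdl (c1 0 0) h; have /dvdzP[k2 k2E] := dvdz_gcdr (c1 0 0) h.
exists (gcdz (c1 0 0) h), (row_mx u%:M (v *: y)), (col_mx k1%:M (k2 *: z)); split.
  by rewrite -uv mul_row_col mul_scalar_mx -scalemxAl mxE [X in X + _]mxE [X in _ + X]mxE yE.
rewrite scale_col_mx zE scalerA [_ * k2]mulrC -k2E; congr col_mx.
by rewrite scale_scalar_mx mulrC -k1E -mx11_scalar.
Qed.

(** Let h be the gcd of all entries of c but the first. If h != 0, a multiple of p added to the
    first entry makes it coprime to h, by [shift_coprime]. *)
Lemma cV_stable_range m (p : int) (c : 'cV[int]_m.+2) (x : int) (y : 'rV[int]_m.+2) :
  x * p + (y *m c) 0 0 = 1 ->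
  exists (t : 'cV[int]_m.+2) (v : 'rV[int]_m.+2), v *m (c + p *: t) = 1%:M.
Proof.
have sD a b : (a + b)%:M = a%:M + b%:M :> 'M[int]_1 by exact: raddfD.
move: y c; rewrite -[m.+2]/(1 + m.+1)%N => y c.
rewrite -[c]vsubmxK -[y]hsubmxK mul_row_col.
set c0 := usubmx c; set c1 := dsubmx c; set y0 := lsubmx y; set y1 := rsubmx y.
have [h [z [k [zc1 c1E]]]] := cV_gcd c1.
have zc1' : z *m c1 = h%:M by apply/matrixP => i j; rewrite !ord1 zc1 mxE eqxx.
have [u uE] : exists u, y1 *m c1 = (u * h)%:M.
  exists ((y1 *m k) 0 0); apply/matrixP => i j.
  by rewrite !ord1 c1E -scalemxAr !mxE mulrC.
have [s sE] : exists s, y0 = s%:M by exists (y0 0 0); rewrite -mx11_scalar.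
have [r rE] : exists r, c0 = r%:M by exists (c0 0 0); rewrite -mx11_scalar.
rewrite uE sE rE -scalar_mxM -sD mxE eqxx mulr1n => E.
have [h0|hn0] := eqVneq h 0.
  have c10 : c1 = 0 by rewrite c1E h0 scale0r.
  (* The tail is zero, so p itself is put into its first place; the first entry of c and p are
     already coprime. *)
  exists (col_mx 0 (delta_mx 0 0)), (row_mx s%:M (x *: delta_mx 0 0)).
  rewrite scale_col_mx add_col_mx mul_row_col c10 scaler0 addr0 add0r -scalar_mxM.
  rewrite -scalemxAl -scalemxAr mul_delta_mx scalerA; apply/matrixP => i j.
  by rewrite !ord1 !mxE !eqxx mulr1n !mulr1 -E h0 mulr0 addr0 addrC.
have E' : s * r + x * p + u * h = 1 by rewrite -E; ring.
have [t /coprimezP[[a b] /= ab]] := shift_coprime hn0 E'.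
exists (col_mx t%:M 0), (row_mx a%:M (b *: z)).
rewrite scale_col_mx add_col_mx mul_row_col scaler0 addr0 -scalemxAl zc1'.
rewrite scale_scalar_mx -sD -scalar_mxM scale_scalar_mx -sD.
by congr (_%:M); rewrite -ab; ring.
Qed.

(** On the first column (p, c): adding t p to c gives c' with v c' = 1, adding (1 - p) v c' to p
    turns the corner into 1, and then c' is cleared. The inverses of these three operations are the
    first three factors. *)
Lemma stable_step m (A : 'M[int]_(1 + m.+2)) : A \in unitmx ->
  exists w1 v1 w2 v2 B, A = block_mx 1%:M 0 w1 1%:M *m block_mx 1%:M v1 0 1%:M
    *m block_mx 1%:M 0 w2 1%:M *m block_mx 1%:M v2 0 B.
Proof.
move=> Au; pose p := A 0 0; pose c := dlsubmx A.
have [x [y E]] : exists (x : int) (y : 'rV[int]_m.+2), x * p + (y *m c) 0 0 = 1.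
  exists (invmx A 0 0), (ursubmx (invmx A)).
  transitivity ((invmx A *m A) 0 0); last by rewrite mulVmx // mxE.
  rewrite [RHS]mxE big_split_ord big_ord1 /= mxE; congr (_ * _ + _).
  - by congr (invmx A _ _); apply: val_inj.
  - by congr (A _ _); apply: val_inj.
  apply: eq_bigr => k _; rewrite !mxE; congr (invmx A _ _ * A _ _); exact: val_inj.
have [t [v vE]] := cV_stable_range E.
have AE : A = block_mx p%:M (ursubmx A) c (drsubmx A).
  rewrite -[LHS]submxK; congr block_mx; apply/matrixP => i j.
  by rewrite !ord1 !mxE eqxx mulr1n; congr (A _ _); apply: val_inj.
pose c' := c + p *: t; rewrite -/c' in vE.
pose R := ursubmx A; pose S := drsubmx A.
pose k := (1 - p) *: v; pose S1 := S + t *m R; pose R2 := R + k *m S1.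
exists (- t), (- k), c', R2, (S1 - c' *m R2).
have vc' : k *m c' = (1 - p)%:M by rewrite -scalemxAl vE scale_scalar_mx mulr1.
have -> : block_mx 1%:M 0 (- t) 1%:M *m block_mx 1%:M (- k) 0 1%:M *m block_mx 1%:M 0 c' 1%:M
    *m block_mx 1%:M R2 0 (S1 - c' *m R2)
  = block_mx 1%:M 0 (- t) 1%:M *m (block_mx 1%:M (- k) 0 1%:M *m block_mx 1%:M R2 c' S1).
  rewrite -!mulmxA; congr (_ *m (_ *m _)).
  by rewrite mulmx_block !mul1mx ?mulmx1 !mul0mx ?mulmx0 !addr0 [c' *m R2 + _]addrC subrK.
rewrite [block_mx _ (- k) _ _ *m _]mulmx_block !mul1mx !mul0mx !add0r !mulNmx vc'.
have -> : 1%:M - (1 - p)%:M = p%:M :> 'M[int]_1 by rewrite -raddfB opprB addrCA subrr addr0.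
rewrite /R2 addrK mulmx_block !mul1mx !mul0mx !addr0 {1}AE /S1 -/c -/R -/S; congr block_mx.
  by rewrite /c' mul_mx_scalar scalerN addrCA addNr addr0.
by rewrite mulNmx addrCA addNr addr0.
Qed.

Definition bottom n (B : 'M[int]_n) :=
  forall i j : 'I_n, (i.+2 < n)%N || (j.+2 < n)%N -> B i j = (i == j)%:R.

Lemma bottom_block m (B : 'M[int]_m.+2) : bottom B -> bottom (block_mx (1%:M : 'M_1) 0 0 B).
Proof.
move=> HB; change (forall i j : 'I_(1 + m.+2), (i.+2 < 1 + m.+2)%N || (j.+2 < 1 + m.+2)%N ->
  block_mx (1%:M : 'M_1) 0 0 B i j = (i == j)%:R) => i j.
case: (split_ordP i) => i' ->; case: (split_ordP j) => j' ->.
- by rewrite block_mxEul mxE (inj_eq (@lshift_inj _ _)).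
- by rewrite block_mxEur mxE eq_lrshift.
- by rewrite block_mxEdl mxE eq_rlshift.
rewrite block_mxEdr (inj_eq (@rshift_inj _ _)) /= => H; apply: HB.
by move: H; lia.
Qed.

Lemma ltri_block n (c : 'cV[int]_n) (M : 'M_n) : ltri M -> ltri (block_mx (1%:M : 'M_1) 0 c M).
Proof. by move=> HM; rewrite /ltri (@tr_block_mx _ 1 n 1 n) trmx1 trmx0; apply: utri_block. Qed.

(** The number of triangular factors does not grow with n: each new row or column is absorbed into
    one of the four factors already present. *)
Lemma stable_reduction n (A : 'M[int]_n) : (1 < n)%N -> A \in unitmx ->
  exists l1 u1 l2 u2 B, [/\ ltri l1 /\ utri u1, ltri l2 /\ utri u2, bottom B
    & A = l1 *m u1 *m l2 *m u2 *m B].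
Proof.
case: n A => [|[|m]] //; elim: m => [|m IH] A _ Au.
  exists 1%:M, 1%:M, 1%:M, 1%:M, A; rewrite !mul1mx; split=> //.
  - by split; rewrite /ltri ?trmx1; apply: utri1.
  - by split; rewrite /ltri ?trmx1; apply: utri1.
have [w1 [v1 [w2 [v2 [A1 AE]]]]] := stable_step (A := A) Au.
have A1u : A1 \in unitmx.
  move: Au; rewrite AE unitmxE (@det_mulmx _ (1 + m.+2)) unitrM => /andP[_].
  by rewrite det_ublock det1 mul1r.
have [l [u [l' [u' [B [[Hl Hu] [Hl' Hu'] HB A1E]]]]]] := IH A1 isT A1u.
have Bu : B \in unitmx by move: A1u; rewrite A1E !unitmx_mul => /andP[].
have luu : l *m u \in unitmx by move: A1u; rewrite A1E !unitmx_mul => /andP[/andP[/andP[]]].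
(* [y] is the column w2 after it is moved to the right past l u, and [z] is the row v2 after it is
   moved to the left past B. *)
pose y := invmx (l *m u) *m w2; pose z := v2 *m invmx B.
exists (block_mx 1%:M 0 w1 l), (block_mx 1%:M (v1 *m l *m u) 0 u), (block_mx 1%:M 0 y l'),
  (block_mx 1%:M z 0 u'), (block_mx (1%:M : 'M_1) 0 0 B); split.
- by split; [apply: ltri_block | apply: (@utri_block m.+2)].
- by split; [apply: ltri_block | apply: (@utri_block m.+2)].
- exact: bottom_block.
have S3 : block_mx 1%:M v2 0 A1 = block_mx 1%:M 0 0 (l *m u *m l') *m block_mx 1%:M z 0 u'
    *m block_mx 1%:M 0 0 B :> 'M_(1 + m.+2).
  rewrite !mulmx_block !mul1mx !mul0mx ?mulmx0 ?mulmx1 ?addr0 ?add0r mulmxKV //.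
  by rewrite A1E.
have S2 : block_mx 1%:M 0 w2 1%:M *m block_mx 1%:M 0 0 (l *m u *m l')
    = block_mx 1%:M 0 0 (l *m u) *m block_mx 1%:M 0 y l' :> 'M_(1 + m.+2).
  by rewrite !mulmx_block !mul1mx !mul0mx ?mulmx0 ?mulmx1 ?addr0 ?add0r mulKVmx.
have S1 : block_mx 1%:M 0 w1 1%:M *m block_mx 1%:M v1 0 1%:M *m block_mx 1%:M 0 0 (l *m u)
    = block_mx 1%:M 0 w1 l *m block_mx 1%:M (v1 *m l *m u) 0 u :> 'M_(1 + m.+2).
  rewrite !mulmx_block !mul1mx !mul0mx ?mulmx0 ?mulmx1 ?addr0 ?add0r ?mul1mx mulmxDl mul1mx !mulmxA.
  by [].
apply: (etrans AE); rewrite S3 !mulmxA -(mulmxA _ (block_mx 1%:M 0 w2 1%:M)) S2 !mulmxA S1.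
by [].
Qed.

(** * Products of conjugates of elementary matrices *)

(** Pick one point in each of [size p] blocks. Their images under the permutation value stay in
    their blocks and differ from them, so points and images are all distinct, and a conjugation
    carries them to p and q. *)
Lemma wval_perm_moving d (w : free_group d) : w <> 1%g -> exists e, forall n (p q : seq 'I_n),
  (e * size p <= n)%N -> size p = size q -> uniq (p ++ q) ->
  exists s : {perm 'I_n}, wval w (perm_mx s) /\ map s p = q.
Proof.
move=> w1; have [e e0 He] := word_value_perm w1; exists e => n p q en pq upq.
have [rho [ev]] := He n; set pi := word_eval w rho => piP.
set L := size p in en pq *.
have lt (i : 'I_L) : (i * e < n %/ e * e)%N.
  by rewrite ltn_mul2r e0 (leq_trans (ltn_ord i)) // leq_divRL // mulnC.
have lt' i := leq_trans (lt i) (leq_divM n e).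
pose f i : 'I_n := Ordinal (lt' i); pose P0 := map f (enum 'I_L).
have fi : injective f.
  move=> i j /(congr1 val)/= /eqP; rewrite eqn_mul2r (gtn_eqF e0) /= => /eqP; exact: val_inj.
have uP : uniq (P0 ++ map pi P0).
  rewrite cat_uniq (map_inj_uniq (@perm_inj _ pi)) (map_inj_uniq fi) enum_uniq andbT /=.
  apply/hasPn => _ /mapP[_ /mapP[i _ ->] ->]; apply/negP => /mapP[j _ E].
  have [ne _ blk] := piP (f i) (lt i).
  have ji : j = i by apply: val_inj; move: blk; rewrite E /= !mulnK.
  by move: ne; rewrite E ji eqxx.
have sP : size P0 = L by rewrite size_map size_enum_ord.
have [g gE] : exists g : {perm 'I_n}, map g (P0 ++ map pi P0) = p ++ q.
  by apply: perm_extend => //; rewrite !size_cat size_map sP -pq.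
have [gp gq] : map g P0 = p /\ map g (map pi P0) = q.
  move: gE; rewrite map_cat => /eqP; rewrite eqseq_cat; last by rewrite size_map sP.
  by case/andP=> /eqP-> /eqP->.
exists (g^-1 * pi * g)%g; split.
  rewrite !perm_mxM -{2}[g]invgK -(invmx_perm (g^-1)%g).
  by apply: wval_conj; [exact: perm_mx_unit | exact: wval_perm].
rewrite -gp -gq -!map_comp; apply: eq_map => x /=.
by rewrite !permM permK.
Qed.

Lemma elconj_chain m K (A : 'M[int]_m.+1) : mprod (@elconj m.+1) K A ->
  exists (z g : nat -> 'M[int]_m.+1) (a b : nat -> 'I_m.+1) (t : nat -> int), [/\ z 0%N = 1%:M, z K = A &
    forall k, (k < K)%N -> [/\ g k \in unitmx, a k != b k &
      z k.+1 = g k *m elmx (a k) (b k) (t k) *m invmx (g k) *m z k]].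
Proof.
elim: K A => [|K IH] A /=.
  by move=> ->; exists (fun=> 1%:M), (fun=> 1%:M), (fun=> 0), (fun=> 0), (fun=> 0).
move=> [T [B [[g' [a' [b' [t' [gu ab TE]]]]] /IH[z [g [a [b [t [z0 zK zS]]]]]] AE]]].
pose upd U (f : nat -> U) i u k := if k == i then u else f k.
exists (upd _ z K.+1 A), (upd _ g K g'), (upd _ a K a'), (upd _ b K b'), (upd _ t K t').
split; rewrite /upd ?eqxx // => k; rewrite ltnS leq_eqVlt eqSS.
case: (eqVneq k K) => [-> _|kK /= kK']; first by rewrite ltn_eqF // zK AE TE.
by rewrite ltn_eqF ?ltnS 1?ltnW //; apply: zS.
Qed.

(** * Block diagonal matrices on disjoint triples of coordinates *)

Section Frames.
Variables (n N : nat) (pos : nat -> 'I_n).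
Hypothesis pos_inj : forall i j, (i < N)%N -> (j < N)%N -> pos i = pos j -> i = j.
Implicit Types (o r k : nat) (x y : nat -> 'M[int]_3).

(* When the positions are distinct, [framed o r x] acts as [x k] on the coordinates
   pos (o + 3k), pos (o + 3k + 1), pos (o + 3k + 2) for k < r, and fixes the others. *)
Definition frame k : 'M[int]_(n, 3) := \matrix_(i, a) (i == pos (k + a))%:R.

Definition framed o r x : 'M[int]_n :=
  1%:M + \sum_(k < r) frame (o + k * 3) *m (x k - 1%:M) *m (frame (o + k * 3))^T.

Lemma frame_orth k l : (k + 3 <= N)%N -> (l + 3 <= N)%N ->
  (k = l) \/ (k + 3 <= l)%N \/ (l + 3 <= k)%N ->
  (frame k)^T *m frame l = (k == l)%:R%:M.
Proof.
move=> kN lN kl; apply/matrixP => a b; rewrite !mxE (bigD1 (pos (l + b))) //= !mxE eqxx mulr1.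
rewrite big1 ?addr0 => [|i /negPf ib]; last by rewrite !mxE ib mulr0.
have aN : (k + a < N)%N by rewrite (leq_trans _ kN) // ltn_add2l.
have bN : (l + b < N)%N by rewrite (leq_trans _ lN) // ltn_add2l.
rewrite (_ : (pos _ == _) = (k + a == l + b)%N); last first.
  by apply/eqP/eqP => [/pos_inj-> // | ->].
have ha := ltn_ord a; have hb := ltn_ord b.
case: (eqVneq k l) kl => [<- _|kl [kl'|kl']]; first by rewrite eqn_add2l mulr1n.
  by rewrite mul0rn; case: eqP => // E; case/eqP: kl.
rewrite mul0rn; case: eqP kl' => // E; lia.
Qed.

Lemma eq_framed o r x y : (forall k, (k < r)%N -> x k = y k) -> framed o r x = framed o r y.
Proof. by move=> xy; congr (_ + _); apply: eq_bigr => k _; rewrite xy. Qed.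

Lemma framedM o r x y : (o + r * 3 <= N)%N ->
  framed o r x *m framed o r y = framed o r (fun k => x k *m y k).
Proof.
move=> orN; rewrite /framed mulmxDl mul1mx mulmxDr mulmx1 -addrA; congr (_ + _).
rewrite addrCA mulmx_suml -!big_split /=; apply: eq_bigr => k _.
set G := \sum_i _; set F := frame (o + k * 3).
have FF : F^T *m F = 1%:M by rewrite /F frame_orth ?eqxx ?mulr1n //; [have := ltn_ord k; lia.. | left].
have -> : F *m (x k - 1%:M) *m F^T *m G = F *m ((x k - 1%:M) *m (y k - 1%:M)) *m F^T.
  rewrite /G mulmx_sumr (bigD1 k) //= big1 ?addr0 => [|l lk].
    by rewrite !mulmxA -(mulmxA _ F^T) FF mulmx1.
  rewrite !mulmxA -(mulmxA _ F^T) /F frame_orth; [|have := ltn_ord k; lia|have := ltn_ord l; lia|].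
    by rewrite eqn_add2l eqn_mul2r /= eq_sym val_eqE (negPf lk) mulr0n raddf0 mulmx0 !mul0mx.
  by move: lk; rewrite -val_eqE /=; lia.
rewrite -!mulmxDl -!mulmxDr; congr (_ *m _ *m _).
rewrite mulmxBl mul1mx mulmxBr mulmx1.
by apply/matrixP => i j; rewrite !mxE; ring.
Qed.

Lemma framed1 o r x : (forall k, (k < r)%N -> x k = 1%:M) -> framed o r x = 1%:M.
Proof.
move=> x1; rewrite /framed big1 ?addr0 // => k _.
by rewrite x1 // subrr mulmx0 mul0mx.
Qed.

Lemma framed_unitV o r x : (o + r * 3 <= N)%N -> (forall k, (k < r)%N -> x k \in unitmx) ->
  framed o r x \in unitmx /\ invmx (framed o r x) = framed o r (fun k => invmx (x k)).
Proof.
move=> orN xu; have E : framed o r x *m framed o r (fun k => invmx (x k)) = 1%:M.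
  by rewrite framedM // framed1 // => k kr; rewrite mulmxV // xu.
have [u _] := mulmx1_unit E; split=> //.
by rewrite -[RHS](mulKmx u) E mulmx1.
Qed.

Lemma framed_recl o r x : x 0%N = 1%:M -> framed o r.+1 x = framed (o + 3) r (fun k => x k.+1).
Proof.
move=> x0; rewrite /framed big_ord_recl x0 subrr mulmx0 mul0mx add0r; congr (_ + _).
by apply: eq_bigr => k _; rewrite -addnA.
Qed.

Lemma framed_recr o r x : x r = 1%:M -> framed o r.+1 x = framed o r x.
Proof. by move=> xr; rewrite /framed big_ord_recr /= xr subrr mulmx0 mul0mx addr0. Qed.

Lemma framed_last o r x : (forall k, (k < r)%N -> x k = 1%:M) ->
  framed o r.+1 x = 1%:M + frame (o + r * 3) *m (x r - 1%:M) *m (frame (o + r * 3))^T.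
Proof.
move=> x1; rewrite /framed big_ord_recr /= big1 ?add0r // => k _.
by rewrite x1 // subrr mulmx0 mul0mx.
Qed.

Section WordValues.
Variables (d : nat) (w : free_group d) (e : nat).
Hypothesis moving : forall p q : seq 'I_n,
  (e * size p <= n)%N -> size p = size q -> uniq (p ++ q) ->
  exists s : {perm 'I_n}, wval w (perm_mx s) /\ map s p = q.
Local Notation wprod n := (mprod (@wval d w n)).

(** The product is the commutator of D = [framed o1 r x] with a permutation value S that transports
    one range of positions to the other: S D^-1 S^-1 is D^-1 placed at o2. *)
Lemma framed_swap o1 o2 r x : (e * N <= n)%N -> (o1 + r * 3 <= N)%N -> (o2 + r * 3 <= N)%N ->
  (o1 + r * 3 <= o2)%N || (o2 + r * 3 <= o1)%N ->
  (forall k, (k < r)%N -> x k \in unitmx) ->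
  wprod n 2 (framed o1 r x *m framed o2 r (fun k => invmx (x k))).
Proof.
move=> eN o1N o2N o12 xu; set L := (r * 3)%N in o1N o2N o12.
have [s [sw sE]] : exists s : {perm 'I_n}, wval w (perm_mx s) /\
    map s (map pos (iota o2 L)) = map pos (iota o1 L).
  apply: moving; rewrite ?size_map ?size_iota //.
    by apply: leq_trans eN; rewrite leq_mul2l (leq_trans _ o1N) ?leq_addl // orbT.
  rewrite -map_cat map_inj_in_uniq.
    rewrite cat_uniq !iota_uniq andbT /=; apply/hasPn => i; rewrite !mem_iota; lia.
  by move=> i j; rewrite !mem_cat !mem_iota => iL jL; apply: pos_inj; lia.
have sp j : (j < L)%N -> s (pos (o2 + j)) = pos (o1 + j).
  move=> jL; have := congr1 (fun l => nth (pos 0%N) l j) sE.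
  rewrite -map_comp !(nth_map 0%N) ?size_iota //= !nth_iota //.
have Sfr k : (k < r)%N -> perm_mx s *m frame (o1 + k * 3) = frame (o2 + k * 3).
  move=> kr; rewrite -row_permE; apply/matrixP => i a; rewrite !mxE -!addnA -sp ?(inj_eq perm_inj) //.
  by have := ltn_ord a; rewrite /L; lia.
have [Du DV] := framed_unitV o1N xu.
have -> : framed o2 r (fun k => invmx (x k)) =
    perm_mx s *m invmx (framed o1 r x) *m invmx (perm_mx s).
  rewrite DV /framed mulmxDr mulmxDl mulmx1 mulmxV ?perm_mx_unit //; congr (_ + _).
  rewrite mulmx_sumr mulmx_suml; apply: eq_bigr => k _.
  by rewrite -Sfr // trmx_mul tr_perm_mx invmx_perm !mulmxA.
by rewrite !mulmxA; apply: wprod_comm.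
Qed.

Hypothesis supported_wprod : forall (P : pred 'I_n) (M : 'M[int]_n),
  (e <= #|P|)%N -> supported P M -> wprod n 4 M.

Lemma frame_delta k l (a b : 'I_3) :
  frame k *m delta_mx a b *m (frame l)^T = delta_mx (pos (k + a)) (pos (l + b)).
Proof.
have E : (frame l)^T = \sum_(c < 3) delta_mx c (pos (l + c)).
  apply/matrixP => c j; rewrite summxE (bigD1 c) //= big1 ?addr0 => [|c' cc'].
    by rewrite !mxE eqxx.
  by rewrite !mxE [c == _]eq_sym (negPf cc').
have F : frame k = \sum_(c < 3) delta_mx (pos (k + c)) c.
  apply/matrixP => j c; rewrite summxE (bigD1 c) //= big1 ?addr0 => [|c' cc'].
    by rewrite !mxE eqxx andbT.
  by rewrite !mxE [c == _]eq_sym (negPf cc') andbF.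
rewrite F mulmx_suml (bigD1 a) //= big1 ?addr0 => [|c ca]; last by rewrite mul_delta_mx_0.
rewrite mul_delta_mx E mulmx_sumr (bigD1 b) //= big1 ?addr0 => [|c cb]; last by rewrite mul_delta_mx_0 // eq_sym.
by rewrite mul_delta_mx.
Qed.

Lemma framed_elmx o r (a b : nat -> 'I_3) (t : nat -> int) : (e + N <= n)%N -> (o + r * 3 <= N)%N ->
  (forall k, (k < r)%N -> a k != b k) ->
  wprod n 4 (framed o r (fun k => elmx (a k) (b k) (t k))).
Proof.
(* Only the columns b k have to be avoided, so [P] is the complement of these at most r positions
   and has at least [e] elements. The rows a k lie in it because the frames are disjoint. *)
move=> eN orN ab; pose Q := [pred i : 'I_n | [exists k : 'I_r, i == pos (o + k * 3 + b k)]].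
apply: (supported_wprod (P := predC Q)).
  have Qr : (#|Q| <= r)%N.
    rewrite -[X in (_ <= X)%N]card_ord.
    apply: leq_trans (leq_image_card (fun k : 'I_r => pos (o + k * 3 + b k)) 'I_r).
    apply/subset_leq_card/fintype.subsetP => i /existsP[k /eqP->]; exact: fintype.image_f.
  rewrite -(leq_add2l #|Q|) (cardC Q) card_ord; apply: leq_trans eN.
  by rewrite addnC leq_add2l; apply: leq_trans Qr _; move: orN; lia.
move=> i j; have [kx|] := boolP [exists k : 'I_r, (i == pos (o + k * 3 + a k)) && (j == pos (o + k * 3 + b k))].
  case/existsP: kx => k /andP[/eqP-> /eqP->] _; apply/andP; split; last by rewrite /= negbK; apply/existsP; exists k.
  apply/negP => /existsP[l /eqP E]; have := ab k (ltn_ord k); case/eqP.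
  have bnd (u : 'I_r) (c : 'I_3) : (o + u * 3 + c < N)%N.
    by have := ltn_ord u; have := ltn_ord c; lia.
  have {}E := pos_inj (bnd _ _) (bnd _ _) E.
  have ha := ltn_ord (a k); have hb := ltn_ord (b l).
  have kl : k = l by apply: val_inj => /=; lia.
  by subst l; apply/val_inj/eqP; move/eqP: E; rewrite eqn_add2l.
move=> /existsPn H /eqP[]; rewrite !mxE summxE big1 ?addr0 // => k _.
rewrite [elmx _ _ _]/elmx addrAC subrr add0r -scalemxAr -scalemxAl frame_delta !mxE.
by move: (H k); case: eqP => // _; case: eqP => //= _; rewrite ?mulr0.
Qed.

(* Let A = tau_(K-1) ... tau_0 and z_k = tau_(k-1) ... tau_0.  With blocks k <= K and
   auxiliary blocks k' <= K, multiply z_k at k by z_k^-1 at k', then by z_(k+1) at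
   (k+1)' and z_(k+1)^-1 at k, then by tau_k at k: what remains is z_K at block K. *)
Lemma framed_elconj_prod K A : mprod (@elconj 3) K A ->
  (e * N <= n)%N -> (e + N <= n)%N -> (K.+1 * 6 <= N)%N ->
  wprod n 8 (1%:M + frame (K * 3) *m (A - 1%:M) *m (frame (K * 3))^T).
Proof.
move=> /elconj_chain[z [g [a [b [t [z0 zK zS]]]]]] eN eN' KN.
have zu k : (k <= K)%N -> z k \in unitmx.
  elim: k => [|k IH] kK; first by rewrite z0 unitmx1.
  have [gu ab ->] := zS k kK.
  by rewrite !unitmx_mul gu unitmx_inv gu IH ?(ltnW kK) // (elconj_unit (elconj_elmx _ ab)).
pose q := (K.+1 * 3)%N.
have P1 : wprod n 2 (framed 0 K.+1 z *m framed q K.+1 (fun k => invmx (z k))).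
  by apply: framed_swap => //; rewrite /q ?add0n ?leqnn //; lia.
have P2 : wprod n 2 (framed (q + 3) K (fun k => z k.+1) *m framed 0 K (fun k => invmx (z k.+1))).
  by apply: framed_swap => //; rewrite /q; [lia | lia | lia | move=> k kK; apply: zu].
have P3 : wprod n 4 (framed 0 K (fun k => g k *m elmx (a k) (b k) (t k) *m invmx (g k))).
  have NK : (0 + K * 3 <= N)%N by lia.
  have gu k : (k < K)%N -> g k \in unitmx by move=> /zS[].
  have [gfu gfV] := framed_unitV NK gu.
  rewrite -!framedM // -gfV; apply: wprod_conj => //.
  by apply: framed_elmx => // k /zS[].
have := mprodM (mprodM P1 P2) P3; congr (wprod n 8 _).
pose ext (x : nat -> 'M[int]_3) k := if (k < K)%N then x k else 1%:M.
have extE x : framed 0 K x = framed 0 K.+1 (ext x).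
  rewrite framed_recr /ext ?ltnn //; apply: eq_framed => k kK; by rewrite kK.
(* Since z 0 = 1, the auxiliary part of [P2], shifted by one block, has z k at auxiliary block k and
   cancels the auxiliary part of [P1]. *)
rewrite -framed_recl // !extE.
have NK : (0 + K.+1 * 3 <= N)%N by lia.
have NK' : (q + K.+1 * 3 <= N)%N by rewrite /q; lia.
rewrite !mulmxA -(mulmxA (framed 0 _ z)) framedM // [framed q _ _]framed1; last first.
  by move=> k kK; rewrite mulVmx // zu.
rewrite mulmx1 !framedM // framed_last /ext => [|k kK]; rewrite ?ltnn ?kK.
  by rewrite !mulmx1 zK.
have [gu ab zE] := zS k kK.
have zu1 := zu k (ltnW kK); have zu2 := zu k.+1 kK.
set T := g k *m _ *m _ in zE *.
rewrite -[LHS](mulmxK zu1) -(mulmxA _ T) -zE mulmxKV // mulmxV //.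
Qed.

End WordValues.

End Frames.

Lemma bottom_det n (B : 'M[int]_n.+2) (i0 := inord n : 'I_n.+2) (i1 := inord n.+1 : 'I_n.+2) :
  bottom B -> \det B = B i0 i0 * B i1 i1 - B i0 i1 * B i1 i0.
Proof.
move=> HB; have E : (n.+2 = n + 2)%N by rewrite addn2.
pose B' : 'M[int]_(n + 2) := castmx (E, E) B.
have -> : \det B = \det B' by rewrite {}/B'; case: _ / E; rewrite castmx_id.
have B'E i j : B' i j = B (cast_ord (esym E) i) (cast_ord (esym E) j) by rewrite castmxE.
have -> : B' = block_mx 1%:M 0 0 (drsubmx B').
  rewrite -[LHS]submxK; congr block_mx; apply/matrixP => i j; rewrite !mxE B'E HB /=.
  - by rewrite (inj_eq (@cast_ord_inj _ _ _)) (inj_eq (@lshift_inj _ _)).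
  - by have := ltn_ord i; lia.
  - by rewrite (inj_eq (@cast_ord_inj _ _ _)) eq_lrshift.
  - by have := ltn_ord i; lia.
  - by rewrite (inj_eq (@cast_ord_inj _ _ _)) eq_rlshift.
  by have := ltn_ord j; lia.
rewrite det_ublock det1 mul1r (expand_det_row _ 0) !big_ord_recl big_ord0 /cofactor !det_mx11.
rewrite !mxE !B'E /= addr0 expr0 mul1r expr1 mulN1r mulrN.
by congr (B _ _ * B _ _ - B _ _ * B _ _); apply: val_inj; rewrite /= !inordK //= ?addn0 ?addn1.
Qed.

(** * The bottom 2 by 2 block and the final count *)

Section Width.
Variables (d : nat) (w : free_group d).
Hypothesis w1 : w <> 1%g.
Local Notation wprod n := (mprod (@wval d w n)).

Lemma bottom_wprod_ex : exists m, forall n (B : 'M[int]_n),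
  (m <= n)%N -> bottom B -> \det B = 1 -> wprod n 8 B.
Proof.
have [e1 He1] := wval_perm_moving w1; have [e2 He2] := supported_wprod_ex w1.
(* 432 = 72 * 6 positions: 72 blocks for 71 factors, as many auxiliary blocks, and 3 coordinates in
   each. *)
pose e := maxn e1 e2; exists (e.+1 * 432).+2 => -[|[|n]] // B en HB dB.
have en' : (e.+1 * 432 <= n)%N by [].
(* The cyclic shift puts the start of block 71, position 213 = 71 * 3, at index n. Its first two
   coordinates are then the last two indices, and the third wraps around to 0, where [emb] acts
   trivially. *)
pose pos k : 'I_n.+2 := Ordinal (ltn_pmod (k + (n - 213)) (isT : (0 < n.+2)%N)).
have pos_inj i j : (i < 432)%N -> (j < 432)%N -> pos i = pos j -> i = j.
  move=> iN jN /(congr1 val) /= /eqP; rewrite eqn_modDr !modn_small; [exact/eqP|lia|lia].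
have moving (p q : seq 'I_n.+2) : (e * size p <= n.+2)%N -> size p = size q -> uniq (p ++ q) ->
    exists s : {perm 'I_n.+2}, wval w (perm_mx s) /\ map s p = q.
  move=> ep; apply: He1; apply: leq_trans ep; by rewrite leq_mul2r leq_maxl orbT.
have supp (P : pred 'I_n.+2) (M : 'M[int]_n.+2) : (e <= #|P|)%N -> supported P M -> wprod n.+2 4 M.
  by move=> eP; apply: He2; apply: leq_trans eP; apply: leq_maxr.
pose i0 : 'I_n.+2 := inord n; pose i1 : 'I_n.+2 := inord n.+1.
have det : B i0 i0 * B i1 i1 - B i0 i1 * B i1 i0 = 1 by rewrite -bottom_det.
have := framed_elconj_prod pos_inj moving supp (sl2_bounded_generation det).
have eN : (e * 432 <= n.+2)%N by rewrite (leq_trans _ (leqW (leqW en'))) // leq_mul2r leqnSn orbT.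
have eN' : (e + 432 <= n.+2)%N by move: en'; lia.
move=> /(_ eN eN' (leqnn _)); congr (wprod _ 8 _).
have p0 : pos (71 * 3)%N = i0.
  by apply: val_inj; rewrite /= inordK // subnKC ?modn_small //; lia.
have p1 : pos (71 * 3 + 1)%N = i1.
  apply: val_inj; rewrite /= inordK // (_ : _ + (n - 213) = n.+1)%N ?modn_small //; lia.
have F a b (X : 'M[int]_3) : (frame pos (71 * 3) *m X *m (frame pos (71 * 3))^T) a b =
  \sum_(u < 3) \sum_(v < 3) X u v * ((a == pos (71 * 3 + u)%N) && (b == pos (71 * 3 + v)%N))%:R.
  rewrite mxE exchange_big /=; apply: eq_bigr => v _.
  rewrite !mxE big_distrl /=; apply: eq_bigr => u _.
  by rewrite !mxE -mulnb natrM; ring.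
apply/matrixP => a b; rewrite mxE F !big_ord_recl !big_ord0 /= !mxE /= /bump /= !addn0 p0 p1.
rewrite !subrr !subr0 !mul0r !addr0.
have i01 : (i0 == i1) = false by rewrite -val_eqE /= !inordK // ltn_eqF.
have i10 : (i1 == i0) = false by rewrite eq_sym.
have out (u : 'I_n.+2) : u != i0 -> u != i1 -> (u.+2 < n.+2)%N.
  by rewrite -!val_eqE /= !inordK //; have := ltn_ord u; lia.
have Ha := out a; have Hb := out b; move: Ha Hb.
case: (eqVneq a i0) => [->|a0]; last case: (eqVneq a i1) => [->|a1]; last first.
- by move=> /(_ isT isT) lt _; rewrite /= !mulr0 !addr0 HB ?lt.
- case: (eqVneq b i0) => [->|b0]; last case: (eqVneq b i1) => [->|b1] _; last first.
  + by move=> /(_ isT isT) lt; rewrite /= !mulr0 !addr0 HB ?lt ?orbT // eq_sym (negPf b1).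
  + by move=> _ /=; ring.
  + by move=> _ _; rewrite i01 i10 /=; ring.
case: (eqVneq b i0) => [->|b0]; last case: (eqVneq b i1) => [->|b1] _; last first.
+ by move=> /(_ isT isT) lt; rewrite i01 /= !mulr0 !addr0 HB ?lt ?orbT // eq_sym (negPf b0).
+ by move=> _; rewrite i01 /=; ring.
by move=> _ _; rewrite i01 /=; ring.
Qed.

Lemma wval_det n (M : 'M[int]_n) : wval w M -> \det M = 1.
Proof. by move=> [A _ ->]; apply/eqP/slmx_det. Qed.

Lemma wprod_det n k (M : 'M[int]_n) : wprod n k M -> \det M = 1.
Proof.
elim: k M => [|k IH] M /=; first by move=> ->; rewrite det1.
by move=> [A [B [HA HB ->]]]; rewrite det_mulmx (wval_det HA) (IH _ HB) mulr1.
Qed.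

Lemma wprod_prod_of_at_most n k (A : SL n int) :
  wprod n k (slmx A) -> prod_of_at_most k (word_value w) A.
Proof.
elim: k A => [|k IH] A /=.
  by move=> A1; exists [::]; rewrite big_nil; split=> //; apply: val_inj.
move=> [T [M [[T' Tw TE] HM AE]]].
have dM : \det M == 1 by rewrite (wprod_det HM).
have [s [sk sw sE]] := IH (MkSL dM) HM.
exists (T' :: s); split=> //.
  by move=> y; rewrite inE => /orP[/eqP->|/sw].
by rewrite big_cons -sE; apply: val_inj; rewrite /= AE TE.
Qed.

Lemma slz_width : exists nw, forall n, (nw < n)%N -> forall A : SL n int,
  prod_of_at_most 87 (word_value w) A.
Proof.
have [m1 H1] := utri_wprod_ex w1; have [m2 H2] := ltri_wprod_ex w1.
have [m3 H3] := bottom_wprod_ex.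
exists (m1 + m2 + m3 + 1)%N => n nm A; apply: wprod_prod_of_at_most.
have n1 : (1 < n)%N by lia.
have [l [u [l' [u' [B [[Hl Hu] [Hl' Hu'] HB AE]]]]]] := stable_reduction n1 (SL_unit A).
have Wu M : utri M -> wprod n 16 M by apply: H1; lia.
have Wl M : ltri M -> wprod n 16 M by apply: H2; lia.
have dB : \det B = 1.
  have := eqP (slmx_det A); rewrite AE !det_mulmx.
  by rewrite (wprod_det (Wl l Hl)) (wprod_det (Wu u Hu)) (wprod_det (Wl l' Hl')) (wprod_det (Wu u' Hu')) !mul1r.
(* The product has 72 factors; the identity is a w-value, so it can be padded to 87. *)
rewrite AE; apply: (@wprod_mono _ _ _ (16 + 16 + 16 + 16 + 8)) => //.
by do 4?[apply: mprodM]; auto; apply: H3 => //; lia.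
Qed.

End Width.

Theorem theorem1p1 :
  (exists C : nat, SLZ_word_width_bound C) /\ SLZ_word_width_bound 87.
Proof.
have H : SLZ_word_width_bound 87 by move=> d w; apply: slz_width.
by split=> //; exists 87.
Qed.
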